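(* Let $d>0$, $\alpha_0\in\mathbb R$, $c\in\mathbb R\setminus\{0\}$, $\omega\in(0,\pi)\setminus\{\pi/2\}$, $\phi\in[0,2\pi)$, $\gamma\in(\tfrac12,1]$ and let $\{q_n\}_{n\in\mathbb N}\in\ell^1(\mathbb N)$ be real-valued. Let the pair $(X,\alpha)$, $X=\{x_n\colon n\in\mathbb N\}$, $\alpha=\{\alpha_n\}_{n\in\mathbb N}$, be given either by Model I, $$x_n=nd,\qquad \alpha_n=\alpha_0+\frac{c\sin(2\omega n+\phi)}{n^\gamma}+q_n,\qquad n\in\mathbb N,$$ or by Model II, $$x_n=nd+\frac{c\sin(2\omega n+\phi)}{n^\gamma}+q_n,\qquad \alpha_n=\alpha_0,\qquad n\in\mathbb N,$$ where $0<x_1<x_2<\dots$, $\inf_{n}|x_{n+1}-x_n|>0$ and $\sup_n|x_{n+1}-x_n|<\infty$. Let $\lambda\in\mathbb R$, $k:=\sqrt\lambda$ (with $\operatorname{Im}k\ge0$), be such that $|L(k)|\neq1$, where $L(k)=\cos(kd)+\alpha_0\frac{\sin(kd)}{2k}$ (with $L(0)=1+\frac{\alpha_0d}{2}$). Then the finite difference equation $(\ast)$ associated with $(X,\alpha,\lambda)$ (given in the context) has a basis of solutions $\xi^\pm(k)=\{\xi_n^\pm(k)\}_{n\ge N(k)}$ with the following asymptotics. (i) If $|L(k)|\in[0,+\infty)\setminus\{|\cos\omega|,1\}$, then $$\xi_n^\pm(k)=\Big(L(k)\pm\sqrt{(L(k))^2-1}\Big)^n(1+o(1))\quad\text{as }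 n\to\infty.$$ (ii) If $L(k)=\cos\omega$, then as $n\to\infty$ $$\xi_n^+(k)=\big(\cos(\omega n+\vartheta_+(k))+o(1)\big)f_n^+(\beta(k)),\qquad \xi_n^-(k)=\big(\sin(\omega n+\vartheta_+(k))+o(1)\big)f_n^-(\beta(k)).$$ If $L(k)=-\cos\omega$, then as $n\to\infty$ $$\xi_n^+(k)=(-1)^n\big(\cos(\omega n+\vartheta_-(k))+o(1)\big)f_n^+(\beta(k)),\qquad \xi_n^-(k)=(-1)^n\big(\sin(\omega n+\vartheta_-(k))+o(1)\big)f_n^-(\beta(k)).$$ Here $f_n^\pm(\beta)=\exp\big(\pm\frac{\beta n^{1-\gamma}}{1-\gamma}\big)$ if $\gamma<1$ and $f_n^\pm(\beta)=n^{\pm\beta}$ if $\gamma=1$; in the case of Model I $$\beta(k)=\Big|\frac{c\sin(kd)}{4k\sin\omega}\Big|,\qquad \vartheta_\pm(k)=\tfrac12\Big(\arg\Big(\mp\frac{c\sin(kd)}{k}\Big)+\phi\Big)$$ (for $k=0$: $\beta(0)=\big|\frac{cd}{4\sin\omega}\big|$, $\vartheta_\pm(0)=\frac12(\arg(\mp cd)+\phi)$), and in the case of Model II $$\beta(k)=\Big|\frac{c\alpha_0}{2}\Big|,\qquad \vartheta_\pm(k)=\tfrac12\big(\arg(ic\alpha_0)+\phi\big).$$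
   Context: Set $x_0:=0$, $s_n(k):=\sin(k(x_{n+1}-x_n))$, $c_n(k):=\cos(k(x_{n+1}-x_n))$; for $\lambda<0$ the number $k$ is purely imaginary and $\sin(ix)=i\sinh x$, $\cos(ix)=\cosh x$. The finite difference equation $(\ast)$: for $\lambda\ne0$, let $N(k)\in\mathbb N$ be such that $s_n(k)\ne0$ for all $n\ge N(k)$ (such $N(k)$ exists under the assumptions of the claim); the equation is $$-k\Big(\frac{\xi_{n-1}}{s_{n-1}(k)}+\frac{\xi_{n+1}}{s_n(k)}\Big)+\Big(\alpha_n+k\Big(\frac{c_{n-1}(k)}{s_{n-1}(k)}+\frac{c_n(k)}{s_n(k)}\Big)\Big)\xi_n=0,\qquad n\ge N(k)+1.$$ For $\lambda=0$ it is understood as its limit $k\to0$: $$-\Big(\frac{\xi_{n-1}}{x_n-x_{n-1}}+\frac{\xi_{n+1}}{x_{n+1}-x_n}\Big)+\Big(\alpha_n+\frac1{x_n-x_{n-1}}+\frac1{x_{n+1}-x_n}\Big)\xi_n=0,\qquad n\ge N(0)+1,$$ with any $N(0)\in\mathbb N$. Solutions are complex sequences $\{\xi_n\}_{n\ge N(k)}$; they form a two-dimensional complex vector space. In (i) any fixed choice of the branch of the square root $\sqrt{(L(k))^2-1}$ is allowed. If $\alpha_0=0$ in Model II, then $\beta(k)=0$ and $\arg 0$ may be taken to be any real number. *)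

(* Defs.v *)
From Stdlib Require Import Reals.
From Coquelicot Require Export Coquelicot.

Set Implicit Arguments.
Unset Strict Implicit.
Unset Printing Implicit Defensive.

Open Scope R_scope.

(* sin (a + ib) and cos (a + ib); on the imaginary axis this gives
   sin (ib) = i sinh b and cos (ib) = cosh b. *)
Definition Csin (z : C) : C :=
  (sin (Re z) * cosh (Im z), cos (Re z) * sinh (Im z)).
Definition Ccos (z : C) : C :=
  (cos (Re z) * cosh (Im z), - (sin (Re z) * sinh (Im z))).

(* The square root of a real number, with nonnegative imaginary part (and
   nonnegative real part). *)
Definition sqrt_real (lam : R) : C :=
  if Rle_dec 0 lam then RtoC (sqrt lam) else (Ci * sqrt (- lam))%C.

(* sin (k d) / k, continued by its limit d at k = 0. *)
Definition sin_over (k : C) (d : R) : C :=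
  if Ceq_dec k 0 then RtoC d else (Csin (k * d) / k)%C.

Definition Lfun (d alpha0 : R) (k : C) : C :=
  (Ccos (k * d) + alpha0 * (sin_over k d / 2))%C.

(* Sequences indexed by n = 1, 2, ... are functions on nat whose value at 0 is
   irrelevant, except that x 0 = 0 is imposed on the positions x. *)

Definition perturbation (c omega phi gam : R) (q : nat -> R) (n : nat) : R :=
  c * sin (2 * omega * INR n + phi) / Rpower (INR n) gam + q n.

Inductive model : Set := ModelI | ModelII.

Definition is_model (m : model) (d alpha0 c omega phi gam : R) (q : nat -> R)
    (x alpha : nat -> R) : Prop :=
  x 0%nat = 0 /\
  forall n : nat, (1 <= n)%nat ->
    match m with
    | ModelI =>
        x n = INR n * d /\
        alpha n = alpha0 + perturbation c omega phi gam q n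
    | ModelII =>
        x n = INR n * d + perturbation c omega phi gam q n /\
        alpha n = alpha0
    end.

Definition s_seq (x : nat -> R) (k : C) (n : nat) : C :=
  Csin (k * (x (n + 1)%nat - x n)%R)%C.
Definition c_seq (x : nat -> R) (k : C) (n : nat) : C :=
  Ccos (k * (x (n + 1)%nat - x n)%R)%C.

(* N is a possible value of N(k); any N is possible for k = 0. *)
Definition admissible (x : nat -> R) (k : C) (N : nat) : Prop :=
  k <> 0 -> forall n : nat, (N <= n)%nat -> s_seq x k n <> 0.

(* Left-hand side of the difference equation at n >= 1. *)
Definition fd_lhs (x alpha : nat -> R) (k : C) (xi : nat -> C) (n : nat) : C :=
  if Ceq_dec k 0 then
    let l := (x n - x (n - 1)%nat)%R in
    let r := (x (n + 1)%nat - x n)%R in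
    (- (xi (n - 1)%nat / l + xi (n + 1)%nat / r)
     + (alpha n + 1 / l + 1 / r) * xi n)%C
  else
    let s := s_seq x k in
    let co := c_seq x k in
    (- k * (xi (n - 1)%nat / s (n - 1)%nat + xi (n + 1)%nat / s n)
     + (alpha n + k * (co (n - 1)%nat / s (n - 1)%nat + co n / s n)) * xi n)%C.

(* A sequence {xi_n}_{n >= N} is represented by a function on nat whose values
   below N are irrelevant. *)
Definition is_solution (x alpha : nat -> R) (k : C) (N : nat) (xi : nat -> C)
    : Prop :=
  forall n : nat, (N + 1 <= n)%nat -> fd_lhs x alpha k xi n = 0.

Definition is_basis (x alpha : nat -> R) (k : C) (N : nat)
    (xip xim : nat -> C) : Prop :=
  is_solution x alpha k N xip /\
  is_solution x alpha k N xim /\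
  (forall a b : C,
     (forall n : nat, (N <= n)%nat -> (a * xip n + b * xim n)%C = 0) ->
     a = 0 /\ b = 0) /\
  (forall xi : nat -> C, is_solution x alpha k N xi ->
     exists a b : C,
       forall n : nat, (N <= n)%nat -> xi n = (a * xip n + b * xim n)%C).

(* xi_n = (u_n + o(1)) v_n as n -> oo, with a complex-valued o(1). *)
Definition asymp (xi u v : nat -> C) : Prop :=
  exists eps : nat -> C,
    filterlim eps eventually (locally (RtoC 0)) /\
    eventually (fun n => xi n = ((u n + eps n) * v n)%C).

(* f_n^+ (beta); f_n^- (beta) is f_growth gam (- beta) n. *)
Definition f_growth (gam beta : R) (n : nat) : R :=
  if Req_EM_T gam 1 then Rpower (INR n) beta
  else exp (beta * Rpower (INR n) (1 - gam) / (1 - gam)).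

Definition beta_exp (m : model) (d alpha0 c omega : R) (k : C) : R :=
  match m with
  | ModelI => Cmod (c * sin_over k d / (4 * sin omega)%R)
  | ModelII => Rabs (c * alpha0 / 2)
  end.

(* The complex number whose argument enters vartheta_+ and vartheta_-. *)
Definition phase_plus (m : model) (d alpha0 c : R) (k : C) : C :=
  match m with
  | ModelI => (- (c * sin_over k d))%C
  | ModelII => (Ci * c * alpha0)%C
  end.
Definition phase_minus (m : model) (d alpha0 c : R) (k : C) : C :=
  match m with
  | ModelI => (c * sin_over k d)%C
  | ModelII => (Ci * c * alpha0)%C
  end.

(* Any determination of the argument; every real a is an argument of 0. *)
Definition is_arg (z : C) (a : R) : Prop :=
  z = (Cmod z * (cos a, sin a))%C.

(* Main.v *)
Require Import Defs.
From Stdlib Require Import Reals Lra Lia Psatz IndefiniteDescription.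
From Coquelicot Require Import Coquelicot.
Open Scope R_scope.

(* Put psi' (x_n +) = (xi_(n+1) - cos (k l_n) xi_n) k / sin (k l_n), l_n = x_(n+1) - x_n:
   the difference equation becomes v_(n+1) = A_n v_n for v_n = (xi_n, psi' (x_n +)), where
   A_n has determinant 1. In Model II, moving the points x_n back to n d by the free
   propagator replaces the perturbation of the distances by a commutator. In both models one
   gets A_n = M + n^(-gamma) c sin (2 omega n + phi) K + (summable), with det M = 1 and
   tr M = 2 L (k).
   A solution mu^n v of the constant system is corrected to mu^n (v + n^(-gamma) h_n), h_n a
   trigonometric polynomial with frequencies shifted by +- 2 omega, so as to cancel the terms
   of order n^(-gamma). This is possible unless mu^2 = exp (+- 2 i omega), that is,
   L = +- cos omega; in that case the obstruction is absorbed by a scalar factor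
   exp (+- beta sum n^(-gamma)) once the phase theta is chosen correctly. As gamma > 1/2 the
   remaining errors are summable, and a Levinson type theorem turns the two approximate
   solutions into exact ones. *)

(** * Summable and vanishing sequences *)

(** The obstruction is spectral. A correction at frequency e has to solve (mu e - M) h = f, so it
    exists unless mu e is one of the eigenvalues mu, 1 / mu of M; as e = exp (+- 2 i omega) differs
    from 1, only mu e = 1 / mu can occur. At resonance the forcing couples the eigenvalues s z and s
    / z, with z = exp (i omega) and s = +- 1, and neither mode can be corrected alone. The ansatz is
    therefore a combination a z^n + a' z^(-n), and the uncorrectable components must cancel against
    the growth factor. With a = exp (i theta) / 2 and a' its conjugate, the modulus of this
    condition fixes beta and its argument fixes theta; passing from cosine to sine changes the sign
    of beta. The frequencies z^3 and z^(-3) that also appear are harmless since z^4 <> 1, which is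
    where omega <> pi / 2 enters. In the Levinson step the dominant solution is built by forward
    recursion from a late index, the other one from infinity by convergent matrix products. The
    condition |L| <> 1 makes the eigenvalues distinct and sin (k d) / k nonzero. *)

Definition l1 (a : nat -> C) : Prop := ex_series (fun n => Cmod (a n)).
Definition bdd (a : nat -> C) : Prop := exists B, forall n, Cmod (a n) <= B.
Definition vanishes (a : nat -> C) : Prop := is_lim_seq (fun n => Cmod (a n)) 0.

Lemma l1_le (a : nat -> C) (b : nat -> R) :
  (forall n, Cmod (a n) <= b n) -> ex_series b -> l1 a.
Proof.
  intros H Hb. apply (ex_series_le (K := R_AbsRing) (V := R_CompleteNormedModule)) with b; auto.
  intros n. simpl. unfold norm; simpl. unfold abs; simpl.
  rewrite Rabs_pos_eq; auto. apply Cmod_ge_0.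
Qed.

Lemma l1_ext (a b : nat -> C) : (forall n, a n = b n) -> l1 a -> l1 b.
Proof. intros H Ha. apply l1_le with (fun n => Cmod (a n)); auto. intros; rewrite H; lra. Qed.

Lemma l1_plus (a b : nat -> C) : l1 a -> l1 b -> l1 (fun n => a n + b n)%C.
Proof.
  intros Ha Hb. apply l1_le with (fun n => Cmod (a n) + Cmod (b n)).
  - intros; apply Cmod_triangle.
  - apply (ex_series_plus (V := R_NormedModule)); assumption.
Qed.

Lemma l1_opp (a : nat -> C) : l1 a -> l1 (fun n => - a n)%C.
Proof. intros Ha. apply l1_le with (fun n => Cmod (a n)); auto. intros; rewrite Cmod_opp; lra. Qed.

Lemma l1_minus (a b : nat -> C) : l1 a -> l1 b -> l1 (fun n => a n - b n)%C.
Proof. intros Ha Hb. apply l1_plus; auto. apply l1_opp; auto. Qed.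

Lemma l1_mult_bdd (a b : nat -> C) : l1 a -> bdd b -> l1 (fun n => a n * b n)%C.
Proof.
  intros Ha [B HB]. apply l1_le with (fun n => B * Cmod (a n)).
  - intros; rewrite Cmod_mult. rewrite Rmult_comm. apply Rmult_le_compat_r; auto. apply Cmod_ge_0.
  - apply (ex_series_scal (V := R_NormedModule) B); auto.
Qed.

Lemma l1_bdd_mult (a b : nat -> C) : bdd a -> l1 b -> l1 (fun n => a n * b n)%C.
Proof. intros. apply l1_ext with (fun n => b n * a n)%C. intros; ring. now apply l1_mult_bdd. Qed.

Lemma l1_shift (a : nat -> C) (k : nat) : l1 a <-> l1 (fun n => a (k + n)%nat).
Proof. apply (ex_series_incr_n (V := R_NormedModule) (fun n => Cmod (a n)) k). Qed.

Lemma l1_eventually (a b : nat -> C) (N : nat) :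
  (forall n, (N <= n)%nat -> a n = b n) -> l1 a -> l1 b.
Proof.
  intros H Ha. apply l1_shift with N. apply l1_ext with (fun n => a (N + n)%nat).
  intros; apply H; lia. now apply l1_shift.
Qed.

Lemma vanishes_le (a : nat -> C) (b : nat -> R) :
  eventually (fun n => Cmod (a n) <= b n) -> is_lim_seq b 0 -> vanishes a.
Proof.
  intros [N H] Hb. unfold vanishes.
  apply is_lim_seq_le_le_loc with (fun _ => 0) b; auto using is_lim_seq_const.
  exists N. intros n Hn. split; auto. apply Cmod_ge_0.
Qed.

Lemma l1_vanishes (a : nat -> C) : l1 a -> vanishes a.
Proof. apply ex_series_lim_0. Qed.

Lemma bdd_eventually (a : nat -> C) (B : R) (N : nat) :
  (forall n, (N <= n)%nat -> Cmod (a n) <= B) -> bdd a.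
Proof.
  revert B. induction N as [|N IH]; intros B H.
  - exists B. intros; apply H; lia.
  - apply (IH (Rmax B (Cmod (a N)))). intros n Hn.
    destruct (Nat.eq_dec n N) as [->|Hne]; [apply Rmax_r|].
    eapply Rle_trans; [apply H; lia | apply Rmax_l].
Qed.

Lemma vanishes_spec (a : nat -> C) :
  vanishes a <->
  forall eps, 0 < eps -> exists N, forall n, (N <= n)%nat -> Cmod (a n) < eps.
Proof.
  unfold vanishes. rewrite <- is_lim_seq_spec. split.
  - intros H eps Heps. destruct (H (mkposreal eps Heps)) as [N HN].
    exists N. intros n Hn. specialize (HN n Hn). simpl in HN.
    rewrite Rminus_0_r, Rabs_pos_eq in HN; auto using Cmod_ge_0.
  - intros H eps. destruct (H eps (cond_pos eps)) as [N HN].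
    exists N. intros n Hn. rewrite Rminus_0_r, Rabs_pos_eq; auto using Cmod_ge_0.
Qed.

Lemma vanishes_bdd (a : nat -> C) : vanishes a -> bdd a.
Proof.
  intros H. destruct (proj1 (vanishes_spec a) H 1 Rlt_0_1) as [N HN].
  apply bdd_eventually with 1 N. intros; left; auto.
Qed.

Lemma l1_bdd (a : nat -> C) : l1 a -> bdd a.
Proof. intros; now apply vanishes_bdd, l1_vanishes. Qed.

Lemma l1_mult (a b : nat -> C) : l1 a -> l1 b -> l1 (fun n => a n * b n)%C.
Proof. intros; apply l1_mult_bdd; auto using l1_bdd. Qed.

Lemma bdd_const (c : C) : bdd (fun _ => c).
Proof. exists (Cmod c). intros; lra. Qed.

Lemma bdd_plus (a b : nat -> C) : bdd a -> bdd b -> bdd (fun n => a n + b n)%C.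
Proof.
  intros [A HA] [B HB]. exists (A + B). intros n.
  eapply Rle_trans; [apply Cmod_triangle|]. specialize (HA n); specialize (HB n); lra.
Qed.

Lemma bdd_opp (a : nat -> C) : bdd a -> bdd (fun n => - a n)%C.
Proof. intros [A HA]. exists A. intros n. rewrite Cmod_opp. auto. Qed.

Lemma bdd_minus (a b : nat -> C) : bdd a -> bdd b -> bdd (fun n => a n - b n)%C.
Proof. intros. apply bdd_plus; auto using bdd_opp. Qed.

Lemma bdd_mult (a b : nat -> C) : bdd a -> bdd b -> bdd (fun n => a n * b n)%C.
Proof.
  intros [A HA] [B HB]. exists (A * B). intros n. rewrite Cmod_mult.
  apply Rmult_le_compat; auto using Cmod_ge_0.
Qed.

Lemma bdd_S (a : nat -> C) : bdd a -> bdd (fun n => a (S n)).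
Proof. intros [A HA]. exists A. auto. Qed.

Lemma vanishes_ext (a b : nat -> C) : (forall n, a n = b n) -> vanishes a -> vanishes b.
Proof. intros H. apply is_lim_seq_ext. intros; now rewrite H. Qed.

Lemma vanishes_plus (a b : nat -> C) :
  vanishes a -> vanishes b -> vanishes (fun n => a n + b n)%C.
Proof.
  intros Ha Hb. apply vanishes_le with (fun n => Cmod (a n) + Cmod (b n)).
  - exists 0%nat. intros; apply Cmod_triangle.
  - replace (Finite 0) with (Finite (0 + 0)) by (f_equal; lra).
    now apply is_lim_seq_plus'.
Qed.

Lemma vanishes_mult_bdd (a b : nat -> C) :
  vanishes a -> bdd b -> vanishes (fun n => a n * b n)%C.
Proof.
  intros Ha [B HB]. apply vanishes_le with (fun n => Cmod (a n) * B).
  - exists 0%nat. intros; rewrite Cmod_mult. apply Rmult_le_compat_l; auto using Cmod_ge_0.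
  - replace (Finite 0) with (Rbar_mult 0 B) by (simpl; f_equal; lra).
    now apply is_lim_seq_scal_r.
Qed.

Lemma vanishes_opp (a : nat -> C) : vanishes a -> vanishes (fun n => - a n)%C.
Proof. apply is_lim_seq_ext. intros; now rewrite Cmod_opp. Qed.

Lemma vanishes_minus (a b : nat -> C) :
  vanishes a -> vanishes b -> vanishes (fun n => a n - b n)%C.
Proof. intros; apply vanishes_plus; auto using vanishes_opp. Qed.

Lemma vanishes_shift (a : nat -> C) (k : nat) :
  vanishes a <-> vanishes (fun n => a (k + n)%nat).
Proof.
  unfold vanishes. rewrite (is_lim_seq_incr_n _ k).
  split; apply is_lim_seq_ext; intros; now rewrite Nat.add_comm.
Qed.

(** The tails [T] act as a potential for the errors [q]: the identity [T n = q n + T (S n)] makes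
    the later inductions telescope, and [T] doubles as a rate of convergence. *)
Lemma series_tail (q : nat -> R) :
  (forall n, 0 <= q n) -> ex_series q ->
  exists T : nat -> R,
    (forall n, T n = q n + T (S n)) /\ (forall n, 0 <= T n) /\ is_lim_seq T 0.
Proof.
  intros Hq Hs. exists (fun n => Series (fun k => q (n + k)%nat)).
  assert (He : forall n, ex_series (fun k => q (n + k)%nat)).
  { intros n. now apply (ex_series_incr_n (V := R_NormedModule) q n). }
  split; [|split].
  - intros n. rewrite Series_incr_1; auto. rewrite Nat.add_0_r. f_equal.
    apply Series_ext. intros; f_equal; lia.
  - intros n. replace 0 with (Series (fun _ => 0 * 0)).
    + apply Series_le; auto. intros k; rewrite Rmult_0_l; split; [lra|auto].
    + rewrite Series_scal_l; ring.
  - apply is_lim_seq_incr_1.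
    apply is_lim_seq_ext with (fun n => Series q - sum_n q n).
    + intros n. rewrite (Series_incr_n q (S n)); [|lia|auto].
      simpl pred. rewrite sum_n_Reals. ring_simplify. reflexivity.
    + replace (Finite 0) with (Finite (Series q - Series q)) by (f_equal; lra).
      apply is_lim_seq_minus'; [apply is_lim_seq_const|].
      apply Series_correct in Hs. exact Hs.
Qed.

Lemma Cmod_le_ReIm (z : C) : Cmod z <= Rabs (Re z) + Rabs (Im z).
Proof.
  replace z with (RtoC (Re z) + Ci * RtoC (Im z))%C at 1
    by (apply injective_projections; simpl; unfold Re, Im; ring).
  eapply Rle_trans; [apply Cmod_triangle|]. rewrite Cmod_mult, !Cmod_R, Cmod_Ci. lra.
Qed.

(** Completeness of the reals, applied to real and imaginary parts. The rate [T] is kept for the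
    limit because the limit will have to be shown close to an initial value. *)
Lemma C_cauchy_limit (x : nat -> C) (T : nat -> R) :
  is_lim_seq T 0 -> (forall n m, (n <= m)%nat -> Cmod (x m - x n) <= T n) ->
  exists l, vanishes (fun n => x n - l)%C /\ forall n, Cmod (l - x n) <= T n.
Proof.
  intros HT H.
  assert (HR : forall f : C -> R, (forall z w, f z - f w = f (z - w)%C) ->
    (forall z, Rabs (f z) <= Cmod z) -> exists l, is_lim_seq (fun n => f (x n)) (Finite l)).
  { intros f Hf1 Hf2. apply ex_lim_seq_cauchy_corr. intros eps.
    destruct (proj2 (is_lim_seq_spec T 0) HT (pos_div_2 eps)) as [N HN].
    exists N. intros n m Hn Hm. simpl in HN.
    assert (Hk : forall k, (N <= k)%nat -> Rabs (f (x k) - f (x N)) < eps / 2).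
    { intros k Hk. rewrite Hf1. eapply Rle_lt_trans; [apply Hf2|].
      eapply Rle_lt_trans; [apply H; auto|].
      specialize (HN N (Nat.le_refl _)). rewrite Rminus_0_r in HN.
      eapply Rle_lt_trans; [apply Rle_abs|auto]. }
    pose proof (Hk n Hn). pose proof (Hk m Hm).
    replace (f (x n) - f (x m)) with ((f (x n) - f (x N)) - (f (x m) - f (x N))) by ring.
    eapply Rle_lt_trans; [apply Rabs_triang|]. rewrite Rabs_Ropp. lra. }
  destruct (HR Re) as [a Ha]; [intros [] []; simpl; ring|apply re_le_Cmod|].
  destruct (HR Im) as [b Hb]; [intros [] []; simpl; ring| |].
  { intros z. eapply Rle_trans; [|apply Rmax_Cmod]. apply Rmax_r. }
  assert (Hl : vanishes (fun n => x n - (a, b))%C).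
  { apply vanishes_le with (fun n => Rabs (Re (x n) - a) + Rabs (Im (x n) - b)).
    - exists 0%nat. intros n _.
      eapply Rle_trans; [apply Cmod_le_ReIm|]. right. reflexivity.
    - replace (Finite 0) with (Finite (0 + 0)) by (f_equal; lra).
      apply is_lim_seq_plus'; apply (proj1 (is_lim_seq_abs_0 _));
      [replace (Finite 0) with (Finite (a - a)) by (f_equal; lra)
      |replace (Finite 0) with (Finite (b - b)) by (f_equal; lra)];
      apply is_lim_seq_minus'; auto using is_lim_seq_const. }
  change (R*R)%type with C in Hl; revert Hl; generalize ((a, b) : C); intros l Hl. exists l. split; auto.
  intros n. apply le_epsilon. intros eps Heps.
  destruct (proj1 (vanishes_spec _) Hl eps Heps) as [N HN].
  specialize (HN (Nat.max n N) (Nat.le_max_r _ _)).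
  specialize (H n (Nat.max n N) (Nat.le_max_l _ _)).
  replace (l - x n)%C
    with ((x (Nat.max n N) - x n) + - (x (Nat.max n N) - l))%C by ring.
  eapply Rle_trans; [apply Cmod_triangle|]. rewrite Cmod_opp. lra.
Qed.

(** * A Levinson theorem for approximate solutions *)

Lemma vanishes_const (c : C) : vanishes (fun _ => c) -> c = 0.
Proof.
  intros H. apply Cmod_eq_0.
  assert (E : Finite (Cmod c) = Finite 0).
  { rewrite <- (Lim_seq_const (Cmod c)). now apply is_lim_seq_unique. }
  now injection E.
Qed.

Lemma limit_unique (x : nat -> C) (l l' : C) :
  vanishes (fun n => x n - l)%C -> vanishes (fun n => x n - l')%C -> l = l'.
Proof.
  intros H H'.
  assert (E : (l - l')%C = 0).
  { apply vanishes_const.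
    apply vanishes_ext with (fun n => (x n - l') - (x n - l))%C; [intros; ring|].
    now apply vanishes_minus. }
  replace l with ((l - l') + l')%C by ring. rewrite E. ring.
Qed.

(** A discrete Gronwall argument. The sum of the two moduli grows at most by the factor 1 + 2 q_n <=
    exp (2 q_n), so its product with exp (2 T_n) never increases and [B] bounds it. The increments
    of [x] are then at most [B * q n] and telescope against [T]. Here [x] is the component that
    converges and [y] the one that may contract. *)
Lemma perturbed_limit (x y : nat -> C) (q T : nat -> R) :
  (forall n, 0 <= q n) ->
  (forall n, T n = q n + T (S n)) -> (forall n, 0 <= T n) -> is_lim_seq T 0 ->
  (forall n, Cmod (x (S n) - x n) <= q n * (Cmod (x n) + Cmod (y n))) ->
  (forall n, Cmod (y (S n)) <= Cmod (y n) + q n * (Cmod (x n) + Cmod (y n))) ->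
  let B := (Cmod (x 0%nat) + Cmod (y 0%nat)) * exp (2 * T 0%nat) in
  (forall n, Cmod (x n) + Cmod (y n) <= B) /\
  exists l, vanishes (fun n => x n - l)%C /\ Cmod (l - x 0%nat) <= B * T 0%nat.
Proof.
  intros Hq HT HT0 HTl Hx Hy B.
  set (s := fun n => Cmod (x n) + Cmod (y n)).
  assert (Hs0 : forall n, 0 <= s n).
  { intros n. unfold s. pose proof (Cmod_ge_0 (x n)); pose proof (Cmod_ge_0 (y n)); lra. }
  assert (Hexp : forall n, s n * exp (2 * T n) <= B).
  { induction n as [|n IH]; [unfold s, B; lra|].
    eapply Rle_trans; [|apply IH]. rewrite (HT n).
    replace (2 * (q n + T (S n))) with (2 * q n + 2 * T (S n)) by ring.
    rewrite exp_plus, <- Rmult_assoc.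
    apply Rmult_le_compat_r; [left; apply exp_pos|].
    assert (s (S n) <= s n * (1 + 2 * q n)).
    { unfold s. specialize (Hx n). specialize (Hy n).
      pose proof (Cmod_triangle (x (S n) - x n) (x n)) as Ht.
      replace (x (S n) - x n + x n)%C with (x (S n)) in Ht by ring. lra. }
    eapply Rle_trans; [eassumption|]. apply Rmult_le_compat_l; auto.
    apply exp_ineq1_le. }
  assert (HB : forall n, s n <= B).
  { intros n. eapply Rle_trans; [|apply (Hexp n)].
    rewrite <- (Rmult_1_r (s n)) at 1. apply Rmult_le_compat_l; auto.
    rewrite <- exp_0. destruct (HT0 n) as [H|H].
    - left; apply exp_increasing; lra.
    - rewrite <- H. right; f_equal; ring. }
  split; [exact HB|].
  destruct (C_cauchy_limit x (fun n => B * T n)) as [l [Hl Hl']].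
  - replace (Finite 0) with (Rbar_mult B 0) by (simpl; f_equal; lra).
    now apply is_lim_seq_scal_l.
  - intros n m Hnm.
    enough (H : Cmod (x m - x n) <= B * (T n - T m)).
    { eapply Rle_trans; [exact H|]. apply Rmult_le_compat_l.
      - eapply Rle_trans; [apply (Hs0 0%nat)|apply HB].
      - specialize (HT0 m); lra. }
    induction Hnm as [|m Hnm IH].
    + replace (x n - x n)%C with (RtoC 0) by ring. rewrite Cmod_0. right; ring.
    + replace (x (S m) - x n)%C with ((x (S m) - x m) + (x m - x n))%C by ring.
      eapply Rle_trans; [apply Cmod_triangle|].
      specialize (Hx m). rewrite (HT m) in IH.
      assert (q m * s m <= q m * B) by (apply Rmult_le_compat_l; auto).
      unfold s in *. nra.
  - exists l. split; auto.
Qed.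

(** The row vector [p] times N_n N_(n+1) ... N_(n+j-1). Multiplying a row from the right gives a
    forward recursion in [j], although the limit is to solve a backward recursion in [n]. *)
Fixpoint row_product (N11 N12 N21 N22 : nat -> C) (n : nat) (p : C * C) (j : nat) : C * C :=
  match j with
  | O => p
  | S j => let r := row_product N11 N12 N21 N22 n p j in
           (fst r * N11 (n + j)%nat + snd r * N21 (n + j)%nat,
            fst r * N12 (n + j)%nat + snd r * N22 (n + j)%nat)%C
  end.

(* The solution is z_n = lim_m N_n N_(n+1) ... N_(m-1) (0, 1)^T; the rows of the
   partial products solve a forward recursion to which [perturbed_limit] applies. *)
Lemma backward_solution (N11 N12 N21 N22 : nat -> C) (q : nat -> R) :
  (forall n, 0 <= q n) -> ex_series q ->
  (forall n, Cmod (N11 n) <= 1 + q n) -> (forall n, Cmod (N12 n) <= q n) ->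
  (forall n, Cmod (N21 n) <= q n) -> (forall n, Cmod (N22 n - 1) <= q n) ->
  exists z1 z2 : nat -> C,
    (forall n, z1 n = N11 n * z1 (S n) + N12 n * z2 (S n))%C /\
    (forall n, z2 n = N21 n * z1 (S n) + N22 n * z2 (S n))%C /\
    vanishes z1 /\ vanishes (fun n => z2 n - 1)%C.
Proof.
  intros Hq Hs H11 H12 H21 H22.
  destruct (series_tail q Hq Hs) as [T [HT [HT0 HTl]]].
  set (row := row_product N11 N12 N21 N22).
  assert (Hlim : forall n p, exists l, vanishes (fun j => snd (row n p j) - l)%C /\
     Cmod (l - snd p) <= ((Cmod (snd p) + Cmod (fst p)) * exp (2 * T n)) * T n).
  { intros n p.
    destruct (perturbed_limit (fun j => snd (row n p j)) (fun j => fst (row n p j))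
       (fun j => q (n + j)%nat) (fun j => T (n + j)%nat)) as [_ [l [Hl Hl']]].
    - auto.
    - intros j. rewrite HT. do 2 f_equal. lia.
    - auto.
    - apply is_lim_seq_ext with (fun j => T (j + n)%nat).
      + intros; f_equal; lia.
      + now apply (is_lim_seq_incr_n T n).
    - intros j. simpl. fold row.
      replace (fst (row n p j) * N12 (n + j)%nat + snd (row n p j) * N22 (n + j)%nat
        - snd (row n p j))%C with (fst (row n p j) * N12 (n + j)%nat
        + snd (row n p j) * (N22 (n + j)%nat - 1))%C by ring.
      eapply Rle_trans; [apply Cmod_triangle|]. rewrite !Cmod_mult.
      specialize (H12 (n + j)%nat); specialize (H22 (n + j)%nat).
      pose proof (Cmod_ge_0 (fst (row n p j))). pose proof (Cmod_ge_0 (snd (row n p j))).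
      nra.
    - intros j. simpl. fold row.
      eapply Rle_trans; [apply Cmod_triangle|]. rewrite !Cmod_mult.
      specialize (H11 (n + j)%nat); specialize (H21 (n + j)%nat).
      pose proof (Cmod_ge_0 (fst (row n p j))). pose proof (Cmod_ge_0 (snd (row n p j))).
      nra.
    - exists l. split; auto. simpl in Hl'. rewrite Nat.add_0_r in Hl'. exact Hl'. }
  (* Associativity: the leftmost factor is split off instead of the rightmost one. In the limit this
     becomes the backward recursion for [z1] and [z2]. *)
  assert (Hrow : forall n p j,
    row n p (S j) = row (S n) (fst p * N11 n + snd p * N21 n, fst p * N12 n + snd p * N22 n)%C j).
  { intros n p. induction j as [|j IH].
    - unfold row; simpl. rewrite Nat.add_0_r. reflexivity.
    - change (row n p (S (S j))) with
        (fst (row n p (S j)) * N11 (n + S j)%nat + snd (row n p (S j)) * N21 (n + S j)%nat,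
         fst (row n p (S j)) * N12 (n + S j)%nat + snd (row n p (S j)) * N22 (n + S j)%nat)%C.
      rewrite IH. replace (n + S j)%nat with (S n + j)%nat by lia. reflexivity. }
  assert (Hlin : forall n p j,
    row n p j = (fst p * fst (row n (RtoC 1, RtoC 0) j) + snd p * fst (row n (RtoC 0, RtoC 1) j),
                 fst p * snd (row n (RtoC 1, RtoC 0) j) + snd p * snd (row n (RtoC 0, RtoC 1) j))%C).
  { intros n [a b]. induction j as [|j IH].
    - unfold row; simpl. f_equal; ring.
    - assert (Hr : forall p, row n p (S j) =
        (fst (row n p j) * N11 (n + j)%nat + snd (row n p j) * N21 (n + j)%nat,
         fst (row n p j) * N12 (n + j)%nat + snd (row n p j) * N22 (n + j)%nat)%C)
        by reflexivity.
      rewrite !Hr, IH. cbn [fst snd]. f_equal; ring. }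
  (* [z1 n] and [z2 n] form the second column of the infinite product starting at [n]. The bound
     stored with each limit forces them to 0 and 1 as n grows. *)
  destruct (functional_choice (fun n l => vanishes (fun j => snd (row n (RtoC 1, RtoC 0) j) - l)%C /\
     Cmod (l - 0) <= ((Cmod 0 + Cmod 1) * exp (2 * T n)) * T n)) as [z1 Hz1].
  { intros n. apply (Hlim n (RtoC 1, RtoC 0)). }
  destruct (functional_choice (fun n l => vanishes (fun j => snd (row n (RtoC 0, RtoC 1) j) - l)%C /\
     Cmod (l - 1) <= ((Cmod 1 + Cmod 0) * exp (2 * T n)) * T n)) as [z2 Hz2].
  { intros n. apply (Hlim n (RtoC 0, RtoC 1)). }
  assert (Hlim2 : forall n a b,
    vanishes (fun j => snd (row n (a, b) j) - (a * z1 n + b * z2 n))%C).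
  { intros n a b.
    apply vanishes_ext with (fun j =>
      (snd (row n (RtoC 1, RtoC 0) j) - z1 n) * a + (snd (row n (RtoC 0, RtoC 1) j) - z2 n) * b)%C.
    - intros j. cbv beta. rewrite (Hlin n (a, b) j). simpl. ring.
    - apply vanishes_plus; apply vanishes_mult_bdd; auto using bdd_const; [apply Hz1|apply Hz2]. }
  assert (HTn : forall c d, is_lim_seq (fun n => ((c + d) * exp (2 * T n)) * T n) 0).
  { intros c d.
    replace (Finite 0) with (Finite (((c + d) * exp (2 * 0)) * 0)) by (f_equal; ring).
    apply is_lim_seq_mult'; auto. apply is_lim_seq_mult'; [apply is_lim_seq_const|].
    apply (is_lim_seq_continuous (fun t => exp (2 * t)) T 0); auto.
    apply derivable_continuous_pt. reg. }
  exists z1, z2. repeat split.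
  - intros n. apply limit_unique with (fun j => snd (row n (RtoC 1, RtoC 0) (S j))).
    + apply (vanishes_shift (fun j => snd (row n (RtoC 1, RtoC 0) j) - z1 n)%C 1). apply Hz1.
    + eapply vanishes_ext; [|apply (Hlim2 (S n) (N11 n) (N12 n))].
      intros j. rewrite Hrow. simpl fst. simpl snd.
      replace (1 * N11 n + 0 * N21 n)%C with (N11 n) by ring.
      replace (1 * N12 n + 0 * N22 n)%C with (N12 n) by ring. reflexivity.
  - intros n. apply limit_unique with (fun j => snd (row n (RtoC 0, RtoC 1) (S j))).
    + apply (vanishes_shift (fun j => snd (row n (RtoC 0, RtoC 1) j) - z2 n)%C 1). apply Hz2.
    + eapply vanishes_ext; [|apply (Hlim2 (S n) (N21 n) (N22 n))].
      intros j. rewrite Hrow. simpl fst. simpl snd.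
      replace (0 * N11 n + 1 * N21 n)%C with (N21 n) by ring.
      replace (0 * N12 n + 1 * N22 n)%C with (N22 n) by ring. reflexivity.
  - eapply vanishes_le; [|apply (HTn (Cmod 0) (Cmod 1))]. exists 0%nat. intros n _.
    replace (z1 n) with (z1 n - 0)%C at 1 by ring. apply Hz1.
  - eapply vanishes_le; [|apply (HTn (Cmod 1) (Cmod 0))]. exists 0%nat. intros n _. apply Hz2.
Qed.

(** [rr] solves the unperturbed recursion with multiplier [rho]. From an index [m] on, [y] differs
    from its free continuation [rr n / rr m * y m] by at most [B * T m], because the contractions do
    not amplify the errors. First [m] is chosen to make this small; then the free part decays. *)
Lemma vanishes_contraction (y rho rr : nat -> C) (q T : nat -> R) (B : R) :
  (forall n, T n = q n + T (S n)) -> (forall n, 0 <= T n) -> is_lim_seq T 0 -> 0 <= B ->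
  (forall n, rr n <> 0) -> (forall n, rr (S n) = rho n * rr n)%C ->
  (forall n, Cmod (rho n) <= 1) -> vanishes rr ->
  (forall n, Cmod (y (S n) - rho n * y n) <= B * q n) ->
  vanishes y.
Proof.
  intros HT HT0 HTl HB HR0 HR Hrho HRv Hy.
  apply vanishes_spec. intros eps Heps.
  destruct (proj2 (is_lim_seq_spec T 0) HTl (mkposreal (eps / 2 / (B + 1))
     ltac:(apply Rdiv_lt_0_compat; lra))) as [m Hm].
  specialize (Hm m (Nat.le_refl _)). simpl in Hm. rewrite Rminus_0_r, Rabs_pos_eq in Hm; auto.
  assert (HTm : B * T m < eps / 2).
  { apply Rle_lt_trans with ((B + 1) * T m).
    - specialize (HT0 m); nra.
    - apply Rmult_lt_reg_l with (/ (B + 1)); [apply Rinv_0_lt_compat; lra|].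
      rewrite <- Rmult_assoc, Rinv_l, Rmult_1_l by lra.
      eapply Rlt_le_trans; [exact Hm|]. right; field; lra. }
  assert (Hk : forall n, (m <= n)%nat ->
    Cmod (y n - rr n / rr m * y m) <= B * (T m - T n)).
  { intros n Hn. induction Hn as [|n Hn IH].
    - replace (y m - rr m / rr m * y m)%C with (RtoC 0) by (field; apply HR0).
      rewrite Cmod_0. right; ring.
    - replace (y (S n) - rr (S n) / rr m * y m)%C
        with ((y (S n) - rho n * y n) + rho n * (y n - rr n / rr m * y m))%C
        by (rewrite HR; field; apply HR0).
      eapply Rle_trans; [apply Cmod_triangle|]. rewrite Cmod_mult.
      specialize (Hy n). rewrite (HT n) in IH. specialize (Hrho n).
      pose proof (Cmod_ge_0 (y n - rr n / rr m * y m)).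
      pose proof (Cmod_ge_0 (rho n)). nra. }
  destruct (proj1 (vanishes_spec _) (vanishes_mult_bdd rr (fun _ => / rr m * y m)%C HRv (bdd_const _))
     (eps / 2) ltac:(lra)) as [N HN].
  exists (Nat.max m N). intros n Hn.
  specialize (Hk n ltac:(lia)). specialize (HN n ltac:(lia)).
  replace (y n) with ((y n - rr n / rr m * y m) + rr n * (/ rr m * y m))%C
    by (field; apply HR0).
  eapply Rle_lt_trans; [apply Cmod_triangle|].
  specialize (HT0 n). nra.
Qed.

(** The system is diag (1, [rho]) plus a summable error. It is started from (1, 0) at an index [n0]
    so late that exp (2 T) T < 1; the limit of the first component then lies at distance less than 1
    from 1, hence is nonzero, and dividing by it normalises the solution. *)
Lemma forward_solution (E11 E12 E21 E22 rho rr : nat -> C) (q : nat -> R) :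
  (forall n, 0 <= q n) -> ex_series q ->
  (forall n, Cmod (E11 n) <= q n) -> (forall n, Cmod (E12 n) <= q n) ->
  (forall n, Cmod (E21 n) <= q n) -> (forall n, Cmod (E22 n) <= q n) ->
  (forall n, rr n <> 0) -> (forall n, rr (S n) = rho n * rr n)%C ->
  (forall n, Cmod (rho n) <= 1) -> vanishes rr ->
  exists (n0 : nat) (y1 y2 : nat -> C),
    (forall n, (n0 <= n)%nat -> y1 (S n) = (1 + E11 n) * y1 n + E12 n * y2 n)%C /\
    (forall n, (n0 <= n)%nat -> y2 (S n) = E21 n * y1 n + (rho n + E22 n) * y2 n)%C /\
    vanishes (fun n => y1 n - 1)%C /\ vanishes y2.
Proof.
  intros Hq Hs H11 H12 H21 H22 HR0 HR Hrho HRv.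
  destruct (series_tail q Hq Hs) as [T [HT [HT0 HTl]]].
  assert (HTn : is_lim_seq (fun n => exp (2 * T n) * T n) 0).
  { replace (Finite 0) with (Finite (exp (2 * 0) * 0)) by (f_equal; ring).
    apply is_lim_seq_mult'; auto.
    apply (is_lim_seq_continuous (fun t => exp (2 * t)) T 0); auto.
    apply derivable_continuous_pt. reg. }
  destruct (proj2 (is_lim_seq_spec _ 0) HTn (mkposreal 1 Rlt_0_1)) as [n0 Hn0].
  specialize (Hn0 n0 (Nat.le_refl _)). simpl in Hn0. rewrite Rminus_0_r, Rabs_pos_eq in Hn0.
  2: { apply Rmult_le_pos; auto. left; apply exp_pos. }
  set (Y := fix Y (k : nat) : C * C := match k with
    | O => (RtoC 1, RtoC 0)
    | S k => ((1 + E11 (n0 + k)%nat) * fst (Y k) + E12 (n0 + k)%nat * snd (Y k),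
              E21 (n0 + k)%nat * fst (Y k) + (rho (n0 + k)%nat + E22 (n0 + k)%nat) * snd (Y k))%C
    end).
  assert (HTsh : is_lim_seq (fun k => T (n0 + k)%nat) 0).
  { apply is_lim_seq_ext with (fun k => T (k + n0)%nat); [intros; f_equal; lia|].
    now apply (is_lim_seq_incr_n T n0). }
  destruct (perturbed_limit (fun k => fst (Y k)) (fun k => snd (Y k))
     (fun k => q (n0 + k)%nat) (fun k => T (n0 + k)%nat)) as [HB [l [Hl Hl']]]; auto.
  { intros k. rewrite HT. do 2 f_equal. lia. }
  { intros k. simpl.
    match goal with |- Cmod ?z <= _ =>
      replace z with (E11 (n0 + k)%nat * fst (Y k) + E12 (n0 + k)%nat * snd (Y k))%C by ring end.
    eapply Rle_trans; [apply Cmod_triangle|]. rewrite !Cmod_mult.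
    specialize (H11 (n0 + k)%nat); specialize (H12 (n0 + k)%nat).
    pose proof (Cmod_ge_0 (fst (Y k))). pose proof (Cmod_ge_0 (snd (Y k))). nra. }
  { intros k. simpl.
    match goal with |- Cmod ?z <= _ =>
      replace z with (rho (n0 + k)%nat * snd (Y k) +
        (E21 (n0 + k)%nat * fst (Y k) + E22 (n0 + k)%nat * snd (Y k)))%C by ring end.
    eapply Rle_trans; [apply Cmod_triangle|].
    eapply Rle_trans; [apply Rplus_le_compat_l, Cmod_triangle|]. rewrite !Cmod_mult.
    specialize (H21 (n0 + k)%nat); specialize (H22 (n0 + k)%nat). specialize (Hrho (n0 + k)%nat).
    pose proof (Cmod_ge_0 (fst (Y k))). pose proof (Cmod_ge_0 (snd (Y k))). nra. }
  set (B := (Cmod (fst (Y 0%nat)) + Cmod (snd (Y 0%nat))) * exp (2 * T (n0 + 0)%nat)) in *.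
  assert (Hv2 : vanishes (fun k => snd (Y k))).
  { apply vanishes_contraction with (fun k => rho (n0 + k)%nat) (fun k => rr (n0 + k)%nat)
      (fun k => q (n0 + k)%nat) (fun k => T (n0 + k)%nat) B; auto.
    - intros k. rewrite HT. do 2 f_equal. lia.
    - eapply Rle_trans; [|apply (HB 0%nat)].
      pose proof (Cmod_ge_0 (fst (Y 0%nat))). pose proof (Cmod_ge_0 (snd (Y 0%nat))). lra.
    - intros k. rewrite <- HR. f_equal. lia.
    - now apply (vanishes_shift rr n0).
    - intros k. simpl.
      match goal with |- Cmod ?z <= _ =>
        replace z with (E21 (n0 + k)%nat * fst (Y k) + E22 (n0 + k)%nat * snd (Y k))%C by ring end.
      eapply Rle_trans; [apply Cmod_triangle|]. rewrite !Cmod_mult.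
      specialize (H21 (n0 + k)%nat); specialize (H22 (n0 + k)%nat). specialize (HB k).
      specialize (Hq (n0 + k)%nat).
      pose proof (Cmod_ge_0 (fst (Y k))). pose proof (Cmod_ge_0 (snd (Y k))). nra. }
  assert (Hl0 : l <> 0).
  { intros E. subst l. unfold B in Hl'. simpl in Hl'.
    replace (0 - 1)%C with (- (1))%C in Hl' by ring.
    rewrite Cmod_opp, Cmod_1, Cmod_0, Nat.add_0_r in Hl'. lra. }
  exists n0, (fun n => fst (Y (n - n0)%nat) / l)%C, (fun n => snd (Y (n - n0)%nat) / l)%C.
  repeat split.
  - intros n Hn. replace (S n - n0)%nat with (S (n - n0)) by lia. simpl.
    replace (n0 + (n - n0))%nat with n by lia. field. auto.
  - intros n Hn. replace (S n - n0)%nat with (S (n - n0)) by lia. simpl.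
    replace (n0 + (n - n0))%nat with n by lia. field. auto.
  - apply (vanishes_shift _ n0).
    apply vanishes_ext with (fun k => (fst (Y k) - l) * / l)%C.
    + intros k. replace (n0 + k - n0)%nat with k by lia. field; auto.
    + apply vanishes_mult_bdd; auto using bdd_const.
  - apply (vanishes_shift _ n0).
    apply vanishes_ext with (fun k => snd (Y k) * / l)%C.
    + intros k. replace (n0 + k - n0)%nat with k by lia. reflexivity.
    + apply vanishes_mult_bdd; auto using bdd_const.
Qed.

Lemma Cmod_minus_ge (a b : C) : Cmod a - Cmod b <= Cmod (a - b).
Proof.
  pose proof (Cmod_triangle (a - b) b) as H.
  replace (a - b + b)%C with a in H by ring. lra.
Qed.

Lemma eventually_nonzero (D : nat -> C) (delta : C) :
  delta <> 0 -> vanishes (fun n => D n - delta)%C ->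
  exists N, forall n, (N <= n)%nat -> Cmod delta / 2 < Cmod (D n).
Proof.
  intros Hd HD. apply Cmod_gt_0 in Hd.
  destruct (proj1 (vanishes_spec _) HD (Cmod delta / 2) ltac:(lra)) as [N HN].
  exists N. intros n Hn. specialize (HN n Hn).
  pose proof (Cmod_minus_ge delta (delta - D n)) as H.
  replace (delta - (delta - D n))%C with (D n) in H by ring.
  replace (D n - delta)%C with (- (delta - D n))%C in HN by ring.
  rewrite Cmod_opp in HN. lra.
Qed.

Lemma bdd_inv (D : nat -> C) (delta : C) :
  delta <> 0 -> vanishes (fun n => D n - delta)%C -> bdd (fun n => / D n)%C.
Proof.
  intros Hd HD. destruct (eventually_nonzero D delta Hd HD) as [N HN].
  apply Cmod_gt_0 in Hd.
  (* Below [N] the value [D n] may be 0; these finitely many inverses, whatever they are, do not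
     affect boundedness. *)
  apply bdd_eventually with (/ (Cmod delta / 2)) N. intros n Hn. specialize (HN n Hn).
  rewrite Cmod_inv; [|apply Cmod_gt_0; lra].
  apply Rinv_le_contravar; lra.
Qed.

(** * From pairs of approximate solutions to exact solutions *)

Record mat_seq := MatSeq { m11 : nat -> C; m12 : nat -> C; m21 : nat -> C; m22 : nat -> C }.

Definition solves_from (A : mat_seq) (n0 : nat) (u v : nat -> C) : Prop :=
  forall n, (n0 <= n)%nat ->
    u (S n) = (m11 A n * u n + m12 A n * v n)%C /\
    v (S n) = (m21 A n * u n + m22 A n * v n)%C.

(** The candidate is g_n (b_n, c_n). Its residual is measured relative to g_(n+1), so that the
    summability condition does not see the growth or decay of [g]. *)
Definition nearly_solves (A : mat_seq) (g b c : nat -> C) : Prop :=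
  l1 (fun n => g n / g (S n) * (m11 A n * b n + m12 A n * c n) - b (S n))%C /\
  l1 (fun n => g n / g (S n) * (m21 A n * b n + m22 A n * c n) - c (S n))%C.

(** Cramer's rule in the frame (b1, c1), (b2, c2) at index n + 1. The frame is bounded and its
    determinant tends to [delta], so a summable residual has summable coordinates. *)
Lemma residual_coordinates (A : mat_seq) (g b c b1 c1 b2 c2 : nat -> C) (delta : C) :
  nearly_solves A g b c ->
  bdd b1 -> bdd c1 -> bdd b2 -> bdd c2 ->
  delta <> 0 -> vanishes (fun n => b1 n * c2 n - c1 n * b2 n - delta)%C ->
  exists e1 e2 : nat -> C, l1 e1 /\ l1 e2 /\
    exists N, forall n, (N <= n)%nat ->
      (g n / g (S n) * (m11 A n * b n + m12 A n * c n)
        = b (S n) + e1 n * b1 (S n) + e2 n * b2 (S n))%C /\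
      (g n / g (S n) * (m21 A n * b n + m22 A n * c n)
        = c (S n) + e1 n * c1 (S n) + e2 n * c2 (S n))%C.
Proof.
  intros [Hr1 Hr2] Hb1 Hc1 Hb2 Hc2 Hd HD.
  set (D := fun n => (b1 n * c2 n - c1 n * b2 n)%C) in *.
  set (r1 := fun n => (g n / g (S n) * (m11 A n * b n + m12 A n * c n) - b (S n))%C) in *.
  set (r2 := fun n => (g n / g (S n) * (m21 A n * b n + m22 A n * c n) - c (S n))%C) in *.
  assert (HDi : bdd (fun n => / D (S n))%C) by (apply (bdd_S (fun n => / D n)%C); eapply bdd_inv; eauto).
  exists (fun n => (r1 n * c2 (S n) - r2 n * b2 (S n)) * / D (S n))%C,
         (fun n => (r2 n * b1 (S n) - r1 n * c1 (S n)) * / D (S n))%C.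
  split; [|split].
  - apply l1_mult_bdd; auto. apply l1_minus; apply l1_mult_bdd; auto using bdd_S.
  - apply l1_mult_bdd; auto. apply l1_minus; apply l1_mult_bdd; auto using bdd_S.
  - destruct (eventually_nonzero D delta Hd HD) as [N HN]. exists N. intros n Hn.
    assert (HDn : D (S n) <> 0).
    { apply Cmod_gt_0. eapply Rle_lt_trans; [|apply HN; lia].
      pose proof (Cmod_ge_0 delta); lra. }
    assert (E1 : (g n / g (S n) * (m11 A n * b n + m12 A n * c n) = b (S n) + r1 n)%C)
      by (unfold r1; ring).
    assert (E2 : (g n / g (S n) * (m21 A n * b n + m22 A n * c n) = c (S n) + r2 n)%C)
      by (unfold r2; ring).
    rewrite E1, E2. clearbody r1 r2. unfold D in *. split; field; exact HDn.
Qed.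

(** The factor by which g2 / g1 changes in one step. It becomes the second diagonal entry of the
    system once both candidates carry the common scale [g1]. *)
Definition ratio_step (g1 g2 : nat -> C) (n : nat) : C :=
  (g2 (S n) / g1 (S n) / (g2 n / g1 n))%C.

Lemma Cmod_sum_bound (f1 f2 f3 f4 : nat -> C) :
  l1 f1 -> l1 f2 -> l1 f3 -> l1 f4 ->
  exists q : nat -> R, (forall n, 0 <= q n) /\ ex_series q /\
    (forall n, Cmod (f1 n) <= q n) /\ (forall n, Cmod (f2 n) <= q n) /\
    (forall n, Cmod (f3 n) <= q n) /\ (forall n, Cmod (f4 n) <= q n).
Proof.
  intros H1 H2 H3 H4.
  exists (fun n => (Cmod (f1 n) + Cmod (f2 n)) + (Cmod (f3 n) + Cmod (f4 n))).
  assert (H : forall n, 0 <= Cmod (f1 n) /\ 0 <= Cmod (f2 n) /\ 0 <= Cmod (f3 n) /\ 0 <= Cmod (f4 n))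
    by (intros; repeat split; apply Cmod_ge_0).
  split; [intros n; specialize (H n); lra|].
  split; [|repeat split; intros n; specialize (H n); lra].
  apply (ex_series_plus (V := R_NormedModule) (fun n => Cmod (f1 n) + Cmod (f2 n)));
  apply (ex_series_plus (V := R_NormedModule)); assumption.
Qed.

Lemma ratio_step_le_1 (g1 g2 : nat -> C) :
  (forall n, g1 n <> 0) -> (forall n, g2 n <> 0) ->
  (forall n, Cmod (g2 (S n) / g1 (S n)) <= Cmod (g2 n / g1 n)) ->
  forall n, Cmod (ratio_step g1 g2 n) <= 1.
Proof.
  intros Hg1 Hg2 H n. unfold ratio_step.
  assert (Hne : (g2 n / g1 n)%C <> 0).
  { intros E. apply (Hg2 n). replace (g2 n) with (g2 n / g1 n * g1 n)%C by (field; auto).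
    rewrite E. ring. }
  rewrite Cmod_div by exact Hne.
  apply Cmod_gt_0 in Hne. apply Rmult_le_reg_r with (Cmod (g2 n / g1 n)); auto.
  unfold Rdiv. rewrite Rmult_assoc, Rinv_l, Rmult_1_l, Rmult_1_r by lra. auto.
Qed.

Definition asymptotic_solution (A : mat_seq) (g b c : nat -> C) : Prop :=
  exists n0 (u v eu ev : nat -> C), solves_from A n0 u v /\ vanishes eu /\ vanishes ev /\
    forall n, u n = (g n * (b n + eu n))%C /\ v n = (g n * (c n + ev n))%C.

(** In the ansatz g1 (y1 (b1, c1) + y2 (b2, c2)) the common scale [g1] turns the system into diag
    (1, [rho]) plus summable terms with |rho| <= 1, which is the situation of [forward_solution]. *)
Lemma dominant_solution (A : mat_seq) (g1 g2 b1 c1 b2 c2 : nat -> C) (delta : C) :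
  nearly_solves A g1 b1 c1 -> nearly_solves A g2 b2 c2 ->
  bdd b1 -> bdd c1 -> bdd b2 -> bdd c2 ->
  delta <> 0 -> vanishes (fun n => b1 n * c2 n - c1 n * b2 n - delta)%C ->
  (forall n, g1 n <> 0) -> (forall n, g2 n <> 0) ->
  (forall n, Cmod (g2 (S n) / g1 (S n)) <= Cmod (g2 n / g1 n)) ->
  vanishes (fun n => g2 n / g1 n)%C ->
  asymptotic_solution A g1 b1 c1.
Proof.
  intros H1 H2 Hb1 Hc1 Hb2 Hc2 Hd HD Hg1 Hg2 Hmon Hv.
  destruct (residual_coordinates A g1 b1 c1 b1 c1 b2 c2 delta) as [e11 [e21 [L11 [L21 [N1 HN1]]]]]; auto.
  destruct (residual_coordinates A g2 b2 c2 b1 c1 b2 c2 delta) as [e12 [e22 [L12 [L22 [N2 HN2]]]]]; auto.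
  set (rho := ratio_step g1 g2).
  assert (Hrho : forall n, Cmod (rho n) <= 1) by (apply ratio_step_le_1; auto).
  assert (Hrb : bdd rho) by (exists 1; auto).
  destruct (Cmod_sum_bound e11 (fun n => rho n * e12 n)%C e21 (fun n => rho n * e22 n)%C)
    as [q [Hq [Hs [Q1 [Q2 [Q3 Q4]]]]]]; auto using l1_bdd_mult.
  destruct (forward_solution e11 (fun n => rho n * e12 n)%C e21 (fun n => rho n * e22 n)%C
    rho (fun n => g2 n / g1 n)%C q) as [n0 [y1 [y2 [Y1 [Y2 [V1 V2]]]]]]; auto.
  { intros n E. apply (Hg2 n). replace (g2 n) with (g2 n / g1 n * g1 n)%C by (field; auto).
    rewrite E. ring. }
  { intros n. unfold rho, ratio_step. field. auto. }
  exists (Nat.max n0 (Nat.max N1 N2)),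
    (fun n => g1 n * (y1 n * b1 n + y2 n * b2 n))%C, (fun n => g1 n * (y1 n * c1 n + y2 n * c2 n))%C,
    (fun n => (y1 n - 1) * b1 n + y2 n * b2 n)%C, (fun n => (y1 n - 1) * c1 n + y2 n * c2 n)%C.
  split; [|split; [|split]].
  - intros n Hn. rewrite Y1, Y2 by lia.
    destruct (HN1 n ltac:(lia)) as [P1 P2]. destruct (HN2 n ltac:(lia)) as [P3 P4].
    assert (Hr : rho n = (g2 (S n) / g1 (S n) / (g2 n / g1 n))%C) by reflexivity.
    assert (F1 : forall z w, (g1 n / g1 (S n) * z = w -> z = g1 (S n) / g1 n * w)%C)
      by (intros z w <-; field; auto).
    assert (F2 : forall z w, (g2 n / g2 (S n) * z = w -> z = g2 (S n) / g2 n * w)%C)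
      by (intros z w <-; field; auto).
    apply F1 in P1, P2. apply F2 in P3, P4.
    split.
    + transitivity (g1 n * (y1 n * (m11 A n * b1 n + m12 A n * c1 n)
        + y2 n * (m11 A n * b2 n + m12 A n * c2 n)))%C; [|ring].
      rewrite P1, P3, Hr. field; auto.
    + transitivity (g1 n * (y1 n * (m21 A n * b1 n + m22 A n * c1 n)
        + y2 n * (m21 A n * b2 n + m22 A n * c2 n)))%C; [|ring].
      rewrite P2, P4, Hr. field; auto.
  - apply vanishes_plus; apply vanishes_mult_bdd; auto.
  - apply vanishes_plus; apply vanishes_mult_bdd; auto.
  - intros n; split; ring.
Qed.

(** With the common scale [g2] the first diagonal entry is 1 / rho, which may expand. The step
    matrix, of determinant [De] / rho, is therefore inverted: backwards the entry is close to [rho],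
    of modulus at most 1, and [backward_solution] produces the solution from infinity. *)
Lemma subdominant_solution (A : mat_seq) (g1 g2 b1 c1 b2 c2 : nat -> C) (delta : C) :
  nearly_solves A g1 b1 c1 -> nearly_solves A g2 b2 c2 ->
  bdd b1 -> bdd c1 -> bdd b2 -> bdd c2 ->
  delta <> 0 -> vanishes (fun n => b1 n * c2 n - c1 n * b2 n - delta)%C ->
  (forall n, g1 n <> 0) -> (forall n, g2 n <> 0) ->
  (forall n, Cmod (g2 (S n) / g1 (S n)) <= Cmod (g2 n / g1 n)) ->
  asymptotic_solution A g2 b2 c2.
Proof.
  intros H1 H2 Hb1 Hc1 Hb2 Hc2 Hd HD Hg1 Hg2 Hmon.
  destruct (residual_coordinates A g1 b1 c1 b1 c1 b2 c2 delta) as [e11 [e21 [L11 [L21 [N1 HN1]]]]]; auto.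
  destruct (residual_coordinates A g2 b2 c2 b1 c1 b2 c2 delta) as [e12 [e22 [L12 [L22 [N2 HN2]]]]]; auto.
  set (rho := ratio_step g1 g2).
  assert (Hrho : forall n, Cmod (rho n) <= 1) by (apply ratio_step_le_1; auto).
  set (De := fun n => ((1 + e11 n) * (1 + e22 n) - e12 n * e21 n)%C).
  assert (HDe : vanishes (fun n => De n - 1)%C).
  { apply l1_vanishes.
    apply l1_ext with (fun n => e11 n + e22 n + e11 n * e22 n - e12 n * e21 n)%C.
    { intros n; unfold De; ring. }
    apply l1_minus; [|apply l1_mult; auto].
    apply l1_plus; [|apply l1_mult; auto]. now apply l1_plus. }
  assert (H10 : RtoC 1 <> 0) by (intros E; apply RtoC_inj in E; lra).
  assert (HDi : bdd (fun n => / De n)%C) by (eapply bdd_inv; eauto).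
  destruct (eventually_nonzero De 1 H10 HDe) as [N3 HN3].
  assert (HDn : forall n, (N3 <= n)%nat -> De n <> 0).
  { intros n Hn. apply Cmod_gt_0. specialize (HN3 n Hn). rewrite Cmod_1 in HN3. lra. }
  assert (L1 : l1 (fun n => (1 + e22 n) * / De n - 1)%C).
  { apply l1_eventually with (fun n => (e12 n * e21 n - e11 n - e11 n * e22 n) * / De n)%C N3.
    - intros n Hn. specialize (HDn n Hn). unfold De in *. field. auto.
    - apply l1_mult_bdd; auto. apply l1_minus; [apply l1_minus|]; auto using l1_mult. }
  assert (L2 : l1 (fun n => (1 + e11 n) * / De n - 1)%C).
  { apply l1_eventually with (fun n => (e12 n * e21 n - e22 n - e11 n * e22 n) * / De n)%C N3.
    - intros n Hn. specialize (HDn n Hn). unfold De in *. field. auto.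
    - apply l1_mult_bdd; auto. apply l1_minus; [apply l1_minus|]; auto using l1_mult. }
  destruct (Cmod_sum_bound (fun n => (1 + e22 n) * / De n - 1)%C (fun n => e12 n * / De n)%C
     (fun n => e21 n * / De n)%C (fun n => (1 + e11 n) * / De n - 1)%C)
    as [q [Hq [Hs [Q1 [Q2 [Q3 Q4]]]]]]; auto using l1_mult_bdd.
  destruct (backward_solution (fun n => rho n * ((1 + e22 n) * / De n))%C
     (fun n => - (rho n * (e12 n * / De n)))%C (fun n => - (e21 n * / De n))%C
     (fun n => (1 + e11 n) * / De n)%C q)
     as [z1 [z2 [Z1 [Z2 [V1 V2]]]]]; auto.
  { intros n. rewrite Cmod_mult. specialize (Q1 n). specialize (Hrho n).
    pose proof (Cmod_triangle ((1 + e22 n) * / De n - 1) 1) as Ht. rewrite Cmod_1 in Ht.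
    replace ((1 + e22 n) * / De n - 1 + 1)%C with ((1 + e22 n) * / De n)%C in Ht by ring.
    pose proof (Cmod_ge_0 ((1 + e22 n) * / De n)). pose proof (Cmod_ge_0 (rho n)). nra. }
  { intros n. rewrite Cmod_opp, Cmod_mult. specialize (Q2 n). specialize (Hrho n).
    pose proof (Cmod_ge_0 (e12 n * / De n)). pose proof (Cmod_ge_0 (rho n)). nra. }
  { intros n. rewrite Cmod_opp. auto. }
  exists (Nat.max N3 (Nat.max N1 N2)),
    (fun n => g2 n * (z1 n * b1 n + z2 n * b2 n))%C, (fun n => g2 n * (z1 n * c1 n + z2 n * c2 n))%C,
    (fun n => z1 n * b1 n + (z2 n - 1) * b2 n)%C, (fun n => z1 n * c1 n + (z2 n - 1) * c2 n)%C.
  split; [|split; [|split]].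
  - intros n Hn. rewrite (Z1 n), (Z2 n) by lia.
    destruct (HN1 n ltac:(lia)) as [P1 P2]. destruct (HN2 n ltac:(lia)) as [P3 P4].
    assert (Hr : rho n = (g2 (S n) / g1 (S n) / (g2 n / g1 n))%C) by reflexivity.
    specialize (HDn n ltac:(lia)).
    assert (F1 : forall z w, (g1 n / g1 (S n) * z = w -> z = g1 (S n) / g1 n * w)%C)
      by (intros z w <-; field; auto).
    assert (F2 : forall z w, (g2 n / g2 (S n) * z = w -> z = g2 (S n) / g2 n * w)%C)
      by (intros z w <-; field; auto).
    apply F1 in P1, P2. apply F2 in P3, P4.
    assert (F3 : forall P Q : C,
      (g2 n * (rho n * ((1 + e22 n) * / De n) * z1 (S n) + - (rho n * (e12 n * / De n)) * z2 (S n))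
        * (g1 (S n) / g1 n * P)
       + g2 n * (- (e21 n * / De n) * z1 (S n) + (1 + e11 n) * / De n * z2 (S n))
        * (g2 (S n) / g2 n * Q)
       = g2 (S n) * ((((1 + e22 n) * z1 (S n) - e12 n * z2 (S n)) * P
           + ((1 + e11 n) * z2 (S n) - e21 n * z1 (S n)) * Q) / De n))%C).
    { intros P Q. rewrite Hr. field. auto. }
    split.
    + match goal with |- _ = (_ * (_ * (?x * _ + ?y * _)) + _ * (_ * _))%C =>
        transitivity (g2 n * x * (m11 A n * b1 n + m12 A n * c1 n)
          + g2 n * y * (m11 A n * b2 n + m12 A n * c2 n))%C; [|ring] end.
      rewrite P1, P3, F3. unfold De in *. field; auto.
    + match goal with |- _ = (_ * (_ * (?x * _ + ?y * _)) + _ * (_ * _))%C =>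
        transitivity (g2 n * x * (m21 A n * b1 n + m22 A n * c1 n)
          + g2 n * y * (m21 A n * b2 n + m22 A n * c2 n))%C; [|ring] end.
      rewrite P2, P4, F3. unfold De in *. field; auto.
  - apply vanishes_plus; apply vanishes_mult_bdd; auto.
  - apply vanishes_plus; apply vanishes_mult_bdd; auto.
  - intros n; split; ring.
Qed.

(** If g2 / g1 has constant modulus, each scale is subdominant with respect to the other and the
    backward construction serves both. Otherwise the first solution comes from the forward
    construction and the second from the backward one. *)
Lemma levinson_pair (A : mat_seq) (g1 g2 b1 c1 b2 c2 : nat -> C) (delta : C) :
  nearly_solves A g1 b1 c1 -> nearly_solves A g2 b2 c2 ->
  bdd b1 -> bdd c1 -> bdd b2 -> bdd c2 ->
  delta <> 0 -> vanishes (fun n => b1 n * c2 n - c1 n * b2 n - delta)%C ->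
  (forall n, g1 n <> 0) -> (forall n, g2 n <> 0) ->
  (forall n, Cmod (g2 (S n) / g1 (S n)) = Cmod (g2 n / g1 n)) \/
  ((forall n, Cmod (g2 (S n) / g1 (S n)) <= Cmod (g2 n / g1 n)) /\
   vanishes (fun n => g2 n / g1 n)%C) ->
  asymptotic_solution A g1 b1 c1 /\ asymptotic_solution A g2 b2 c2.
Proof.
  intros H1 H2 Hb1 Hc1 Hb2 Hc2 Hd HD Hg1 Hg2 [Heq|[Hmon Hv]].
  - split.
    + apply (subdominant_solution A g2 g1 b2 c2 b1 c1 (- delta)); auto.
      * intros E. apply Hd. replace delta with (- - delta)%C by ring. rewrite E. ring.
      * apply vanishes_ext with (fun n => - (b1 n * c2 n - c1 n * b2 n - delta))%C.
        { intros; ring. }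
        now apply vanishes_opp.
      * intros n. specialize (Heq n). right.
        assert (Hi : forall z w : C, z <> 0 -> w <> 0 -> Cmod (z / w) = / Cmod (w / z)).
        { intros z w Hz Hw. rewrite !Cmod_div by auto. 
          apply Cmod_gt_0 in Hz, Hw. field. lra. }
        rewrite (Hi (g1 (S n)) (g2 (S n))), (Hi (g1 n) (g2 n)) by auto. now rewrite Heq.
    + apply (subdominant_solution A g1 g2 b1 c1 b2 c2 delta); auto.
      intros n; right; auto.
  - split.
    + apply (dominant_solution A g1 g2 b1 c1 b2 c2 delta); auto.
    + apply (subdominant_solution A g1 g2 b1 c1 b2 c2 delta); auto.
Qed.

Ltac bd :=
  repeat first [ assumption | apply l1_bdd; assumption | apply bdd_const
    | apply bdd_plus | apply bdd_minus | apply bdd_opp | apply bdd_mult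
    | apply bdd_S; assumption ].

(** One row of the residual, with ([m1], [m2]) and ([k1], [k2]) rows of M and K. The equation for
    [H'] makes the terms of order t cancel, the part [b * (mu * V')] being compensated by the factor
    1 - b t in g_n / g_(n+1). Every remaining term contains a product of two values of t, a
    difference t_(n+1) - t_n, or one of [Q1], [Q2], [s], all summable. *)
Lemma corrected_residual_l1 (m1 m2 k1 k2 mu b : C) (Q1 Q2 t F V W V' H J H' s : nat -> C) :
  mu <> 0 ->
  l1 Q1 -> l1 Q2 -> l1 s -> bdd t -> bdd F -> bdd V -> bdd W -> bdd V' -> bdd H -> bdd J -> bdd H' ->
  l1 (fun n => t n * t n)%C -> l1 (fun n => t (S n) - t n)%C ->
  (forall n, mu * V' n = m1 * V n + m2 * W n)%C ->
  (forall n, mu * H' n = m1 * H n + m2 * J n - b * (mu * V' n) + F n * (k1 * V n + k2 * W n))%C ->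
  l1 (fun n => (/ mu * (1 - b * t (S n)) + s n) *
    ((m1 + t (S n) * F n * k1 + Q1 n) * (V n + t n * H n) +
     (m2 + t (S n) * F n * k2 + Q2 n) * (W n + t n * J n)) - (V' n + t (S n) * H' n))%C.
Proof.
  intros Hmu HQ1 HQ2 Hs Ht HF HV HW HV' HH HJ HH' Ht2 Hdt EV EH.
  assert (Ht' : bdd (fun n => t (S n))) by bd.
  assert (Ht2' : l1 (fun n => t (S n) * t (S n))%C) by (apply (l1_shift (fun n => t n * t n)%C 1); auto).
  assert (Htt : l1 (fun n => t (S n) * t n)%C).
  { apply l1_ext with (fun n => t n * t n + (t (S n) - t n) * t n)%C; [intros; ring|].
    apply l1_plus; auto. now apply l1_mult_bdd. }
  set (X := fun n => ((m1 + t (S n) * F n * k1 + Q1 n) * (V n + t n * H n) +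
     (m2 + t (S n) * F n * k2 + Q2 n) * (W n + t n * J n))%C).
  set (E := fun n => ((t (S n) * t n) * (F n * (k1 * H n + k2 * J n))
     - (t (S n) - t n) * (m1 * H n + m2 * J n)
     + Q1 n * (V n + t n * H n) + Q2 n * (W n + t n * J n))%C).
  assert (HX : bdd X) by (unfold X; bd).
  assert (HE : l1 E).
  { unfold E. apply l1_plus; [apply l1_plus; [apply l1_minus|]|];
    (apply l1_mult_bdd; [assumption|bd]). }
  assert (EX : forall n, X n = (mu * V' n + t (S n) * (mu * H' n + b * (mu * V' n)) + E n)%C).
  { intros n. rewrite EH, EV. unfold X, E. ring. }
  apply l1_ext with (fun n => s n * X n + E n * (/ mu * (1 - b * t (S n)))
     + (t (S n) * t (S n)) * (- b * (H' n + b * V' n)))%C.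
  - intros n. change ((m1 + t (S n) * F n * k1 + Q1 n) * (V n + t n * H n) +
     (m2 + t (S n) * F n * k2 + Q2 n) * (W n + t n * J n))%C with (X n).
    rewrite EX. field. auto.
  - apply l1_plus; [apply l1_plus|]; (apply l1_mult_bdd; [assumption|bd]).
Qed.

(** * The sequence n^(-gamma) and its sums *)

Lemma ex_series_telescope (a G : nat -> R) (M : R) :
  (forall n, 0 <= a n <= G (S n) - G n) -> (forall n, G n <= M) -> ex_series a.
Proof.
  intros Ha HG.
  destruct (ex_finite_lim_seq_incr (sum_n a) (M - G 0%nat)) as [l Hl].
  - intros n. rewrite sum_Sn. unfold plus; simpl. specialize (Ha (S n)). lra.
  - intros n. assert (H : sum_n a n <= G (S n) - G 0%nat).
    { induction n as [|n IH].
      - rewrite sum_O. apply Ha.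
      - rewrite sum_Sn. unfold plus; simpl. specialize (Ha (S n)). lra. }
    specialize (HG (S n)). lra.
  - exists l. exact Hl.
Qed.

Definition pow_decay (gam : R) (n : nat) : R := Rpower (INR n) (- gam).

Lemma Rpower_neg_decr (gam x y : R) : 0 <= gam -> 0 < x -> x <= y ->
  Rpower y (- gam) <= Rpower x (- gam).
Proof.
  intros Hg Hx Hxy. rewrite !Rpower_Ropp. apply Rinv_le_contravar.
  - apply exp_pos.
  - apply Rle_Rpower_l; lra.
Qed.

Lemma INR_S_pos (n : nat) : 0 < INR (S n).
Proof. apply lt_0_INR; lia. Qed.

Lemma pow_decay_pos (gam : R) (n : nat) : 0 < pow_decay gam n.
Proof. apply exp_pos. Qed.

Lemma pow_decay_decr (gam : R) (n : nat) : 0 <= gam -> pow_decay gam (S n) <= pow_decay gam n.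
Proof.
  intros Hg. destruct n as [|n].
  (* By convention [ln 0] is 0, so the values at the indices 0 and 1 coincide and monotonicity holds
     from 0 on. *)
  - right. unfold pow_decay, Rpower. simpl. rewrite ln_1. f_equal. f_equal.
    unfold ln. destruct (Rlt_dec 0 0) as [H|H]; [exfalso; lra|reflexivity].
  - apply Rpower_neg_decr; auto using INR_S_pos. apply le_INR; lia.
Qed.

Lemma is_lim_seq_INR_Rpower (y : R) : 0 < y -> is_lim_seq (fun n => Rpower (INR n) y) p_infty.
Proof.
  intros Hy. apply is_lim_seq_spec. intros M.
  set (M' := Rmax M 1).
  destruct (nfloor_ex (Rpower M' (/ y))) as [N [_ HN]]; [left; apply exp_pos|].
  exists (S N). intros n Hn.
  apply Rle_lt_trans with M'; [apply Rmax_l|].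
  assert (HM' : 0 < M') by (pose proof (Rmax_r M 1); unfold M' in *; lra).
  replace M' with (Rpower (Rpower M' (/ y)) y).
  - apply Rlt_Rpower_l; auto. split; [apply exp_pos|].
    eapply Rlt_le_trans; [exact HN|]. rewrite <- S_INR. now apply le_INR.
  - rewrite Rpower_mult, Rinv_l by lra. now apply Rpower_1.
Qed.

Lemma pow_decay_lim (gam : R) : 0 < gam -> is_lim_seq (pow_decay gam) 0.
Proof.
  intros Hg. apply is_lim_seq_ext with (fun n => / Rpower (INR n) gam).
  - intros n. unfold pow_decay. now rewrite Rpower_Ropp.
  - replace (Finite 0) with (Rbar_inv p_infty) by reflexivity.
    apply is_lim_seq_inv; [now apply is_lim_seq_INR_Rpower|discriminate].
Qed.

Lemma pow_decay_variation (gam : R) : 0 <= gam ->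
  ex_series (fun n => pow_decay gam n - pow_decay gam (S n)).
Proof.
  intros Hg. apply ex_series_telescope with (fun n => - pow_decay gam n) 0.
  - intros n. pose proof (pow_decay_decr gam n Hg). lra.
  - intros n. pose proof (pow_decay_pos gam n). lra.
Qed.

Lemma pow_decay_square_series (gam : R) : 1 / 2 < gam ->
  ex_series (fun n => pow_decay gam n * pow_decay gam n).
Proof.
  (* Integral comparison with the antiderivative of x^(- 2 gam). The shift by 2 compares the term of
     index n + 2 with the interval from n + 1 to n + 2, away from 0. *)
  intros Hg. apply (ex_series_incr_n (V := R_NormedModule) _ 2).
  apply ex_series_telescope with
    (fun n => - (Rpower (INR (S n)) (1 - 2 * gam) / (2 * gam - 1))) 0.
  - intros n. split.
    + left; apply Rmult_lt_0_compat; apply pow_decay_pos.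
    + destruct (MVT_cor2 (fun x => - (Rpower x (1 - 2 * gam) / (2 * gam - 1)))
        (fun x => Rpower x (- (2 * gam))) (INR (S n)) (INR (S (S n)))) as [x [Hx1 Hx2]].
      * apply lt_INR; lia.
      * intros x Hx. pose proof (INR_S_pos n).
        replace (Rpower x (- (2 * gam)))
          with (- (((1 - 2 * gam) * Rpower x (1 - 2 * gam - 1)) * / (2 * gam - 1))).
        2: { replace (1 - 2 * gam - 1) with (- (2 * gam)) by ring. field. lra. }
        apply derivable_pt_lim_opp.
        apply derivable_pt_lim_ext with (fun x => / (2 * gam - 1) * Rpower x (1 - 2 * gam)).
        { intros; unfold Rdiv; ring. }
        rewrite (Rmult_comm _ (/ _)).
        apply derivable_pt_lim_scal. apply derivable_pt_lim_power. lra.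
      * rewrite Hx1.
        replace (INR (S (S n)) - INR (S n)) with 1 by (rewrite (S_INR (S n)); ring).
        rewrite Rmult_1_r. unfold pow_decay. rewrite <- Rpower_plus.
        replace (- gam + - gam) with (- (2 * gam)) by ring.
        pose proof (INR_S_pos n).
        apply Rpower_neg_decr; try lra. simpl Init.Nat.add. lra.
  - intros n. assert (0 < Rpower (INR (S n)) (1 - 2 * gam) / (2 * gam - 1)).
    { apply Rdiv_lt_0_compat; [apply exp_pos|lra]. }
    lra.
Qed.

(** An antiderivative of x^(- gam), evaluated at the integers; it replaces the sum of the n^(- gam)
    in the exponent of the growth factor. *)
Definition growth_exponent (gam : R) (n : nat) : R :=
  if Req_EM_T gam 1 then ln (INR n) else Rpower (INR n) (1 - gam) / (1 - gam).

Lemma f_growth_exp (gam b : R) (n : nat) :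
  f_growth gam b n = exp (b * growth_exponent gam n).
Proof.
  unfold f_growth, growth_exponent. destruct (Req_EM_T gam 1).
  - reflexivity.
  - f_equal. unfold Rdiv. ring.
Qed.

Lemma growth_exponent_step (gam : R) (n : nat) : 0 <= gam <= 1 ->
  pow_decay gam (S (S n)) <= growth_exponent gam (S (S n)) - growth_exponent gam (S n)
    <= pow_decay gam (S n).
Proof.
  intros Hg. pose proof (INR_S_pos n) as Hn.
  destruct (MVT_cor2 (fun x => if Req_EM_T gam 1 then ln x else Rpower x (1 - gam) / (1 - gam))
    (fun x => Rpower x (- gam)) (INR (S n)) (INR (S (S n)))) as [x [Hx1 Hx2]].
  - apply lt_INR; lia.
  - intros x Hx. destruct (Req_EM_T gam 1) as [->|Hne].
    + rewrite Rpower_Ropp, Rpower_1 by lra. apply derivable_pt_lim_ln. lra.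
    + replace (Rpower x (- gam)) with (/ (1 - gam) * ((1 - gam) * Rpower x (1 - gam - 1))).
      2: { replace (1 - gam - 1) with (- gam) by ring. field. lra. }
      apply derivable_pt_lim_ext with (fun x => / (1 - gam) * Rpower x (1 - gam)).
      { intros; unfold Rdiv; ring. }
      apply derivable_pt_lim_scal. apply derivable_pt_lim_power. lra.
  - unfold growth_exponent. rewrite Hx1.
    replace (INR (S (S n)) - INR (S n)) with 1 by (rewrite (S_INR (S n)); ring).
    rewrite Rmult_1_r. unfold pow_decay.
    split; apply Rpower_neg_decr; lra.
Qed.

Lemma growth_exponent_incr (gam : R) (n : nat) : 0 <= gam <= 1 ->
  growth_exponent gam n <= growth_exponent gam (S n).
Proof.
  intros Hg. destruct n as [|n].
  (* Again the convention for [ln 0] makes the values at 0 and 1 equal. *)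
  - right. assert (H0 : ln 0 = 0).
    { unfold ln. destruct (Rlt_dec 0 0) as [H|H]; [exfalso; lra|reflexivity]. }
    unfold growth_exponent, Rpower. simpl. rewrite H0, ln_1. reflexivity.
  - pose proof (growth_exponent_step gam n Hg). pose proof (pow_decay_pos gam (S (S n))). lra.
Qed.

Lemma growth_exponent_lim (gam : R) : 0 <= gam <= 1 ->
  is_lim_seq (growth_exponent gam) p_infty.
Proof.
  intros Hg. unfold growth_exponent. destruct (Req_EM_T gam 1) as [->|Hne].
  - apply (is_lim_comp_seq ln INR p_infty p_infty).
    + apply is_lim_ln_p.
    + exists 0%nat. intros; discriminate.
    + apply is_lim_seq_INR.
  - replace p_infty with (Rbar_mult p_infty (/ (1 - gam))).
    + apply is_lim_seq_scal_r. apply is_lim_seq_INR_Rpower. lra.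
    + unfold Rbar_mult, Rbar_mult'. assert (0 < / (1 - gam)) by (apply Rinv_0_lt_compat; lra).
      destruct (Rle_dec 0 (/ (1 - gam))) as [H1|H1]; [|exfalso; lra].
      destruct (Rle_lt_or_eq_dec 0 (/ (1 - gam)) H1); [reflexivity|exfalso; lra].
Qed.

(** Applying exp x >= 1 + x to both x and - x encloses exp x between 1 + x and 1 / (1 - x). *)
Lemma exp_remainder (x : R) : Rabs x <= 1 / 2 -> Rabs (exp x - 1 - x) <= 2 * (x * x).
Proof.
  intros Hx. apply Rabs_le_between in Hx.
  pose proof (exp_ineq1_le x) as H1. pose proof (exp_ineq1_le (- x)) as H2.
  rewrite exp_Ropp in H2. pose proof (exp_pos x) as H3.
  assert (H4 : (1 - x) * exp x <= 1).
  { apply Rmult_le_compat_r with (r := exp x) in H2; [|lra]. rewrite Rinv_l in H2; lra. }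
  rewrite Rabs_pos_eq by lra. nra.
Qed.

(** The quotient is exp (- b D), where D is the increment of [growth_exponent]. Linearising exp
    costs O (D^2), summable because gam > 1/2; replacing D by a value of [pow_decay] costs at most
    the telescoping variation of [pow_decay]. *)
Lemma f_growth_step (gam b : R) : 1 / 2 < gam <= 1 ->
  l1 (fun n => RtoC (f_growth gam b n / f_growth gam b (S n) - (1 - b * pow_decay gam (S n)))).
Proof.
  intros Hg.
  assert (HT : vanishes (fun n => RtoC (b * pow_decay gam n))).
  { apply vanishes_le with (fun n => Rabs b * pow_decay gam n).
    - exists 0%nat. intros n _. rewrite Cmod_R, Rabs_mult, (Rabs_pos_eq (pow_decay gam n)); [lra|].
      left; apply pow_decay_pos.
    - replace (Finite 0) with (Rbar_mult (Rabs b) 0) by (simpl; f_equal; ring).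
      apply is_lim_seq_scal_l. apply pow_decay_lim. lra. }
  destruct (proj1 (vanishes_spec _) HT (1/2) ltac:(lra)) as [N HN].
  apply l1_shift with (S N).
  apply l1_le with (fun k => 2 * (b * b) * (pow_decay gam (S N + k) * pow_decay gam (S N + k))
     + Rabs b * (pow_decay gam (S N + k) - pow_decay gam (S (S N + k)))).
  - intros k. set (n := (N + k)%nat). change (S N + k)%nat with (S n).
    specialize (HN (S n) ltac:(lia)). rewrite Cmod_R in *.
    rewrite !f_growth_exp. set (D := growth_exponent gam (S (S n)) - growth_exponent gam (S n)).
    pose proof (growth_exponent_step gam n ltac:(lra)) as HD. fold D in HD.
    pose proof (pow_decay_pos gam (S (S n))) as Hp.
    replace (exp (b * growth_exponent gam (S n)) / exp (b * growth_exponent gam (S (S n))))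
      with (exp (- (b * D))).
    2: { unfold Rdiv. rewrite <- exp_Ropp, <- exp_plus. f_equal. unfold D. ring. }
    assert (HbD : Rabs (- (b * D)) <= 1 / 2).
    { rewrite Rabs_Ropp, Rabs_mult in *. rewrite (Rabs_pos_eq D) by lra.
      rewrite (Rabs_pos_eq (pow_decay gam (S n))) in HN by lra.
      pose proof (Rabs_pos b). nra. }
    pose proof (exp_remainder _ HbD) as HR.
    replace (exp (- (b * D)) - (1 - b * pow_decay gam (S (S n))))
      with ((exp (- (b * D)) - 1 - - (b * D)) + b * (pow_decay gam (S (S n)) - D)) by ring.
    eapply Rle_trans; [apply Rabs_triang|]. apply Rplus_le_compat.
    + eapply Rle_trans; [exact HR|].
      replace (2 * (- (b * D) * - (b * D))) with (2 * (b * b) * (D * D)) by ring.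
      apply Rmult_le_compat_l; nra.
    + rewrite Rabs_mult. apply Rmult_le_compat_l; [apply Rabs_pos|].
      rewrite Rabs_minus_sym, Rabs_pos_eq; lra.
  - apply (ex_series_plus (V := R_NormedModule)
      (fun k => 2 * (b * b) * (pow_decay gam (S N + k) * pow_decay gam (S N + k)))).
    + apply (ex_series_scal (V := R_NormedModule) (2 * (b * b))).
      apply (ex_series_incr_n (V := R_NormedModule) (fun n => pow_decay gam n * pow_decay gam n)).
      apply pow_decay_square_series; lra.
    + apply (ex_series_scal (V := R_NormedModule) (Rabs b)
        (fun k => pow_decay gam (S N + k) - pow_decay gam (S (S N + k)))).
      apply (ex_series_incr_n (V := R_NormedModule) (fun n => pow_decay gam n - pow_decay gam (S n))).
      apply pow_decay_variation; lra.
Qed.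

(** * Approximate solutions of the perturbed constant system *)

Record mat := Mat { e11 : C; e12 : C; e21 : C; e22 : C }.

(** The weight is t_(n+1) because the step from n to n + 1 contains the interaction at x_(n+1);
    [forcing] carries the matching index shift. *)
Definition is_perturbation (A : mat_seq) (M K : mat) (t F : nat -> C) : Prop :=
  l1 (fun n => m11 A n - (e11 M + t (S n) * F n * e11 K))%C /\
  l1 (fun n => m12 A n - (e12 M + t (S n) * F n * e12 K))%C /\
  l1 (fun n => m21 A n - (e21 M + t (S n) * F n * e21 K))%C /\
  l1 (fun n => m22 A n - (e22 M + t (S n) * F n * e22 K))%C.

(** The equation of the corrector ([H], [J]) for the source ([f], [g]). Boundedness is the point: a
    source in resonance would in general force linear growth. *)
Definition boundedly_solvable (mu : C) (M : mat) (f g : nat -> C) : Prop :=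
  exists H J : nat -> C, bdd H /\ bdd J /\ forall n,
    (mu * H (S n) = e11 M * H n + e12 M * J n + f n)%C /\
    (mu * J (S n) = e21 M * H n + e22 M * J n + g n)%C.

Lemma boundedly_solvable_plus (mu : C) (M : mat) (f g f' g' : nat -> C) :
  boundedly_solvable mu M f g -> boundedly_solvable mu M f' g' ->
  boundedly_solvable mu M (fun n => f n + f' n)%C (fun n => g n + g' n)%C.
Proof.
  intros [H [J [HH [HJ E]]]] [H' [J' [HH' [HJ' E']]]].
  exists (fun n => H n + H' n)%C, (fun n => J n + J' n)%C.
  split; [now apply bdd_plus|split; [now apply bdd_plus|]].
  intros n. destruct (E n) as [E1 E2]. destruct (E' n) as [E1' E2']. split.
  - transitivity (mu * H (S n) + mu * H' (S n))%C; [ring|]. rewrite E1, E1'. ring.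
  - transitivity (mu * J (S n) + mu * J' (S n))%C; [ring|]. rewrite E2, E2'. ring.
Qed.

Lemma boundedly_solvable_ext (mu : C) (M : mat) (f g f' g' : nat -> C) :
  (forall n, f n = f' n) -> (forall n, g n = g' n) ->
  boundedly_solvable mu M f g -> boundedly_solvable mu M f' g'.
Proof.
  intros Ef Eg [H [J [HH [HJ E]]]]. exists H, J. split; [|split]; auto.
  intros n. rewrite <- Ef, <- Eg. apply E.
Qed.

Lemma bdd_pow (e h : C) : Cmod e = 1 -> bdd (fun n => e ^ n * h)%C.
Proof.
  intros He. exists (Cmod h). intros n. rewrite Cmod_mult, Cmod_pow, He, pow1. lra.
Qed.

(** Eigenvectors are normalised to (1, tau), since the first component carries the solution of the
    difference equation; this is possible because the upper right entry of M will be [Sr lam d],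
    which is nonzero. Trace and determinant are recorded in order to factor the characteristic
    polynomial. *)
Definition eigenbasis (M : mat) (mu1 mu2 tau1 tau2 : C) : Prop :=
  (e11 M + e12 M * tau1 = mu1)%C /\ (e21 M + e22 M * tau1 = mu1 * tau1)%C /\
  (e11 M + e12 M * tau2 = mu2)%C /\ (e21 M + e22 M * tau2 = mu2 * tau2)%C /\
  (e11 M + e22 M = mu1 + mu2)%C /\ (e11 M * e22 M - e12 M * e21 M = mu1 * mu2)%C.

(** The ansatz e^n (h, j) reduces the recursion to a 2 x 2 linear system whose determinant is the
    characteristic polynomial of M at mu e. *)
Lemma mode_solvable (mu e mu1 mu2 tau1 tau2 f g : C) (M : mat) :
  eigenbasis M mu1 mu2 tau1 tau2 ->
  Cmod e = 1 -> (mu * e)%C <> mu1 -> (mu * e)%C <> mu2 ->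
  boundedly_solvable mu M (fun n => e ^ n * f)%C (fun n => e ^ n * g)%C.
Proof.
  intros [_ [_ [_ [_ [Ht Hd]]]]] He H1 H2.
  set (x := (mu * e)%C) in *.
  assert (Hdet : ((x - e11 M) * (x - e22 M) - e12 M * e21 M)%C <> 0).
  { replace ((x - e11 M) * (x - e22 M) - e12 M * e21 M)%C
      with (x * x - x * (e11 M + e22 M) + (e11 M * e22 M - e12 M * e21 M))%C by ring.
    rewrite Ht, Hd. replace (x * x - x * (mu1 + mu2) + mu1 * mu2)%C with ((x - mu1) * (x - mu2))%C by ring.
    apply Cmult_neq_0; intros E.
    - apply H1. replace x with (x - mu1 + mu1)%C by ring. rewrite E. ring.
    - apply H2. replace x with (x - mu2 + mu2)%C by ring. rewrite E. ring. }
  set (D := ((x - e11 M) * (x - e22 M) - e12 M * e21 M)%C) in *.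
  set (h := (((x - e22 M) * f + e12 M * g) / D)%C).
  set (j := (((x - e11 M) * g + e21 M * f) / D)%C).
  assert (E1 : (x * h = e11 M * h + e12 M * j + f)%C) by (unfold h, j, D in *; field; exact Hdet).
  assert (E2 : (x * j = e21 M * h + e22 M * j + g)%C) by (unfold h, j, D in *; field; exact Hdet).
  exists (fun n => e ^ n * h)%C, (fun n => e ^ n * j)%C.
  split; [now apply bdd_pow|split; [now apply bdd_pow|]].
  clearbody h j. intros n. rewrite !Cpow_S. split.
  - transitivity (e ^ n * (x * h))%C; [unfold x; ring|]. rewrite E1. ring.
  - transitivity (e ^ n * (x * j))%C; [unfold x; ring|]. rewrite E2. ring.
Qed.

(** Here mu e is the eigenvalue [mu1], but the source points along the other eigenvector (1, tau2),
    on which mu1 - M acts as multiplication by mu1 - mu2. *)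
Lemma resonant_mode_solvable (mu e mu1 mu2 tau1 tau2 f : C) (M : mat) :
  eigenbasis M mu1 mu2 tau1 tau2 ->
  Cmod e = 1 -> mu1 <> mu2 -> (mu * e)%C = mu1 ->
  boundedly_solvable mu M (fun n => e ^ n * f)%C (fun n => e ^ n * (f * tau2))%C.
Proof.
  intros [_ [_ [H1 [H2 _]]]] He Hne Hmu.
  assert (Hd : (mu1 - mu2)%C <> 0).
  { intros E. apply Hne. replace mu1 with (mu1 - mu2 + mu2)%C by ring. rewrite E. ring. }
  set (h := (f / (mu1 - mu2))%C).
  assert (Eh : f = (h * (mu1 - mu2))%C) by (unfold h; field; auto).
  exists (fun n => e ^ n * h)%C, (fun n => e ^ n * (h * tau2))%C.
  split; [now apply bdd_pow|split; [now apply bdd_pow|]].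
  clearbody h. intros n. rewrite !Cpow_S, Eh. split.
  - transitivity (mu * e * (e ^ n * h))%C; [ring|]. rewrite Hmu.
    transitivity (e ^ n * h * (e11 M + e12 M * tau2) + e ^ n * (h * (mu1 - mu2)))%C; [|ring].
    rewrite H1. ring.
  - transitivity (mu * e * (e ^ n * h * tau2))%C; [ring|]. rewrite Hmu.
    transitivity (e ^ n * h * (e21 M + e22 M * tau2) + e ^ n * (h * (mu1 - mu2) * tau2))%C; [|ring].
    rewrite H2. ring.
Qed.

Lemma asymptotic_solution_corrected (A : mat_seq) (g V W H J t : nat -> C) :
  bdd H -> bdd J -> vanishes t ->
  asymptotic_solution A g (fun n => V n + t n * H n)%C (fun n => W n + t n * J n)%C ->
  asymptotic_solution A g V W.
Proof.
  intros HH HJ Ht [n0 [u [v [eu [ev [Hs [Heu [Hev E]]]]]]]].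
  exists n0, u, v, (fun n => t n * H n + eu n)%C, (fun n => t n * J n + ev n)%C.
  split; [|split; [|split]]; auto.
  - apply vanishes_plus; auto. now apply vanishes_mult_bdd.
  - apply vanishes_plus; auto. now apply vanishes_mult_bdd.
  - intros n. destruct (E n) as [-> ->]. split; ring.
Qed.

Lemma nearly_solves_corrected (A : mat_seq) (M K : mat) (t F g V W : nat -> C) (mu b : C) :
  is_perturbation A M K t F ->
  bdd t -> bdd F -> l1 (fun n => t n * t n)%C -> l1 (fun n => t (S n) - t n)%C ->
  mu <> 0 -> bdd V -> bdd W ->
  (forall n, (mu * V (S n) = e11 M * V n + e12 M * W n)%C) ->
  (forall n, (mu * W (S n) = e21 M * V n + e22 M * W n)%C) ->
  boundedly_solvable mu M
    (fun n => F n * (e11 K * V n + e12 K * W n) - b * (mu * V (S n)))%C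
    (fun n => F n * (e21 K * V n + e22 K * W n) - b * (mu * W (S n)))%C ->
  l1 (fun n => g n / g (S n) - / mu * (1 - b * t (S n)))%C ->
  exists H J, bdd H /\ bdd J /\
    nearly_solves A g (fun n => V n + t n * H n)%C (fun n => W n + t n * J n)%C.
Proof.
  intros [P11 [P12 [P21 P22]]] Ht HF Ht2 Hdt Hmu HV HW EV EW [H [J [HH [HJ E]]]] Hg.
  exists H, J. split; [|split]; auto. split.
  - eapply l1_ext; [|apply (corrected_residual_l1 (e11 M) (e12 M) (e11 K) (e12 K) mu b
      _ _ t F V W (fun n => V (S n)) H J (fun n => H (S n)) _ Hmu P11 P12 Hg)]; auto using bdd_S.
    + intros n. cbv beta. ring.
    + intros n. destruct (E n) as [E1 _]. rewrite E1. ring.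
  (* The second row is the same estimate with the two components exchanged. *)
  - eapply l1_ext; [|apply (corrected_residual_l1 (e22 M) (e21 M) (e22 K) (e21 K) mu b
      _ _ t F W V (fun n => W (S n)) J H (fun n => J (S n)) _ Hmu P22 P21 Hg)]; auto using bdd_S.
    + intros n. cbv beta. ring.
    + intros n. rewrite EW. ring.
    + intros n. destruct (E n) as [_ E1]. rewrite E1. ring.
Qed.

Lemma asymptotic_pair (A : mat_seq) (M K : mat) (t F g1 g2 V1 W1 V2 W2 : nat -> C)
    (mu1 mu2 b1 b2 delta : C) :
  is_perturbation A M K t F ->
  vanishes t -> bdd F -> l1 (fun n => t n * t n)%C -> l1 (fun n => t (S n) - t n)%C ->
  mu1 <> 0 -> mu2 <> 0 -> bdd V1 -> bdd W1 -> bdd V2 -> bdd W2 ->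
  (forall n, (mu1 * V1 (S n) = e11 M * V1 n + e12 M * W1 n)%C) ->
  (forall n, (mu1 * W1 (S n) = e21 M * V1 n + e22 M * W1 n)%C) ->
  (forall n, (mu2 * V2 (S n) = e11 M * V2 n + e12 M * W2 n)%C) ->
  (forall n, (mu2 * W2 (S n) = e21 M * V2 n + e22 M * W2 n)%C) ->
  boundedly_solvable mu1 M
    (fun n => F n * (e11 K * V1 n + e12 K * W1 n) - b1 * (mu1 * V1 (S n)))%C
    (fun n => F n * (e21 K * V1 n + e22 K * W1 n) - b1 * (mu1 * W1 (S n)))%C ->
  boundedly_solvable mu2 M
    (fun n => F n * (e11 K * V2 n + e12 K * W2 n) - b2 * (mu2 * V2 (S n)))%C
    (fun n => F n * (e21 K * V2 n + e22 K * W2 n) - b2 * (mu2 * W2 (S n)))%C ->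
  l1 (fun n => g1 n / g1 (S n) - / mu1 * (1 - b1 * t (S n)))%C ->
  l1 (fun n => g2 n / g2 (S n) - / mu2 * (1 - b2 * t (S n)))%C ->
  (forall n, (V1 n * W2 n - W1 n * V2 n)%C = delta) -> delta <> 0 ->
  (forall n, g1 n <> 0) -> (forall n, g2 n <> 0) ->
  (forall n, Cmod (g2 (S n) / g1 (S n)) = Cmod (g2 n / g1 n)) \/
  ((forall n, Cmod (g2 (S n) / g1 (S n)) <= Cmod (g2 n / g1 n)) /\
   vanishes (fun n => g2 n / g1 n)%C) ->
  asymptotic_solution A g1 V1 W1 /\ asymptotic_solution A g2 V2 W2.
Proof.
  intros HP Ht HF Ht2 Hdt Hmu1 Hmu2 HV1 HW1 HV2 HW2 EV1 EW1 EV2 EW2 S1 S2 G1 G2 HD Hd Hg1 Hg2 Hr.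
  assert (Htb : bdd t) by now apply vanishes_bdd.
  destruct (nearly_solves_corrected A M K t F g1 V1 W1 mu1 b1) as [H1 [J1 [HH1 [HJ1 N1]]]]; auto.
  destruct (nearly_solves_corrected A M K t F g2 V2 W2 mu2 b2) as [H2 [J2 [HH2 [HJ2 N2]]]]; auto.
  destruct (levinson_pair A g1 g2 _ _ _ _ delta N1 N2) as [R1 R2]; auto; [bd|bd|bd|bd| |].
  - apply vanishes_ext with (fun n => t n * (H1 n * W2 n + V1 n * J2 n + t n * (H1 n * J2 n)
      - J1 n * V2 n - W1 n * H2 n - t n * (J1 n * H2 n)))%C.
    + intros n. rewrite <- (HD n). ring.
    + apply vanishes_mult_bdd; auto. bd.
  - split; [now apply asymptotic_solution_corrected with H1 J1 t
           |now apply asymptotic_solution_corrected with H2 J2 t].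
Qed.

(** The second components and their constant determinant with [V1], [V2] are kept so that
    independence of the exact solutions can be deduced from the asymptotics. *)
Definition asymptotic_basis (A : mat_seq) (g1 V1 g2 V2 : nat -> C) : Prop :=
  exists (W1 W2 : nat -> C) (delta : C),
    bdd W1 /\ bdd W2 /\ delta <> 0 /\
    (forall n, (V1 n * W2 n - W1 n * V2 n)%C = delta) /\
    asymptotic_solution A g1 V1 W1 /\ asymptotic_solution A g2 V2 W2.

(** * Modes of the forcing and the nonresonant case *)

Definition cis (t : R) : C := (cos t, sin t).

Lemma cis_plus (a b : R) : cis (a + b) = (cis a * cis b)%C.
Proof.
  apply injective_projections; simpl; [rewrite cos_plus|rewrite sin_plus]; ring.
Qed.

Lemma cis_0 : cis 0 = 1.
Proof. unfold cis. rewrite cos_0, sin_0. reflexivity. Qed.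

Lemma cis_opp (a : R) : (cis a * cis (- a))%C = 1.
Proof. rewrite <- cis_plus, Rplus_opp_r. apply cis_0. Qed.

Lemma Cmod_cis (a : R) : Cmod (cis a) = 1.
Proof.
  unfold Cmod, cis; simpl. rewrite !Rmult_1_r.
  pose proof (sin2_cos2 a) as H. unfold Rsqr in H.
  replace (cos a * cos a + sin a * sin a) with 1 by lra. apply sqrt_1.
Qed.

Lemma cis_pow (a : R) (n : nat) : (cis a ^ n)%C = cis (INR n * a).
Proof.
  induction n as [|n IH].
  - simpl. rewrite Rmult_0_l. symmetry; apply cis_0.
  - rewrite Cpow_S, IH, <- cis_plus. f_equal. rewrite S_INR. ring.
Qed.

Lemma Ci_neq_0 : Ci <> 0.
Proof. intros E. apply (f_equal snd) in E. simpl in E. lra. Qed.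

Lemma two_neq_0 : RtoC 2 <> 0.
Proof. intros E. apply RtoC_inj in E. lra. Qed.

Lemma Cmult_reg_r (r x y : C) : r <> 0 -> (x * r = y * r)%C -> x = y.
Proof.
  intros Hr H. replace x with (x * r * / r)%C by (field; auto).
  rewrite H. field; auto.
Qed.

Lemma cos_cis (a : R) : RtoC (cos a) = ((cis a + cis (- a)) / 2)%C.
Proof.
  apply Cmult_reg_r with (RtoC 2); [apply two_neq_0|].
  transitivity (cis a + cis (- a))%C; [|field; apply two_neq_0].
  apply injective_projections; simpl; rewrite ?cos_neg, ?sin_neg; ring.
Qed.

Lemma sin_cis (a : R) : RtoC (sin a) = ((cis a - cis (- a)) / (2 * Ci))%C.
Proof.
  assert (H : (2 * Ci)%C <> 0) by (apply Cmult_neq_0; [apply two_neq_0|apply Ci_neq_0]).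
  apply Cmult_reg_r with (2 * Ci)%C; auto.
  transitivity (cis a - cis (- a))%C; [|field; repeat split; first [apply Ci_neq_0|apply two_neq_0]].
  apply injective_projections; simpl; rewrite ?cos_neg, ?sin_neg; ring.
Qed.

Definition forcing (c omega phi : R) (n : nat) : C :=
  RtoC (c * sin (2 * omega * INR (S n) + phi)).

Lemma forcing_modes (c omega phi : R) (n : nat) :
  let z := cis omega in
  let z' := cis (- omega) in
  forcing c omega phi n =
    (c * cis phi / (2 * Ci) * (z * z) * (z * z) ^ n
     + - (c * cis (- phi) / (2 * Ci)) * (z' * z') * (z' * z') ^ n)%C.
Proof.
  intros z z'. unfold forcing, z, z'. rewrite RtoC_mult, sin_cis.
  rewrite <- !cis_plus, !cis_pow.
  replace (2 * omega * INR (S n) + phi)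
    with (phi + ((omega + omega) + INR n * (omega + omega))) by (rewrite S_INR; ring).
  replace (- (phi + ((omega + omega) + INR n * (omega + omega))))
    with (- phi + ((- omega + - omega) + INR n * (- omega + - omega))) by ring.
  rewrite !cis_plus. field. repeat split; first [apply Ci_neq_0|apply two_neq_0].
Qed.

Lemma bdd_forcing (c omega phi : R) : bdd (forcing c omega phi).
Proof.
  exists (Rabs c). intros n. unfold forcing. rewrite Cmod_R, Rabs_mult.
  rewrite <- (Rmult_1_r (Rabs c)) at 2. apply Rmult_le_compat_l; [apply Rabs_pos|].
  apply Rabs_le. apply SIN_bound.
Qed.

Lemma cis_double_neq_1 (omega : R) : 0 < omega < PI -> (cis omega * cis omega)%C <> 1.
Proof.
  intros H E. pose proof (sin_gt_0 omega ltac:(lra) ltac:(lra)) as Hs.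
  pose proof (f_equal fst E) as E1. pose proof (f_equal snd E) as E2. simpl in E1, E2.
  pose proof (sin2_cos2 omega) as H1. unfold Rsqr in H1. nra.
Qed.

(** sin omega > 0 excludes z^2 = 1, and cos omega <> 0 then excludes z^2 = -1. This keeps the third
    harmonics away from resonance. *)
Lemma cis_quadruple_neq_1 (omega : R) : 0 < omega < PI -> omega <> PI / 2 ->
  (cis omega * cis omega * (cis omega * cis omega))%C <> 1.
Proof.
  intros H Hne E. pose proof (sin_gt_0 omega ltac:(lra) ltac:(lra)) as Hs.
  assert (Hc : cos omega <> 0).
  { intros Hc. apply cos_eq_0_0 in Hc. destruct Hc as [k Hk].
    pose proof PI_RGT_0. 
    assert (-1 < IZR k < 1) by (split; apply Rmult_lt_reg_r with PI; lra).
    assert (k = 0%Z) by (assert (-1 < k < 1)%Z by (split; apply lt_IZR; lra); lia).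
    subst k. apply Hne. lra. }
  assert (F : ((cis omega * cis omega - 1) * (cis omega * cis omega + 1))%C = 0).
  { replace ((cis omega * cis omega - 1) * (cis omega * cis omega + 1))%C
      with (cis omega * cis omega * (cis omega * cis omega) - 1)%C by ring. rewrite E. ring. }
  destruct (Ceq_dec (cis omega * cis omega - 1) 0) as [F1|F1].
  - apply (cis_double_neq_1 omega H).
    replace (cis omega * cis omega)%C with (cis omega * cis omega - 1 + 1)%C by ring.
    rewrite F1. ring.
  - assert (F2 : (cis omega * cis omega + 1)%C = 0).
    { apply Cmult_reg_r with (cis omega * cis omega - 1)%C; auto.
      rewrite Cmult_comm, F. ring. }
    apply (f_equal snd) in F2. simpl in F2. nra.
Qed.

(** The forcing moves [mu1] to mu1 z^2 and mu1 z^(-2). Neither equals [mu1], because z^2 <> 1, nor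
    mu2 = 1 / mu1, because mu1^2 is neither z^2 nor z^(-2). Nothing is left for a growth factor to
    absorb, whence b = 0. *)
Lemma nonresonant_forcing (c omega phi : R) (M K : mat) (mu1 mu2 tau1 tau2 : C) :
  0 < omega < PI ->
  eigenbasis M mu1 mu2 tau1 tau2 -> (mu1 * mu2)%C = 1 ->
  (mu1 * mu1)%C <> (cis omega * cis omega)%C ->
  (mu1 * mu1)%C <> (cis (- omega) * cis (- omega))%C ->
  boundedly_solvable mu1 M
    (fun n => forcing c omega phi n * (e11 K * 1 + e12 K * tau1) - 0 * (mu1 * 1))%C
    (fun n => forcing c omega phi n * (e21 K * 1 + e22 K * tau1) - 0 * (mu1 * tau1))%C.
Proof.
  intros Ho HM H12 N1 N2.
  pose proof (cis_opp omega) as Hz. pose proof (cis_double_neq_1 omega Ho) as Hz2.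
  pose proof (fun n => forcing_modes c omega phi n) as HF.
  pose proof (Cmod_cis omega) as Hm1. pose proof (Cmod_cis (- omega)) as Hm2.
  set (z := cis omega) in *. set (z' := cis (- omega)) in *.
  set (cp := (c * cis phi / (2 * Ci))%C) in *. set (cm := (c * cis (- phi) / (2 * Ci))%C) in *.
  assert (Hmu : mu1 <> 0).
  { intros E. rewrite E in H12. apply (f_equal fst) in H12. simpl in H12. lra. }
  apply boundedly_solvable_ext with
    (fun n => (z * z) ^ n * (cp * (z * z) * (e11 K * 1 + e12 K * tau1))
            + (z' * z') ^ n * (- cm * (z' * z') * (e11 K * 1 + e12 K * tau1)))%C
    (fun n => (z * z) ^ n * (cp * (z * z) * (e21 K * 1 + e22 K * tau1))
            + (z' * z') ^ n * (- cm * (z' * z') * (e21 K * 1 + e22 K * tau1)))%C.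
  { intros n. rewrite HF. ring. }
  { intros n. rewrite HF. ring. }
  assert (G : forall w w' : C, (w * w' = 1)%C -> (w * w)%C <> 1 -> (mu1 * mu1)%C <> (w' * w')%C ->
     (mu1 * (w * w))%C <> mu1 /\ (mu1 * (w * w))%C <> mu2).
  { intros w w' Hw Hw2 Hn. split; intros E.
    - apply Hw2. apply Cmult_reg_r with mu1; auto. rewrite Cmult_comm, E. ring.
    - apply Hn. transitivity (mu1 * (mu1 * (w * w)) * (w' * w'))%C.
      + transitivity (mu1 * mu1 * ((w * w') * (w * w')))%C; [rewrite Hw; ring|ring].
      + rewrite E, H12. ring. }
  destruct (G z z' Hz Hz2 N2) as [G1 G2].
  destruct (G z' z) as [G3 G4]; auto.
  { rewrite Cmult_comm. exact Hz. }
  { intros E. apply Hz2. transitivity ((z' * z') * (z * z))%C; [rewrite E; ring|].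
    transitivity ((z * z') * (z * z'))%C; [ring|rewrite Hz; ring]. }
  apply boundedly_solvable_plus; apply mode_solvable with mu1 mu2 tau1 tau2; auto;
    rewrite Cmod_mult, ?Hm1, ?Hm2; ring.
Qed.

Lemma l1_zero : l1 (fun _ => RtoC 0).
Proof.
  apply l1_le with (fun n => 0 * / 2 ^ n).
  - intros n. rewrite Cmod_0. lra.
  - apply (ex_series_scal (V := R_NormedModule) 0). apply ex_series_ext with (fun n => (/ 2) ^ n).
    + intros n. now rewrite pow_inv.
    + apply ex_series_geom. rewrite Rabs_pos_eq; lra.
Qed.

Definition Cdecay (gam : R) (n : nat) : C := RtoC (pow_decay gam n).

Lemma Cdecay_vanishes (gam : R) : 0 < gam -> vanishes (Cdecay gam).
Proof.
  intros Hg. apply vanishes_le with (pow_decay gam).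
  - exists 0%nat. intros n _. unfold Cdecay. rewrite Cmod_R, Rabs_pos_eq; [lra|].
    left; apply pow_decay_pos.
  - now apply pow_decay_lim.
Qed.

Lemma Cdecay_square_l1 (gam : R) : 1 / 2 < gam -> l1 (fun n => Cdecay gam n * Cdecay gam n)%C.
Proof.
  intros Hg. apply l1_le with (fun n => pow_decay gam n * pow_decay gam n).
  - intros n. unfold Cdecay. rewrite <- RtoC_mult, Cmod_R, Rabs_pos_eq; [lra|].
    left; apply Rmult_lt_0_compat; apply pow_decay_pos.
  - now apply pow_decay_square_series.
Qed.

Lemma Cdecay_variation_l1 (gam : R) : 0 <= gam -> l1 (fun n => Cdecay gam (S n) - Cdecay gam n)%C.
Proof.
  intros Hg. apply l1_le with (fun n => pow_decay gam n - pow_decay gam (S n)).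
  - intros n. unfold Cdecay. rewrite <- RtoC_minus, Cmod_R, Rabs_minus_sym, Rabs_pos_eq; [lra|].
    pose proof (pow_decay_decr gam n Hg). lra.
  - now apply pow_decay_variation.
Qed.

Lemma Cpow_neq_0 (c : C) (n : nat) : c <> 0 -> (c ^ n)%C <> 0.
Proof. intros H. apply Cmod_gt_0. rewrite Cmod_pow. apply pow_lt. now apply Cmod_gt_0. Qed.

Lemma nonresonant_asymptotics (A : mat_seq) (M K : mat) (c omega phi gam : R)
    (mu1 mu2 tau1 tau2 : C) :
  0 < omega < PI -> 1 / 2 < gam <= 1 ->
  is_perturbation A M K (Cdecay gam) (forcing c omega phi) ->
  eigenbasis M mu1 mu2 tau1 tau2 -> (mu1 * mu2)%C = 1 -> mu1 <> mu2 ->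
  (mu1 * mu1)%C <> (cis omega * cis omega)%C ->
  (mu1 * mu1)%C <> (cis (- omega) * cis (- omega))%C ->
  asymptotic_basis A (Cpow mu1) (fun _ => RtoC 1) (Cpow mu2) (fun _ => RtoC 1).
Proof.
  intros Ho Hg HP.
  (* [W] treats the ordering |mu2| <= |mu1| required by [asymptotic_pair], in which (mu2 / mu1)^n
     either decays or has modulus 1; the general case exchanges the eigenvalues. *)
  assert (W : forall mu1 mu2 tau1 tau2, eigenbasis M mu1 mu2 tau1 tau2 ->
    (mu1 * mu2)%C = 1 -> mu1 <> mu2 ->
    (mu1 * mu1)%C <> (cis omega * cis omega)%C ->
    (mu1 * mu1)%C <> (cis (- omega) * cis (- omega))%C ->
    (mu2 * mu2)%C <> (cis omega * cis omega)%C ->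
    (mu2 * mu2)%C <> (cis (- omega) * cis (- omega))%C ->
    Cmod mu2 <= Cmod mu1 ->
    asymptotic_solution A (Cpow mu1) (fun _ => RtoC 1) (fun _ => tau1) /\
    asymptotic_solution A (Cpow mu2) (fun _ => RtoC 1) (fun _ => tau2)).
  { clear mu1 mu2 tau1 tau2. intros mu1 mu2 tau1 tau2 HM H12 Hne N1 N2 N3 N4 Hle.
    assert (Hmu1 : mu1 <> 0).
    { intros E. rewrite E in H12. apply (f_equal fst) in H12. simpl in H12. lra. }
    assert (Hmu2 : mu2 <> 0).
    { intros E. rewrite E in H12. apply (f_equal fst) in H12. simpl in H12. lra. }
    assert (HM' : eigenbasis M mu2 mu1 tau2 tau1).
    { destruct HM as [P1 [P2 [P3 [P4 [P5 P6]]]]].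
      repeat split; auto; [rewrite P5|rewrite P6]; ring. }
    assert (H21 : (mu2 * mu1)%C = 1) by (rewrite Cmult_comm; exact H12).
    assert (Hq : forall n, (mu2 ^ n / mu1 ^ n)%C = ((mu2 / mu1) ^ n)%C).
    { induction n as [|n IH]; [simpl; field; intros E; apply RtoC_inj in E; lra|].
      rewrite !Cpow_S, <- IH. field. split; auto using Cpow_neq_0. }
    apply asymptotic_pair with M K (Cdecay gam) (forcing c omega phi) mu1 mu2 (RtoC 0) (RtoC 0)
      (tau2 - tau1)%C; auto using bdd_const, bdd_forcing.
    - apply Cdecay_vanishes; lra.
    - apply Cdecay_square_l1; lra.
    - apply Cdecay_variation_l1; lra.
    - intros _. destruct HM as [P _]. rewrite <- P. ring.
    - intros _. destruct HM as [_ [P _]]. rewrite <- P. ring.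
    - intros _. destruct HM as [_ [_ [P _]]]. rewrite <- P. ring.
    - intros _. destruct HM as [_ [_ [_ [P _]]]]. rewrite <- P. ring.
    - now apply nonresonant_forcing with mu2 tau2.
    - now apply nonresonant_forcing with mu1 tau1.
    - apply l1_ext with (fun _ => RtoC 0); [|apply l1_zero].
      intros n. rewrite Cpow_S. field. split; auto using Cpow_neq_0.
    - apply l1_ext with (fun _ => RtoC 0); [|apply l1_zero].
      intros n. rewrite Cpow_S. field. split; auto using Cpow_neq_0.
    - intros _. ring.
    - intros E. apply Hne. destruct HM as [P1 [_ [P2 _]]]. rewrite <- P1, <- P2.
      replace tau2 with (tau2 - tau1 + tau1)%C by ring. rewrite E. ring.
    - auto using Cpow_neq_0.
    - auto using Cpow_neq_0.
    - apply Cmod_gt_0 in Hmu1 as Hp1.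
      assert (Hr : Cmod (mu2 / mu1) <= 1).
      { rewrite Cmod_div by auto. apply Rmult_le_reg_r with (Cmod mu1); auto.
        unfold Rdiv. rewrite Rmult_assoc, Rinv_l; lra. }
      pose proof (Cmod_ge_0 (mu2 / mu1)) as Hr0.
      destruct (Rle_lt_or_eq_dec _ _ Hr) as [Hlt|Heq].
      + right. split.
        * intros n. rewrite !Hq, !Cmod_pow. simpl.
          assert (0 <= Cmod (mu2 / mu1) ^ n) by now apply pow_le. nra.
        * apply vanishes_ext with (fun n => (mu2 / mu1) ^ n)%C.
          { intros n; now rewrite Hq. }
          apply vanishes_le with (fun n => Cmod (mu2 / mu1) ^ n).
          { exists 0%nat. intros n _. rewrite Cmod_pow. lra. }
          apply is_lim_seq_geom. rewrite Rabs_pos_eq; auto.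
      + left. intros n. rewrite !Hq, !Cmod_pow, Heq, !pow1. reflexivity. }
  intros HM H12 Hne N1 N2. exists (fun _ => tau1), (fun _ => tau2), (tau2 - tau1)%C.
  split; [apply bdd_const|]. split; [apply bdd_const|]. split; [|split; [intros _; ring|]].
  { intros E. apply Hne. destruct HM as [P1 [_ [P2 _]]]. rewrite <- P1, <- P2.
    replace tau2 with (tau2 - tau1 + tau1)%C by ring. rewrite E. ring. }
  assert (Hz : (cis omega * cis omega * (cis (- omega) * cis (- omega)))%C = 1).
  { transitivity (cis omega * cis (- omega) * (cis omega * cis (- omega)))%C; [ring|].
    rewrite cis_opp. ring. }
  assert (HH : (mu1 * mu1 * (mu2 * mu2))%C = 1).
  { transitivity ((mu1 * mu2) * (mu1 * mu2))%C; [ring|]. rewrite H12. ring. }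
  (* Uniqueness of inverses: it transfers the two nonresonance conditions from [mu1] to mu2 = 1 /
     mu1. *)
  assert (Hsw : forall a b x y : C, (a * b = 1)%C -> (x * y = 1)%C -> b = y -> a = x).
  { intros a b x y Hab Hxy <-. transitivity (a * (x * b))%C; [rewrite Hxy; ring|].
    transitivity ((a * b) * x)%C; [ring|]. rewrite Hab. ring. }
  assert (N3 : (mu2 * mu2)%C <> (cis omega * cis omega)%C).
  { intros E. apply N2. apply (Hsw _ _ _ (cis omega * cis omega)%C HH); auto.
    rewrite Cmult_comm. exact Hz. }
  assert (N4 : (mu2 * mu2)%C <> (cis (- omega) * cis (- omega))%C).
  { intros E. apply N1. apply (Hsw _ _ _ (cis (- omega) * cis (- omega))%C HH); auto. }
  destruct (Rle_dec (Cmod mu2) (Cmod mu1)) as [Hle|Hle].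
  - now apply W.
  - destruct (W mu2 mu1 tau2 tau1); auto; try lra.
    + destruct HM as [P1 [P2 [P3 [P4 [P5 P6]]]]].
      repeat split; auto; [rewrite P5|rewrite P6]; ring.
    + rewrite Cmult_comm. exact H12.
Qed.

(** * The resonant case *)

Lemma Cpow_mult_distr (x y : C) (n : nat) : ((x * y) ^ n = x ^ n * y ^ n)%C.
Proof.
  induction n as [|n IH]; [simpl; ring|]. rewrite !Cpow_S, IH. ring.
Qed.

Lemma Cpow_1_l (n : nat) : (RtoC 1 ^ n)%C = 1.
Proof. induction n as [|n IH]; [reflexivity|]. rewrite Cpow_S, IH. ring. Qed.

Lemma eigenbasis_sym (M : mat) (mu1 mu2 tau1 tau2 : C) :
  eigenbasis M mu1 mu2 tau1 tau2 -> eigenbasis M mu2 mu1 tau2 tau1.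
Proof.
  intros [P1 [P2 [P3 [P4 [P5 P6]]]]]. repeat split; auto; [rewrite P5|rewrite P6]; ring.
Qed.

(** The factor s^n of the eigenvalues s z and s z^(-1) is left to the scale, so that only the
    oscillation remains here. *)
Definition wave (omega : R) (a a' : C) (n : nat) : C :=
  (a * cis omega ^ n + a' * cis (- omega) ^ n)%C.

(** These are the coordinates of K (1, [tau]) in the eigenvectors (1, [tau1]) and (1, [tau2]) of
    M. *)
Definition coordinates (K : mat) (tau1 tau2 tau k1 k2 : C) : Prop :=
  (e11 K + e12 K * tau = k1 + k2)%C /\ (e21 K + e22 K * tau = k1 * tau1 + k2 * tau2)%C.

(** Forcing times wave has the frequencies z^3 and z^(-3), harmless because z^2 and z^4 differ from
    1, and z and z^(-1), at which s z and s z^(-1) are eigenvalues. At frequency z the source splits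
    along the eigenvectors: the [k22] part along the second is solvable, while the [k12] part along
    the first has to cancel against the term with [b]. This is the first matching condition;
    frequency z^(-1) gives the second. *)
Lemma resonant_forcing (c omega phi : R) (M K : mat)
    (s a a' b tau1 tau2 k11 k12 k21 k22 : C) :
  0 < omega < PI -> omega <> PI / 2 -> (s * s)%C = 1 ->
  eigenbasis M (s * cis omega) (s * cis (- omega)) tau1 tau2 ->
  coordinates K tau1 tau2 tau1 k11 k21 -> coordinates K tau1 tau2 tau2 k12 k22 ->
  (c * cis phi / (2 * Ci) * a' * cis omega * k12 = b * s * a)%C ->
  (- (c * cis (- phi) / (2 * Ci)) * a * cis (- omega) * k21 = b * s * a')%C ->
  boundedly_solvable s M
    (fun n => forcing c omega phi n *
       (e11 K * wave omega a a' n + e12 K * wave omega (a * tau1) (a' * tau2) n)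
       - b * (s * wave omega a a' (S n)))%C
    (fun n => forcing c omega phi n *
       (e21 K * wave omega a a' n + e22 K * wave omega (a * tau1) (a' * tau2) n)
       - b * (s * wave omega (a * tau1) (a' * tau2) (S n)))%C.
Proof.
  intros Ho Ho2 Hs HM [K11 K21] [K12 K22] R1 R2.
  pose proof (cis_opp omega) as Hz. pose proof (cis_double_neq_1 omega Ho) as Hz2.
  pose proof (cis_quadruple_neq_1 omega Ho Ho2) as Hz4.
  pose proof (fun n => forcing_modes c omega phi n) as HF.
  pose proof (Cmod_cis omega) as Hm1. pose proof (Cmod_cis (- omega)) as Hm2.
  unfold wave.
  set (z := cis omega) in *. set (z' := cis (- omega)) in *.
  set (cp := (c * cis phi / (2 * Ci))%C) in *. set (cm := (c * cis (- phi) / (2 * Ci))%C) in *.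
  assert (Hsne : s <> 0).
  { intros E. rewrite E in Hs. apply (f_equal fst) in Hs. simpl in Hs. lra. }
  assert (Hcanc : forall x y : C, (s * x = s * y)%C -> x = y).
  { intros x y E. apply Cmult_reg_r with s; auto. rewrite !(Cmult_comm _ s). exact E. }
  assert (G : forall w w' : C, (w * w' = 1)%C -> (w * w)%C <> 1 -> (w * w * (w * w))%C <> 1 ->
     (s * (w * w * w))%C <> (s * w)%C /\ (s * (w * w * w))%C <> (s * w')%C).
  { intros w w' Hw Hw2 Hw4. split; intros E; apply Hcanc in E.
    - apply Hw2. transitivity ((w * w * w) * w')%C.
      + transitivity (w * w * (w * w'))%C; [rewrite Hw; ring|ring].
      + rewrite E. exact Hw.
    - apply Hw4. transitivity ((w * w * w) * w)%C; [ring|]. rewrite E, Cmult_comm. exact Hw. }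
  destruct (G z z') as [G1 G2]; auto.
  assert (Hz' : (z' * z)%C = 1) by (rewrite Cmult_comm; exact Hz).
  destruct (G z' z) as [G3 G4]; auto.
  { intros E. apply Hz2. transitivity ((z' * z') * (z * z))%C; [rewrite E; ring|].
    transitivity ((z * z') * (z * z'))%C; [ring|rewrite Hz; ring]. }
  { intros E. apply Hz4. transitivity ((z' * z' * (z' * z')) * (z * z * (z * z)))%C; [rewrite E; ring|].
    transitivity ((z * z') * (z * z') * ((z * z') * (z * z')))%C; [ring|rewrite Hz; ring]. }
  assert (Hne : (s * z)%C <> (s * z')%C).
  { intros E. apply Hcanc in E. apply Hz2. rewrite E at 2. exact Hz. }
  assert (S1 : boundedly_solvable s M
    (fun n => (z * z * z) ^ n * (cp * (z * z) * a * (e11 K + e12 K * tau1)))%C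
    (fun n => (z * z * z) ^ n * (cp * (z * z) * a * (e21 K + e22 K * tau1)))%C).
  { apply mode_solvable with (s * z)%C (s * z')%C tau1 tau2; auto.
    rewrite !Cmod_mult, Hm1. ring. }
  assert (S2 : boundedly_solvable s M
    (fun n => (z' * z' * z') ^ n * (- cm * (z' * z') * a' * (e11 K + e12 K * tau2)))%C
    (fun n => (z' * z' * z') ^ n * (- cm * (z' * z') * a' * (e21 K + e22 K * tau2)))%C).
  { apply mode_solvable with (s * z)%C (s * z')%C tau1 tau2; auto.
    rewrite !Cmod_mult, Hm2. ring. }
  assert (S3 : boundedly_solvable s M
    (fun n => z ^ n * (cp * (z * z) * a' * k22))%C
    (fun n => z ^ n * ((cp * (z * z) * a' * k22) * tau2))%C).
  { apply resonant_mode_solvable with (s * z)%C (s * z')%C tau1; auto. }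
  assert (S4 : boundedly_solvable s M
    (fun n => z' ^ n * (- cm * (z' * z') * a * k11))%C
    (fun n => z' ^ n * ((- cm * (z' * z') * a * k11) * tau1))%C).
  { apply resonant_mode_solvable with (s * z')%C (s * z)%C tau2; auto.
    now apply eigenbasis_sym. }
  pose proof (boundedly_solvable_plus _ _ _ _ _ _
    (boundedly_solvable_plus _ _ _ _ _ _ S1 S2)
    (boundedly_solvable_plus _ _ _ _ _ _ S3 S4)) as S.
  (* The products z^(2 n) z^(-n) must collapse to z^n; below, this is given to [ring] as a multiple
     of [Z * Z' - 1]. *)
  assert (HZ : forall n, (z ^ n * z' ^ n)%C = 1).
  { intros n. rewrite <- Cpow_mult_distr, Hz. apply Cpow_1_l. }
  revert S. apply boundedly_solvable_ext.
  - intros n. rewrite HF, !Cpow_S, !Cpow_mult_distr. specialize (HZ n).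
    set (Z := (z ^ n)%C) in *. set (Z' := (z' ^ n)%C) in *.
    transitivity ((cp * (z * z) * (Z * Z) + - cm * (z' * z') * (Z' * Z'))
      * (a * Z * (e11 K + e12 K * tau1) + a' * Z' * (e11 K + e12 K * tau2))
      - (z * Z * (b * s * a) + z' * Z' * (b * s * a')))%C; [|ring].
    rewrite <- R1, <- R2, K11, K12.
    transitivity ((cp * (z * z) * (Z * Z) + - cm * (z' * z') * (Z' * Z'))
      * (a * Z * (k11 + k21) + a' * Z' * (k12 + k22))
      - (z * Z * (cp * a' * z * k12) + z' * Z' * (- cm * a * z' * k21))
      - (Z * Z' - 1) * (cp * (z * z) * a' * (k12 + k22) * Z
        + - cm * (z' * z') * a * (k11 + k21) * Z'))%C; [ring|].
    rewrite HZ. ring.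
  - intros n. rewrite HF, !Cpow_S, !Cpow_mult_distr. specialize (HZ n).
    set (Z := (z ^ n)%C) in *. set (Z' := (z' ^ n)%C) in *.
    transitivity ((cp * (z * z) * (Z * Z) + - cm * (z' * z') * (Z' * Z'))
      * (a * Z * (e21 K + e22 K * tau1) + a' * Z' * (e21 K + e22 K * tau2))
      - (z * Z * tau1 * (b * s * a) + z' * Z' * tau2 * (b * s * a')))%C; [|ring].
    rewrite <- R1, <- R2, K21, K22.
    transitivity ((cp * (z * z) * (Z * Z) + - cm * (z' * z') * (Z' * Z'))
      * (a * Z * (k11 * tau1 + k21 * tau2) + a' * Z' * (k12 * tau1 + k22 * tau2))
      - (z * Z * tau1 * (cp * a' * z * k12) + z' * Z' * tau2 * (- cm * a * z' * k21))
      - (Z * Z' - 1) * (cp * (z * z) * a' * (k12 * tau1 + k22 * tau2) * Z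
        + - cm * (z' * z') * a * (k11 * tau1 + k21 * tau2) * Z'))%C; [ring|].
    rewrite HZ. ring.
Qed.

Lemma bdd_wave (omega : R) (a a' : C) : bdd (wave omega a a').
Proof.
  exists (Cmod a + Cmod a'). intros n. unfold wave. eapply Rle_trans; [apply Cmod_triangle|].
  rewrite !Cmod_mult, !Cmod_pow, !Cmod_cis, pow1. lra.
Qed.

Lemma wave_eigen (omega : R) (M : mat) (s a a' tau1 tau2 : C) (n : nat) :
  eigenbasis M (s * cis omega) (s * cis (- omega)) tau1 tau2 ->
  (s * wave omega a a' (S n)
     = e11 M * wave omega a a' n + e12 M * wave omega (a * tau1) (a' * tau2) n)%C /\
  (s * wave omega (a * tau1) (a' * tau2) (S n)
     = e21 M * wave omega a a' n + e22 M * wave omega (a * tau1) (a' * tau2) n)%C.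
Proof.
  intros [P1 [P2 [P3 [P4 _]]]]. unfold wave. rewrite !Cpow_S.
  split.
  - transitivity ((s * cis omega) * (a * cis omega ^ n)
      + (s * cis (- omega)) * (a' * cis (- omega) ^ n))%C; [ring|].
    rewrite <- P1, <- P3. ring.
  - transitivity ((s * cis omega * tau1) * (a * cis omega ^ n)
      + (s * cis (- omega) * tau2) * (a' * cis (- omega) ^ n))%C; [ring|].
    rewrite <- P2, <- P4. ring.
Qed.

Lemma f_growth_pos (gam b : R) (n : nat) : 0 < f_growth gam b n.
Proof. rewrite f_growth_exp. apply exp_pos. Qed.

(** The matching conditions are stated for the amplitudes of the cosine wave. For the sine wave the
    ratio of the two amplitudes has the opposite sign, so the same conditions hold with - beta. *)
Lemma resonant_asymptotics (A : mat_seq) (M K : mat) (c omega phi gam beta theta : R)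
    (s tau1 tau2 k11 k12 k21 k22 : C) :
  0 < omega < PI -> omega <> PI / 2 -> 1 / 2 < gam <= 1 -> 0 <= beta ->
  is_perturbation A M K (Cdecay gam) (forcing c omega phi) ->
  (s * s)%C = 1 ->
  eigenbasis M (s * cis omega) (s * cis (- omega)) tau1 tau2 ->
  coordinates K tau1 tau2 tau1 k11 k21 -> coordinates K tau1 tau2 tau2 k12 k22 ->
  (c * cis phi / (2 * Ci) * cis (- theta) * cis omega * k12 = beta * s * cis theta)%C ->
  (- (c * cis (- phi) / (2 * Ci)) * cis theta * cis (- omega) * k21
     = beta * s * cis (- theta))%C ->
  asymptotic_basis A
    (fun n => s ^ n * f_growth gam beta n)%C (fun n => RtoC (cos (omega * INR n + theta)))
    (fun n => s ^ n * f_growth gam (- beta) n)%C (fun n => RtoC (sin (omega * INR n + theta))).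
Proof.
  intros Ho Ho2 Hg Hb HP Hs HM K1 K2 R1 R2.
  assert (Hsne : s <> 0).
  { intros E. rewrite E in Hs. apply (f_equal fst) in Hs. simpl in Hs. lra. }
  assert (Hfne : forall b n, RtoC (f_growth gam b n) <> 0).
  { intros b n E. apply RtoC_inj in E. pose proof (f_growth_pos gam b n). lra. }
  assert (Hfs : forall b : R, l1 (fun n => s ^ n * f_growth gam b n / (s ^ S n * f_growth gam b (S n))
     - / s * (1 - b * Cdecay gam (S n)))%C).
  { intros b. pose proof (f_growth_step gam b Hg) as H.
    apply l1_ext with (fun n => / s * RtoC (f_growth gam b n / f_growth gam b (S n)
      - (1 - b * pow_decay gam (S n))))%C.
    - intros n. rewrite !RtoC_minus, RtoC_mult, RtoC_div.
      2: { pose proof (f_growth_pos gam b (S n)). lra. }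
      rewrite Cpow_S. unfold Cdecay. field. repeat split; auto using Cpow_neq_0.
    - apply l1_bdd_mult; auto using bdd_const. }
  assert (Hratio : forall n, (s ^ n * f_growth gam (- beta) n / (s ^ n * f_growth gam beta n))%C
     = RtoC (exp (- (2 * beta * growth_exponent gam n)))).
  { intros n. transitivity (RtoC (f_growth gam (- beta) n / f_growth gam beta n)).
    - rewrite RtoC_div by (pose proof (f_growth_pos gam beta n); lra).
      field. auto using Cpow_neq_0.
    - f_equal. rewrite !f_growth_exp. unfold Rdiv. rewrite <- exp_Ropp, <- exp_plus. f_equal. ring. }
  set (a := (cis theta / 2)%C). set (a' := (cis (- theta) / 2)%C).
  set (d := (cis theta / (2 * Ci))%C). set (d' := (- (cis (- theta) / (2 * Ci)))%C).
  assert (Ecos : forall n, wave omega a a' n = RtoC (cos (omega * INR n + theta))).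
  { intros n. unfold wave, a, a'. rewrite cos_cis, !cis_pow.
    replace (omega * INR n + theta) with (theta + INR n * omega) by ring.
    replace (- (theta + INR n * omega)) with (- theta + INR n * - omega) by ring.
    rewrite !cis_plus. field. }
  assert (Esin : forall n, wave omega d d' n = RtoC (sin (omega * INR n + theta))).
  { intros n. unfold wave, d, d'. rewrite sin_cis, !cis_pow.
    replace (omega * INR n + theta) with (theta + INR n * omega) by ring.
    replace (- (theta + INR n * omega)) with (- theta + INR n * - omega) by ring.
    rewrite !cis_plus. field. repeat split; first [apply Ci_neq_0|apply two_neq_0]. }
  assert (Hmu12 : (s * cis omega)%C <> (s * cis (- omega))%C).
  { intros E. apply (cis_double_neq_1 omega Ho).
    transitivity (s * (s * cis omega) * cis omega)%C; [|rewrite E].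
    - transitivity ((s * s) * (cis omega * cis omega))%C; [rewrite Hs; ring|ring].
    - transitivity ((s * s) * (cis omega * cis (- omega)))%C; [ring|]. rewrite Hs, cis_opp. ring. }
  (* The determinant of the two waves is independent of n since z z^(-1) = 1; the factor - 1 / (2 i)
     comes from the cosine and sine amplitudes. *)
  assert (Hdet : forall n, (wave omega a a' n * wave omega (d * tau1) (d' * tau2) n
     - wave omega (a * tau1) (a' * tau2) n * wave omega d d' n)%C
     = ((tau2 - tau1) * - / (2 * Ci))%C).
  { intros n. 
    transitivity ((cis omega ^ n * cis (- omega) ^ n) * ((a * d' - a' * d) * (tau2 - tau1)))%C.
    { unfold wave. ring. }
    rewrite <- Cpow_mult_distr, cis_opp, Cpow_1_l. unfold a, a', d, d'.
    transitivity ((cis theta * cis (- theta)) * ((tau2 - tau1) * - / (2 * Ci)))%C.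
    { field. repeat split; first [apply Ci_neq_0|apply two_neq_0]. }
    rewrite cis_opp. ring. }
  assert (Hdelta : ((tau2 - tau1) * - / (2 * Ci))%C <> 0).
  { apply Cmult_neq_0.
    + intros E. apply Hmu12. destruct HM as [P1 [_ [P2 _]]]. rewrite <- P1, <- P2.
      replace tau2 with (tau2 - tau1 + tau1)%C by ring. rewrite E. ring.
    + intros E. assert (H : (- / (2 * Ci) * (- (2 * Ci)))%C = 1).
      { field. repeat split; first [apply Ci_neq_0|apply two_neq_0]. }
      rewrite E in H. apply (f_equal fst) in H. simpl in H. lra. }
  destruct (asymptotic_pair A M K (Cdecay gam) (forcing c omega phi)
     (fun n => s ^ n * f_growth gam beta n)%C (fun n => s ^ n * f_growth gam (- beta) n)%C
     (wave omega a a') (wave omega (a * tau1) (a' * tau2))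
     (wave omega d d') (wave omega (d * tau1) (d' * tau2)) s s (RtoC beta) (RtoC (- beta))
     ((tau2 - tau1) * - / (2 * Ci))%C) as [Q1 Q2]; auto using bdd_wave, bdd_forcing.
  - apply Cdecay_vanishes; lra.
  - apply Cdecay_square_l1; lra.
  - apply Cdecay_variation_l1; lra.
  - intros n. now apply wave_eigen.
  - intros n. now apply wave_eigen.
  - intros n. now apply wave_eigen.
  - intros n. now apply wave_eigen.
  - apply resonant_forcing with k11 k12 k21 k22; auto; unfold a, a'.
    + transitivity ((c * cis phi / (2 * Ci) * cis (- theta) * cis omega * k12) / 2)%C.
      { field. repeat split; first [apply Ci_neq_0|apply two_neq_0]. }
      rewrite R1. field.
    + transitivity ((- (c * cis (- phi) / (2 * Ci)) * cis theta * cis (- omega) * k21) / 2)%C.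
      { field. repeat split; first [apply Ci_neq_0|apply two_neq_0]. }
      rewrite R2. field.
  - apply resonant_forcing with k11 k12 k21 k22; auto; unfold d, d'; rewrite RtoC_opp.
    + transitivity (- (c * cis phi / (2 * Ci) * cis (- theta) * cis omega * k12) / (2 * Ci))%C.
      { field. repeat split; first [apply Ci_neq_0|apply two_neq_0]. }
      rewrite R1. field. repeat split; first [apply Ci_neq_0|apply two_neq_0].
    + transitivity ((- (c * cis (- phi) / (2 * Ci)) * cis theta * cis (- omega) * k21) / (2 * Ci))%C.
      { field. repeat split; first [apply Ci_neq_0|apply two_neq_0]. }
      rewrite R2. field. repeat split; first [apply Ci_neq_0|apply two_neq_0].
  - intros n. apply Cmult_neq_0; auto using Cpow_neq_0.
  - intros n. apply Cmult_neq_0; auto using Cpow_neq_0.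
  (* For beta > 0 the ratio of the scales is nonincreasing and tends to 0; for beta = 0 its modulus
     is constant, the other alternative of the Levinson theorem. *)
  - destruct (Rle_lt_or_eq_dec _ _ Hb) as [Hb'|<-].
    + right. split.
      * intros n. rewrite !Hratio, !Cmod_R, !Rabs_pos_eq by (left; apply exp_pos).
        pose proof (growth_exponent_incr gam n ltac:(lra)) as [Hlt|Heq].
        -- left. apply exp_increasing. nra.
        -- rewrite Heq. lra.
      * apply vanishes_ext with (fun n => RtoC (exp (- (2 * beta * growth_exponent gam n)))).
        { intros n; now rewrite Hratio. }
        apply vanishes_le with (fun n => exp (- (2 * beta * growth_exponent gam n))).
        { exists 0%nat. intros n _. rewrite Cmod_R, Rabs_pos_eq; [lra|left; apply exp_pos]. }
        apply (is_lim_comp_seq exp (fun n => - (2 * beta * growth_exponent gam n)) m_infty 0).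
        -- apply is_lim_exp_m.
        -- exists 0%nat. intros; discriminate.
        -- apply is_lim_seq_ext with (fun n => - (2 * beta) * growth_exponent gam n).
           { intros; ring. }
           replace m_infty with (Rbar_mult (- (2 * beta)) p_infty).
           ++ apply is_lim_seq_scal_l. apply growth_exponent_lim. lra.
           ++ rewrite Rbar_mult_comm. unfold Rbar_mult, Rbar_mult'.
              destruct (Rle_dec 0 (- (2 * beta))) as [H1|H1]; [exfalso; lra|reflexivity].
    + left. intros n. rewrite !Hratio. do 2 f_equal. rewrite !Rmult_0_r, !Rmult_0_l. reflexivity.
  - assert (Hext : forall g V V' W, (forall n, V n = V' n) ->
      asymptotic_solution A g V W -> asymptotic_solution A g V' W).
    { intros g V V' W EV [n0 [u [v [eu [ev [X1 [X2 [X3 X4]]]]]]]].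
      exists n0, u, v, eu, ev. repeat split; auto; try apply X1; auto; try apply X4.
      rewrite <- EV. apply X4. }
    exists (wave omega (a * tau1) (a' * tau2)), (wave omega (d * tau1) (d' * tau2)),
      ((tau2 - tau1) * - / (2 * Ci))%C.
    split; [apply bdd_wave|split; [apply bdd_wave|split; [exact Hdelta|split; [|split]]]].
    + intros n. rewrite <- Ecos, <- Esin. apply Hdet.
    + eapply Hext; [exact Ecos|exact Q1].
    + eapply Hext; [exact Esin|exact Q2].
Qed.

(** * The functions cos (k t) and sin (k t) / k *)

(** Both functions are even in k, hence real functions of lam = k^2. Working with them removes
    complex trigonometry and lets lam < 0, lam = 0 and lam > 0 share the same identities. *)
Definition Cr (lam t : R) : R :=
  if Rle_dec 0 lam then cos (sqrt lam * t) else cosh (sqrt (- lam) * t).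
Definition Sr (lam t : R) : R :=
  if Req_EM_T lam 0 then t
  else if Rle_dec 0 lam then sin (sqrt lam * t) / sqrt lam
  else sinh (sqrt (- lam) * t) / sqrt (- lam).

Lemma cosh_plus (a b : R) : cosh (a + b) = cosh a * cosh b + sinh a * sinh b.
Proof.
  unfold cosh, sinh. rewrite Ropp_plus_distr, !exp_plus. field.
Qed.

Lemma sinh_plus (a b : R) : sinh (a + b) = sinh a * cosh b + cosh a * sinh b.
Proof.
  unfold cosh, sinh. rewrite Ropp_plus_distr, !exp_plus. field.
Qed.

Lemma cosh2_sinh2 (a : R) : cosh a * cosh a - sinh a * sinh a = 1.
Proof.
  unfold cosh, sinh. transitivity (exp a * exp (- a)); [field|].
  rewrite <- exp_plus, Rplus_opp_r. apply exp_0.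
Qed.

Lemma sqrt_pos_neq (x : R) : 0 < x -> sqrt x <> 0.
Proof. intros H E. pose proof (sqrt_lt_R0 x H). lra. Qed.

Ltac case_lam lam :=
  unfold Sr, Cr; destruct (Req_EM_T lam 0) as [?E|?E];
  [subst lam; destruct (Rle_dec 0 0); [|exfalso; lra]; rewrite ?sqrt_0, ?Rmult_0_l
  |destruct (Rle_dec 0 lam)].

Ltac abstract_sqrt lam :=
  assert (Hr : sqrt lam * sqrt lam = lam) by (apply sqrt_sqrt; lra);
  assert (Hr0 : sqrt lam <> 0) by (apply sqrt_pos_neq; lra);
  set (kap := sqrt lam) in *; clearbody kap; rewrite <- Hr.

Ltac abstract_sqrt_opp lam :=
  assert (Hr : - (sqrt (- lam) * sqrt (- lam)) = lam) by (rewrite sqrt_sqrt; lra);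
  assert (Hr0 : sqrt (- lam) <> 0) by (apply sqrt_pos_neq; lra);
  set (kap := sqrt (- lam)) in *; clearbody kap; rewrite <- Hr.

Lemma Sr_plus (lam a b : R) : Sr lam (a + b) = Sr lam a * Cr lam b + Cr lam a * Sr lam b.
Proof.
  case_lam lam.
  - rewrite cos_0. ring.
  - rewrite Rmult_plus_distr_l, sin_plus. field. apply sqrt_pos_neq; lra.
  - rewrite Rmult_plus_distr_l, sinh_plus. field. apply sqrt_pos_neq; lra.
Qed.

Lemma Cr_plus (lam a b : R) : Cr lam (a + b) = Cr lam a * Cr lam b - lam * Sr lam a * Sr lam b.
Proof.
  case_lam lam.
  - rewrite cos_0. ring.
  - rewrite Rmult_plus_distr_l, cos_plus. abstract_sqrt lam. field. auto.
  - rewrite Rmult_plus_distr_l, cosh_plus. abstract_sqrt_opp lam. field. auto.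
Qed.

Lemma Cr2_Sr2 (lam a : R) : Cr lam a * Cr lam a + lam * (Sr lam a * Sr lam a) = 1.
Proof.
  case_lam lam.
  - rewrite cos_0. ring.
  - pose proof (sin2_cos2 (sqrt lam * a)) as H. unfold Rsqr in H.
    rewrite <- H. clear H. abstract_sqrt lam. field. auto.
  - rewrite <- (cosh2_sinh2 (sqrt (- lam) * a)).
    abstract_sqrt_opp lam. field. auto.
Qed.

Lemma Sr_0 (lam : R) : Sr lam 0 = 0.
Proof.
  case_lam lam; rewrite ?Rmult_0_r, ?sin_0, ?sinh_0; unfold Rdiv; ring.
Qed.

Lemma Cr_0 (lam : R) : Cr lam 0 = 1.
Proof. unfold Cr. rewrite !Rmult_0_r, cos_0, cosh_0. destruct (Rle_dec 0 lam); reflexivity. Qed.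

Lemma Sr_opp (lam a : R) : Sr lam (- a) = - Sr lam a.
Proof.
  case_lam lam; try reflexivity; rewrite Ropp_mult_distr_r_reverse.
  - rewrite sin_neg. unfold Rdiv. ring.
  - unfold sinh. rewrite Ropp_involutive. unfold Rdiv. ring.
Qed.

Lemma Cr_opp (lam a : R) : Cr lam (- a) = Cr lam a.
Proof.
  unfold Cr. rewrite !Ropp_mult_distr_r_reverse, cos_neg.
  destruct (Rle_dec 0 lam); auto. unfold cosh. rewrite Ropp_involutive. lra.
Qed.

Lemma is_derive_Sr (lam t : R) : is_derive (Sr lam) t (Cr lam t).
Proof.
  case_lam lam.
  - rewrite cos_0. apply is_derive_ext with (fun x => x); [reflexivity|]. apply (is_derive_id (K := R_AbsRing)).
  - auto_derive; auto. field. apply sqrt_pos_neq; lra.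
  - unfold sinh, cosh. auto_derive; auto. field. apply sqrt_pos_neq; lra.
Qed.

Lemma is_derive_Cr (lam t : R) : is_derive (Cr lam) t (- lam * Sr lam t).
Proof.
  case_lam lam.
  - apply is_derive_ext with (fun _ => 1).
    + intros x. rewrite Rmult_0_l, cos_0. reflexivity.
    + auto_derive; auto. ring.
  - auto_derive; auto. abstract_sqrt lam. field. auto.
  - unfold sinh, cosh. auto_derive; auto.
    abstract_sqrt_opp lam. field. auto.
Qed.

Lemma Cr_bound (lam t : R) : Rabs t <= 1 -> Rabs (Cr lam t) <= exp (sqrt (- lam)).
Proof.
  intros Ht. apply Rabs_le_between in Ht. unfold Cr. destruct (Rle_dec 0 lam) as [H|H].
  - apply Rle_trans with 1; [apply Rabs_le; apply COS_bound|].
    rewrite <- exp_0. pose proof (sqrt_pos (- lam)) as [H1|H1].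
    + left; now apply exp_increasing.
    + rewrite <- H1. lra.
  - assert (Hp : 0 < sqrt (- lam)) by (apply sqrt_lt_R0; lra).
    assert (Hm : forall x y, x <= y -> exp x <= exp y).
    { intros x y [E|E]; [left; now apply exp_increasing|subst; lra]. }
    unfold cosh. pose proof (exp_pos (sqrt (- lam) * t)). pose proof (exp_pos (- (sqrt (- lam) * t))).
    rewrite Rabs_pos_eq by lra.
    assert (exp (sqrt (- lam) * t) <= exp (sqrt (- lam))) by (apply Hm; nra).
    assert (exp (- (sqrt (- lam) * t)) <= exp (sqrt (- lam))) by (apply Hm; nra).
    lra.
Qed.

Lemma mean_value_bound (f df : R -> R) (B t : R) :
  (forall x, is_derive f x (df x)) -> (forall x, Rabs x <= Rabs t -> Rabs (df x) <= B) ->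
  Rabs (f t - f 0) <= B * Rabs t.
Proof.
  intros Hf HB.
  destruct (MVT_gen f 0 t df) as [x [Hx Ex]].
  - intros; auto.
  - intros x _. apply continuity_pt_filterlim. 
    apply (ex_derive_continuous (K := R_AbsRing) f x). exists (df x). auto.
  - rewrite Ex, Rminus_0_r, Rabs_mult. apply Rmult_le_compat_r; [apply Rabs_pos|].
    apply HB. revert Hx. unfold Rmin, Rmax. destruct (Rle_dec 0 t); intros [H1 H2].
    + rewrite !Rabs_pos_eq; lra.
    + rewrite !Rabs_left1; lra.
Qed.

(** The derivative of [Sr] is [Cr] and that of [Cr] is - lam [Sr], so three mean value estimates
    suffice, each fed by the previous one; |t| <= 1 allows one constant for all. *)
Lemma Sr_small (lam : R) : exists B, 0 <= B /\ forall t, Rabs t <= 1 ->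
  Rabs (Sr lam t) <= B * Rabs t /\ Rabs (Cr lam t - 1) <= B * Rabs t /\
  Rabs (Sr lam t - t) <= B * (t * t).
Proof.
  set (B0 := exp (sqrt (- lam))). pose proof (exp_pos (sqrt (- lam))) as HB0. fold B0 in HB0.
  pose proof (Rabs_pos lam) as Hl.
  assert (H1 : forall t, Rabs t <= 1 -> Rabs (Sr lam t) <= B0 * Rabs t).
  { intros t Ht. rewrite <- (Rminus_0_r (Sr lam t)), <- (Sr_0 lam).
    apply mean_value_bound with (Cr lam).
    - apply is_derive_Sr.
    - intros x Hx. apply Cr_bound. lra. }
  assert (H2 : forall t, Rabs t <= 1 -> Rabs (Cr lam t - 1) <= (Rabs lam * B0 * Rabs t) * Rabs t).
  { intros t Ht. rewrite <- (Cr_0 lam).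
    apply mean_value_bound with (fun x => - lam * Sr lam x).
    - apply is_derive_Cr.
    - intros x Hx. rewrite Rabs_mult, Rabs_Ropp, Rmult_assoc. apply Rmult_le_compat_l; auto.
      eapply Rle_trans; [apply H1; lra|]. apply Rmult_le_compat_l; lra. }
  assert (H3 : forall t, Rabs t <= 1 -> Rabs (Sr lam t - t) <= (Rabs lam * B0 * Rabs t * Rabs t) * Rabs t).
  { intros t Ht. replace (Sr lam t - t) with ((Sr lam t - t) - (Sr lam 0 - 0)) by (rewrite Sr_0; ring).
    apply (mean_value_bound (fun t => Sr lam t - t) (fun t => Cr lam t - 1)).
    - intros x. apply (is_derive_minus (K := R_AbsRing) (V := R_NormedModule) (Sr lam) (fun x => x)).
      + apply is_derive_Sr.
      + apply (is_derive_id (K := R_AbsRing)).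
    - intros x Hx. eapply Rle_trans; [apply H2; lra|]. pose proof (Rabs_pos x).
      assert (Rabs x * Rabs x <= Rabs t * Rabs t) by nra.
      assert (0 <= Rabs lam * B0) by nra. nra. }
  exists (B0 + Rabs lam * B0). split; [nra|]. intros t Ht.
  specialize (H1 t Ht). specialize (H2 t Ht). specialize (H3 t Ht).
  pose proof (Rabs_pos t) as Ht0. assert (HlB : 0 <= Rabs lam * B0) by nra.
  assert (Hsq : t * t = Rabs t * Rabs t).
  { rewrite <- Rabs_mult. symmetry; apply Rabs_pos_eq. nra. }
  rewrite Hsq. set (u := Rabs t) in *. set (v := Rabs lam * B0) in *.
  assert (0 <= u * u) by nra. assert (u * u <= u) by nra.
  assert (v * u * u <= v * u) by (rewrite Rmult_assoc; apply Rmult_le_compat_l; auto).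
  repeat split.
  - eapply Rle_trans; [exact H1|]. nra.
  - eapply Rle_trans; [exact H2|]. nra.
  - eapply Rle_trans; [exact H3|]. nra.
Qed.

Lemma sqrt_real_eq_0 (lam : R) : sqrt_real lam = 0 <-> lam = 0.
Proof.
  unfold sqrt_real. destruct (Rle_dec 0 lam) as [H|H]; split; intros E.
  - apply RtoC_inj in E. now apply sqrt_eq_0.
  - subst. now rewrite sqrt_0.
  - apply (f_equal snd) in E. simpl in E. exfalso.
    apply (sqrt_pos_neq (- lam)); lra.
  - exfalso. lra.
Qed.

Lemma Ccos_sqrt_real (lam t : R) : Ccos (sqrt_real lam * t) = Cr lam t.
Proof.
  unfold Ccos, sqrt_real, Cr. destruct (Rle_dec 0 lam).
  - apply injective_projections; simpl.
    + rewrite !Rmult_0_l, !Rmult_0_r, Rminus_0_r, Rplus_0_l, cosh_0. ring.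
    + rewrite !Rmult_0_l, !Rmult_0_r, Rplus_0_l, sinh_0. ring.
  - apply injective_projections; simpl.
    + replace ((0 * sqrt (- lam) - 1 * 0) * t - (0 * 0 + 1 * sqrt (- lam)) * 0) with 0 by ring.
      rewrite cos_0. replace ((0 * sqrt (- lam) - 1 * 0) * 0 + (0 * 0 + 1 * sqrt (- lam)) * t)
        with (sqrt (- lam) * t) by ring. ring.
    + replace ((0 * sqrt (- lam) - 1 * 0) * t - (0 * 0 + 1 * sqrt (- lam)) * 0) with 0 by ring.
      rewrite sin_0. ring.
Qed.

Lemma Csin_sqrt_real (lam t : R) : Csin (sqrt_real lam * t) = (sqrt_real lam * Sr lam t)%C.
Proof.
  unfold Csin, sqrt_real. case_lam lam.
  - apply injective_projections; simpl; 
    rewrite !Rmult_0_l, ?sin_0, ?sinh_0, ?cosh_0; ring_simplify;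
    rewrite ?sin_0, ?sinh_0; ring.
  - apply injective_projections; simpl.
    + rewrite !Rmult_0_l, !Rmult_0_r, Rminus_0_r, Rplus_0_l, cosh_0. field. apply sqrt_pos_neq; lra.
    + rewrite !Rmult_0_l, !Rmult_0_r, Rplus_0_l, sinh_0. ring.
  - apply injective_projections; simpl.
    + replace ((0 * sqrt (- lam) - 1 * 0) * t - (0 * 0 + 1 * sqrt (- lam)) * 0) with 0 by ring.
      rewrite sin_0. ring.
    + replace ((0 * sqrt (- lam) - 1 * 0) * t - (0 * 0 + 1 * sqrt (- lam)) * 0) with 0 by ring.
      rewrite cos_0. replace ((0 * sqrt (- lam) - 1 * 0) * 0 + (0 * 0 + 1 * sqrt (- lam)) * t)
        with (sqrt (- lam) * t) by ring. field. apply sqrt_pos_neq; lra.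
Qed.

Lemma sin_over_sqrt_real (lam d : R) : sin_over (sqrt_real lam) d = Sr lam d.
Proof.
  unfold sin_over. destruct (Ceq_dec (sqrt_real lam) 0) as [E|E].
  - apply sqrt_real_eq_0 in E. unfold Sr. destruct (Req_EM_T lam 0); [reflexivity|contradiction].
  - rewrite Csin_sqrt_real. field. auto.
Qed.

(** * The difference equation as a transfer matrix recursion *)

(* One step of the point-interaction problem: free propagation from x_n to
   x_(n+1), then the jump of the derivative by alpha_(n+1); it acts on the pairs
   (psi (x_n), psi' (x_n +)). *)
Definition transfer (lam : R) (x alpha : nat -> R) : mat_seq :=
  MatSeq
    (fun n => RtoC (Cr lam (x (S n) - x n)))
    (fun n => RtoC (Sr lam (x (S n) - x n)))
    (fun n => RtoC (alpha (S n) * Cr lam (x (S n) - x n) - lam * Sr lam (x (S n) - x n)))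
    (fun n => RtoC (alpha (S n) * Sr lam (x (S n) - x n) + Cr lam (x (S n) - x n))).

Lemma transfer_det (lam : R) (x alpha : nat -> R) (n : nat) :
  (m11 (transfer lam x alpha) n * m22 (transfer lam x alpha) n
   - m12 (transfer lam x alpha) n * m21 (transfer lam x alpha) n)%C = 1.
Proof.
  simpl. rewrite <- !RtoC_mult, <- RtoC_minus. f_equal.
  rewrite <- (Cr2_Sr2 lam (x (S n) - x n)). ring.
Qed.

(** Determinant 1 makes the adjugate matrix the inverse of a step. Iterated, this carries solutions
    constructed for large n down to the prescribed [N]. *)
Lemma extend_solution_one (A : mat_seq) (N : nat) (u v : nat -> C) :
  (m11 A N * m22 A N - m12 A N * m21 A N)%C = 1 ->
  solves_from A (S N) u v ->
  exists u' v', solves_from A N u' v' /\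
    forall n, (S N <= n)%nat -> u' n = u n /\ v' n = v n.
Proof.
  intros Hd Hs.
  exists (fun n => if Nat.eq_dec n N then (m22 A N * u (S N) - m12 A N * v (S N))%C else u n),
         (fun n => if Nat.eq_dec n N then (m11 A N * v (S N) - m21 A N * u (S N))%C else v n).
  split.
  - intros n Hn. destruct (Nat.eq_dec (S n) N); [lia|].
    destruct (Nat.eq_dec n N) as [->|Hne].
    + split.
      * transitivity ((m11 A N * m22 A N - m12 A N * m21 A N) * u (S N))%C; [rewrite Hd; ring|ring].
      * transitivity ((m11 A N * m22 A N - m12 A N * m21 A N) * v (S N))%C; [rewrite Hd; ring|ring].
    + apply Hs. lia.
  - intros n Hn. destruct (Nat.eq_dec n N); [lia|auto].
Qed.

Lemma extend_solution (A : mat_seq) (N k : nat) (u v : nat -> C) :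
  (forall n, (m11 A n * m22 A n - m12 A n * m21 A n)%C = 1) ->
  solves_from A (N + k) u v ->
  exists u' v', solves_from A N u' v' /\
    forall n, (N + k <= n)%nat -> u' n = u n /\ v' n = v n.
Proof.
  intros Hd. revert u v. induction k as [|k IH]; intros u v Hs.
  - rewrite Nat.add_0_r in Hs. exists u, v. auto.
  - rewrite Nat.add_succ_r in Hs.
    destruct (extend_solution_one A (N + k) u v (Hd _) Hs) as [u1 [v1 [H1 E1]]].
    destruct (IH u1 v1 H1) as [u2 [v2 [H2 E2]]].
    exists u2, v2. split; auto. intros n Hn.
    destruct (E1 n ltac:(lia)) as [<- <-]. apply E2. lia.
Qed.

(** Carries the nonvanishing of the Wronskian from large n, where the asymptotics show it, down to
    [N]. *)
Lemma wronskian_const (A : mat_seq) (N n : nat) (u1 v1 u2 v2 : nat -> C) :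
  (forall n, (m11 A n * m22 A n - m12 A n * m21 A n)%C = 1) ->
  solves_from A N u1 v1 -> solves_from A N u2 v2 -> (N <= n)%nat ->
  (u1 n * v2 n - v1 n * u2 n = u1 N * v2 N - v1 N * u2 N)%C.
Proof.
  intros Hd H1 H2 Hn. induction Hn as [|n Hn IH]; auto.
  destruct (H1 n Hn) as [-> ->]. destruct (H2 n Hn) as [-> ->]. rewrite <- IH.
  transitivity ((m11 A n * m22 A n - m12 A n * m21 A n) * (u1 n * v2 n - v1 n * u2 n))%C; [ring|].
  rewrite Hd. ring.
Qed.

(** For k = 0 admissibility says nothing, and the strict growth of the positions takes its place. *)
Lemma admissible_Sr (lam : R) (x : nat -> R) (N : nat) :
  (forall n, x n < x (n + 1)%nat) -> admissible x (sqrt_real lam) N ->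
  forall n, (N <= n)%nat -> RtoC (Sr lam (x (S n) - x n)) <> 0.
Proof.
  intros Hx Ha n Hn E. destruct (Req_EM_T lam 0) as [H0|H0].
  - unfold Sr in E. destruct (Req_EM_T lam 0); [|contradiction].
    apply RtoC_inj in E. specialize (Hx n). rewrite Nat.add_1_r in Hx. lra.
  - apply (Ha ltac:(rewrite sqrt_real_eq_0; exact H0) n Hn).
    unfold s_seq. rewrite Nat.add_1_r, Csin_sqrt_real, E. ring.
Qed.

(** Brings the cases k = 0 and k <> 0 into one form with real coefficients: the explicit k cancels
    against the k in sin (k l) = k [Sr]. *)
Lemma fd_lhs_real (lam : R) (x alpha : nat -> R) (xi : nat -> C) (n : nat) :
  RtoC (Sr lam (x (S n) - x n)) <> 0 -> RtoC (Sr lam (x (S (S n)) - x (S n))) <> 0 ->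
  fd_lhs x alpha (sqrt_real lam) xi (S n) =
  (- (xi n / Sr lam (x (S n) - x n) + xi (S (S n)) / Sr lam (x (S (S n)) - x (S n)))
   + (alpha (S n) + Cr lam (x (S n) - x n) / Sr lam (x (S n) - x n)
      + Cr lam (x (S (S n)) - x (S n)) / Sr lam (x (S (S n)) - x (S n))) * xi (S n))%C.
Proof.
  intros H1 H2. unfold fd_lhs, s_seq, c_seq. rewrite Nat.add_1_r.
  replace (S n - 1)%nat with n by lia. rewrite Nat.add_1_r.
  destruct (Ceq_dec (sqrt_real lam) 0) as [E|E].
  - apply sqrt_real_eq_0 in E. subst lam. 
    assert (HC : forall t, Cr 0 t = 1).
    { intros t. unfold Cr. destruct (Rle_dec 0 0); [|exfalso; lra].
      now rewrite sqrt_0, Rmult_0_l, cos_0. }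
    assert (HS : forall t, Sr 0 t = t).
    { intros t. unfold Sr. destruct (Req_EM_T 0 0); [auto|exfalso; auto]. }
    rewrite !HC, !HS. reflexivity.
  - rewrite !Ccos_sqrt_real, !Csin_sqrt_real. field. auto.
Qed.

Lemma transfer_is_solution (lam : R) (x alpha : nat -> R) (N : nat) (xi eta : nat -> C) :
  (forall n, x n < x (n + 1)%nat) -> admissible x (sqrt_real lam) N ->
  solves_from (transfer lam x alpha) N xi eta ->
  is_solution x alpha (sqrt_real lam) N xi.
Proof.
  intros Hx Ha Hs n Hn. destruct n as [|n]; [lia|].
  pose proof (admissible_Sr lam x N Hx Ha n ltac:(lia)) as H1.
  pose proof (admissible_Sr lam x N Hx Ha (S n) ltac:(lia)) as H2.
  rewrite fd_lhs_real; auto.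
  destruct (Hs n ltac:(lia)) as [E1 E2]. destruct (Hs (S n) ltac:(lia)) as [E3 _].
  simpl in E1, E2, E3. rewrite E3, E2, E1. rewrite RtoC_plus, RtoC_minus, !RtoC_mult.
  pose proof (Cr2_Sr2 lam (x (S n) - x n)) as H. apply (f_equal RtoC) in H.
  rewrite RtoC_plus, !RtoC_mult in H.
  set (c1 := RtoC (Cr lam (x (S n) - x n))) in *. set (s1 := RtoC (Sr lam (x (S n) - x n))) in *.
  set (c2 := RtoC (Cr lam (x (S (S n)) - x (S n)))) in *.
  set (s2 := RtoC (Sr lam (x (S (S n)) - x (S n)))) in *.
  (* After substitution of the recursion only xi_n survives, with a coefficient that vanishes by the
     Pythagorean identity. *)
  transitivity (xi n / s1 * (c1 * c1 + lam * (s1 * s1) - 1))%C.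
  - field. auto.
  - rewrite H. field. auto.
Qed.

Lemma is_solution_transfer (lam : R) (x alpha : nat -> R) (N : nat) (xi : nat -> C) :
  (forall n, x n < x (n + 1)%nat) -> admissible x (sqrt_real lam) N ->
  is_solution x alpha (sqrt_real lam) N xi ->
  exists eta, solves_from (transfer lam x alpha) N xi eta.
Proof.
  intros Hx Ha Hs.
  exists (fun n => (xi (S n) - Cr lam (x (S n) - x n) * xi n) / Sr lam (x (S n) - x n))%C.
  intros n Hn.
  pose proof (admissible_Sr lam x N Hx Ha n ltac:(lia)) as H1.
  pose proof (admissible_Sr lam x N Hx Ha (S n) ltac:(lia)) as H2.
  specialize (Hs (S n) ltac:(lia)). rewrite fd_lhs_real in Hs; auto.
  simpl. rewrite RtoC_plus, RtoC_minus, !RtoC_mult.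
  pose proof (Cr2_Sr2 lam (x (S n) - x n)) as H. apply (f_equal RtoC) in H.
  rewrite RtoC_plus, !RtoC_mult in H.
  set (c1 := RtoC (Cr lam (x (S n) - x n))) in *. set (s1 := RtoC (Sr lam (x (S n) - x n))) in *.
  set (c2 := RtoC (Cr lam (x (S (S n)) - x (S n)))) in *.
  set (s2 := RtoC (Sr lam (x (S (S n)) - x (S n)))) in *.
  split; [field; auto|].
  (* Inserting the vanishing left-hand side of the equation eliminates xi_(n+2). *)
  match type of Hs with ?l = _ =>
    transitivity ((- l + (alpha (S n) + c1 / s1) * xi (S n) - xi n / s1)%C) end.
  - field. auto.
  - rewrite Hs. 
    transitivity ((alpha (S n) + c1 / s1) * xi (S n) - xi n / s1 * (c1 * c1 + lam * (s1 * s1)))%C.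
    + rewrite H. ring.
    + field. auto.
Qed.

(** Cramer's rule with the Wronskian at [N]. Since [Sr] does not vanish, the values at N and N + 1
    determine the second component, so independence of the sequences is independence of their
    initial vectors. *)
Lemma transfer_basis (lam : R) (x alpha : nat -> R) (N : nat) (xi1 eta1 xi2 eta2 : nat -> C) :
  (forall n, x n < x (n + 1)%nat) -> admissible x (sqrt_real lam) N ->
  solves_from (transfer lam x alpha) N xi1 eta1 ->
  solves_from (transfer lam x alpha) N xi2 eta2 ->
  (xi1 N * eta2 N - eta1 N * xi2 N)%C <> 0 ->
  is_basis x alpha (sqrt_real lam) N xi1 xi2.
Proof.
  intros Hx Ha H1 H2 HW.
  set (w := (xi1 N * eta2 N - eta1 N * xi2 N)%C) in *.
  split; [|split; [|split]].
  - now apply transfer_is_solution with eta1.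
  - now apply transfer_is_solution with eta2.
  - intros a b Hab.
    pose proof (Hab N (Nat.le_refl _)) as E1. pose proof (Hab (S N) ltac:(lia)) as E2.
    destruct (H1 N (Nat.le_refl _)) as [F1 _]. destruct (H2 N (Nat.le_refl _)) as [F2 _].
    rewrite F1, F2 in E2. simpl in E2.
    pose proof (admissible_Sr lam x N Hx Ha N (Nat.le_refl _)) as HS.
    set (c := RtoC (Cr lam (x (S N) - x N))) in *. set (s := RtoC (Sr lam (x (S N) - x N))) in *.
    assert (E3 : (a * eta1 N + b * eta2 N)%C = 0).
    { apply Cmult_reg_r with s; auto.
      transitivity (a * (c * xi1 N + s * eta1 N) + b * (c * xi2 N + s * eta2 N)
        - c * (a * xi1 N + b * xi2 N))%C; [ring|]. rewrite E1, E2. ring. }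
    split; apply Cmult_reg_r with w; auto.
    + transitivity (eta2 N * (a * xi1 N + b * xi2 N) - xi2 N * (a * eta1 N + b * eta2 N))%C;
      [unfold w; ring|]. rewrite E1, E3. ring.
    + transitivity (xi1 N * (a * eta1 N + b * eta2 N) - eta1 N * (a * xi1 N + b * xi2 N))%C;
      [unfold w; ring|]. rewrite E1, E3. ring.
  - intros xi Hxi. destruct (is_solution_transfer lam x alpha N xi Hx Ha Hxi) as [eta H].
    set (a := ((xi N * eta2 N - eta N * xi2 N) / w)%C).
    set (b := ((xi1 N * eta N - eta1 N * xi N) / w)%C).
    exists a, b.
    assert (G : forall n, (N <= n)%nat ->
      xi n = (a * xi1 n + b * xi2 n)%C /\ eta n = (a * eta1 n + b * eta2 n)%C).
    { intros n Hn. induction Hn as [|n Hn [IH1 IH2]].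
      - unfold a, b. split; unfold w in *; field; auto.
      - destruct (H n Hn) as [-> ->]. destruct (H1 n Hn) as [-> ->]. destruct (H2 n Hn) as [-> ->].
        rewrite IH1, IH2. split; ring. }
    intros n Hn. now apply G.
Qed.

Lemma asymp_vanishes (xi u v eps : nat -> C) :
  vanishes eps -> eventually (fun n => xi n = ((u n + eps n) * v n)%C) -> asymp xi u v.
Proof.
  intros Heps H. exists eps. split; auto.
  intros P [e HP]. destruct (proj1 (vanishes_spec eps) Heps e (cond_pos e)) as [N HN].
  exists N. intros n Hn. apply HP. apply C_NormedModule_mixin_compat1.
  specialize (HN n Hn). change (minus (eps n) (RtoC 0)) with (eps n - 0)%C.
  replace (eps n - 0)%C with (eps n) by ring. exact HN.
Qed.

(** At a large index the Wronskian is g1 g2 (delta + o(1)), hence nonzero. As it is constant along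
    the recursion, the solutions continued back to [N] are independent. *)
Lemma asymptotic_basis_transfer (lam : R) (x alpha : nat -> R) (g1 V1 g2 V2 : nat -> C) (N : nat) :
  (forall n, x n < x (n + 1)%nat) -> admissible x (sqrt_real lam) N ->
  bdd V1 -> bdd V2 -> (forall n, g1 n <> 0) -> (forall n, g2 n <> 0) ->
  asymptotic_basis (transfer lam x alpha) g1 V1 g2 V2 ->
  exists xip xim, is_basis x alpha (sqrt_real lam) N xip xim /\
    asymp xip V1 g1 /\ asymp xim V2 g2.
Proof.
  intros Hx Ha HV1 HV2 Hg1 Hg2
    [W1 [W2 [delta [HW1 [HW2 [Hd [HD [[n1 [u1 [v1 [eu1 [ev1 [S1 [P1 [Q1 R1]]]]]]]]
      [n2 [u2 [v2 [eu2 [ev2 [S2 [P2 [Q2 R2]]]]]]]]]]]]]]]].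
  set (A := transfer lam x alpha) in *.
  set (k := Nat.max n1 n2).
  assert (Hdet : forall n, (m11 A n * m22 A n - m12 A n * m21 A n)%C = 1) by apply transfer_det.
  destruct (extend_solution A N k u1 v1 Hdet) as [u1' [v1' [S1' E1]]].
  { intros n Hn. apply S1. lia. }
  destruct (extend_solution A N k u2 v2 Hdet) as [u2' [v2' [S2' E2]]].
  { intros n Hn. apply S2. lia. }
  exists u1', u2'. split; [|split].
  - apply transfer_basis with v1' v2'; auto.
    set (D := fun n => ((V1 n + eu1 n) * (W2 n + ev2 n) - (W1 n + ev1 n) * (V2 n + eu2 n))%C).
    assert (HDv : vanishes (fun n => D n - delta)%C).
    { apply vanishes_ext with (fun n => eu1 n * (W2 n + ev2 n) + ev2 n * V1 n
         - (ev1 n * (V2 n + eu2 n) + eu2 n * W1 n))%C.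
      - intros n. unfold D. rewrite <- (HD n). ring.
      - apply vanishes_minus; apply vanishes_plus; apply vanishes_mult_bdd;
        auto using bdd_plus, vanishes_bdd. }
    destruct (eventually_nonzero D delta Hd HDv) as [N2 HN2].
    set (n := Nat.max (N + k) N2).
    destruct (E1 n ltac:(lia)) as [F1 F2]. destruct (E2 n ltac:(lia)) as [F3 F4].
    rewrite <- (wronskian_const A N n u1' v1' u2' v2' Hdet S1' S2' ltac:(lia)).
    rewrite F1, F2, F3, F4.
    destruct (R1 n) as [-> ->]. destruct (R2 n) as [-> ->].
    replace (g1 n * (V1 n + eu1 n) * (g2 n * (W2 n + ev2 n))
      - g1 n * (W1 n + ev1 n) * (g2 n * (V2 n + eu2 n)))%C with (g1 n * g2 n * D n)%C
      by (unfold D; ring).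
    repeat apply Cmult_neq_0; auto.
    apply Cmod_gt_0. eapply Rle_lt_trans; [|apply HN2; lia].
    pose proof (Cmod_ge_0 delta); lra.
  - apply asymp_vanishes with eu1; auto. exists (N + k)%nat. intros n Hn.
    destruct (E1 n Hn) as [-> _]. destruct (R1 n) as [-> _]. ring.
  - apply asymp_vanishes with eu2; auto. exists (N + k)%nat. intros n Hn.
    destruct (E2 n Hn) as [-> _]. destruct (R2 n) as [-> _]. ring.
Qed.

(* Moves the positions x_n = n d + p_n back to n d by propagating over - p_n. *)
Definition centred_transfer (lam d : R) (p alpha : nat -> R) : mat_seq :=
  let al n := alpha (S n) in
  let S0 := Sr lam d in let C0 := Cr lam d in
  let s n := Sr lam (p (S n)) in let c n := Cr lam (p (S n)) in
  let h11 n := 1 - al n * (s n * c n) in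
  let h12 n := - (al n * (s n * s n)) in
  let h21 n := al n * (c n * c n) in
  let h22 n := 1 + al n * (s n * c n) in
  MatSeq
    (fun n => RtoC (h11 n * C0 - lam * h12 n * S0))
    (fun n => RtoC (h11 n * S0 + h12 n * C0))
    (fun n => RtoC (h21 n * C0 - lam * h22 n * S0))
    (fun n => RtoC (h21 n * S0 + h22 n * C0)).

Lemma Sr_vanishes (lam : R) (p : nat -> R) :
  vanishes (fun n => RtoC (p n)) ->
  vanishes (fun n => RtoC (Sr lam (p n))) /\ vanishes (fun n => RtoC (Cr lam (p n) - 1)).
Proof.
  intros Hp. destruct (Sr_small lam) as [B [HB H]].
  destruct (proj1 (vanishes_spec _) Hp 1 ltac:(lra)) as [N HN].
  assert (HBp : is_lim_seq (fun n => B * Cmod (RtoC (p n))) 0).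
  { replace (Finite 0) with (Rbar_mult B 0) by (simpl; f_equal; ring).
    now apply is_lim_seq_scal_l. }
  split; apply vanishes_le with (fun n => B * Cmod (RtoC (p n))); auto;
  exists N; intros n Hn; specialize (HN n Hn); rewrite !Cmod_R in *; apply H; lra.
Qed.

(** Let P (t) be free propagation and J the jump at x_(n+1). Since x_(n+1) - x_n = p_(n+1) + d -
    p_n, the substitution by P (p_n) turns J P (x_(n+1) - x_n) into P (- p_(n+1)) J P (p_(n+1)) P
    (d), which is [centred_transfer]: J - I has rank one, so the conjugated jump is I + alpha (- s,
    c)^T (c, s). As P (p_n) tends to I, the asymptotics survive. *)
Lemma asymptotic_solution_centred (lam d : R) (x p alpha : nat -> R) (g V W : nat -> C) :
  (forall n, (1 <= n)%nat -> x n = INR n * d + p n) ->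
  vanishes (fun n => RtoC (p n)) -> bdd V -> bdd W ->
  asymptotic_solution (centred_transfer lam d p alpha) g V W ->
  asymptotic_solution (transfer lam x alpha) g V W.
Proof.
  intros Hx Hp HV HW [n0 [u [v [eu [ev [S1 [P1 [Q1 R1]]]]]]]].
  destruct (Sr_vanishes lam p Hp) as [HS HC].
  (* The formula for the positions starts at n = 1, so the step from x_0 is left out. *)
  exists (Nat.max 1 n0),
    (fun n => Cr lam (p n) * u n + Sr lam (p n) * v n)%C,
    (fun n => Cr lam (p n) * v n - lam * Sr lam (p n) * u n)%C,
    (fun n => eu n + RtoC (Cr lam (p n) - 1) * (V n + eu n) + Sr lam (p n) * (W n + ev n))%C,
    (fun n => ev n + RtoC (Cr lam (p n) - 1) * (W n + ev n) + RtoC (Sr lam (p n)) * (- lam * (V n + eu n)))%C.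
  split; [|split; [|split]].
  - intros n Hn. destruct (S1 n ltac:(lia)) as [-> ->].
    assert (Ex : x (S n) - x n = p (S n) + (d + - p n)).
    { rewrite !Hx by lia. rewrite S_INR. ring. }
    assert (EC : forall a b : R, Cr lam (a + (b + - p n)) =
      Cr lam a * (Cr lam b * Cr lam (p n) + lam * Sr lam b * Sr lam (p n))
      - lam * Sr lam a * (Sr lam b * Cr lam (p n) - Cr lam b * Sr lam (p n))).
    { intros a b. rewrite (Cr_plus lam a), (Cr_plus lam b), (Sr_plus lam b), Sr_opp, Cr_opp. ring. }
    assert (ES : forall a b : R, Sr lam (a + (b + - p n)) =
      Sr lam a * (Cr lam b * Cr lam (p n) + lam * Sr lam b * Sr lam (p n))
      + Cr lam a * (Sr lam b * Cr lam (p n) - Cr lam b * Sr lam (p n))).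
    { intros a b. rewrite (Sr_plus lam a), (Cr_plus lam b), (Sr_plus lam b), Sr_opp, Cr_opp. ring. }
    simpl. rewrite Ex, EC, ES.
    pose proof (Cr2_Sr2 lam (p n)) as H0. apply (f_equal RtoC) in H0.
    pose proof (Cr2_Sr2 lam (p (S n))) as H1. apply (f_equal RtoC) in H1.
    repeat rewrite ?RtoC_plus, ?RtoC_minus, ?RtoC_mult, ?RtoC_opp.
    rewrite !RtoC_plus, !RtoC_mult in H0, H1.
    set (c := RtoC (Cr lam (p n))) in *. set (s := RtoC (Sr lam (p n))) in *.
    set (c' := RtoC (Cr lam (p (S n)))) in *. set (s' := RtoC (Sr lam (p (S n)))) in *.
    set (C0 := RtoC (Cr lam d)). set (S0 := RtoC (Sr lam d)). set (l := RtoC lam) in *.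
    set (al := RtoC (alpha (S n))). clearbody c s c' s' C0 S0 l al.
    assert (E0 : (c * c = 1 - l * (s * s))%C) by (rewrite <- H0; ring).
    assert (E1 : (c' * c' = 1 - l * (s' * s'))%C) by (rewrite <- H1; ring).
    split.
    + ring [E0 E1].
    + ring [E0 E1].
  - apply vanishes_plus; [apply vanishes_plus|]; auto; apply vanishes_mult_bdd;
    auto using bdd_plus, vanishes_bdd.
  - apply vanishes_plus; [apply vanishes_plus|]; auto; apply vanishes_mult_bdd;
    auto using bdd_plus, bdd_mult, bdd_const, vanishes_bdd.
  - intros n. destruct (R1 n) as [-> ->]. rewrite !RtoC_minus. split; ring.
Qed.

(** * The two models *)

Lemma l1_dominated (a b : nat -> C) (B : R) (N : nat) :
  (forall n, (N <= n)%nat -> Cmod (a n) <= B * Cmod (b n)) -> l1 b -> l1 a.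
Proof.
  intros H Hb. apply l1_shift with N. apply l1_le with (fun n => B * Cmod (b (N + n)%nat)).
  - intros n. apply H. lia.
  - apply (ex_series_scal (V := R_NormedModule) B).
    apply (ex_series_incr_n (V := R_NormedModule) (fun n => Cmod (b n)) N). exact Hb.
Qed.

Lemma Sr_square_l1 (lam : R) (p : nat -> R) :
  vanishes (fun n => RtoC (p n)) -> l1 (fun n => RtoC (p n * p n)) ->
  l1 (fun n => RtoC (Sr lam (p n) * Sr lam (p n))).
Proof.
  intros Hp Hp2. destruct (Sr_small lam) as [B [HB H]].
  destruct (proj1 (vanishes_spec _) Hp 1 ltac:(lra)) as [N HN].
  apply l1_dominated with (fun n => RtoC (p n * p n)) (B * B) N; auto.
  intros n Hn. specialize (HN n Hn). rewrite !Cmod_R, !Rabs_mult in *.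
  destruct (H (p n) ltac:(lra)) as [H1 _].
  pose proof (Rabs_pos (Sr lam (p n))). pose proof (Rabs_pos (p n)).
  replace (B * B * (Rabs (p n) * Rabs (p n))) with ((B * Rabs (p n)) * (B * Rabs (p n))) by ring.
  apply Rmult_le_compat; auto.
Qed.

(** By the addition formula the product is half of [Sr] at 2 p, so the difference is half of Sr (2
    p) - 2 p = O (p^2). The threshold 1/2 keeps |2 p| below 1. *)
Lemma Sr_Cr_l1 (lam : R) (p : nat -> R) :
  vanishes (fun n => RtoC (p n)) -> l1 (fun n => RtoC (p n * p n)) ->
  l1 (fun n => RtoC (Sr lam (p n) * Cr lam (p n) - p n)).
Proof.
  intros Hp Hp2. destruct (Sr_small lam) as [B [HB H]].
  destruct (proj1 (vanishes_spec _) Hp (1 / 2) ltac:(lra)) as [N HN].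
  apply l1_dominated with (fun n => RtoC (p n * p n)) (2 * B) N; auto.
  intros n Hn. specialize (HN n Hn). rewrite !Cmod_R in *.
  destruct (H (p n + p n)) as [_ [_ H1]].
  { eapply Rle_trans; [apply Rabs_triang|]. lra. }
  rewrite Sr_plus in H1. rewrite (Rabs_pos_eq (p n * p n)) by nra.
  replace (Sr lam (p n) * Cr lam (p n) + Cr lam (p n) * Sr lam (p n) - (p n + p n))
    with (2 * (Sr lam (p n) * Cr lam (p n) - p n)) in H1 by ring.
  rewrite Rabs_mult, (Rabs_pos_eq 2) in H1 by lra. nra.
Qed.

(** Free propagation over d followed by the jump [alpha0]: the transfer matrix of the unperturbed
    periodic problem. *)
Definition base_mat (lam d alpha0 : R) : mat :=
  Mat (Cr lam d) (Sr lam d) (RtoC (alpha0 * Cr lam d - lam * Sr lam d))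
    (RtoC (alpha0 * Sr lam d + Cr lam d)).

(** The first-order change of the transfer matrix, P (d) being free propagation over d. Model I
    perturbs the lower left entry of the jump. Model II yields alpha0 diag (-1, 1) P (d), where
    alpha0 diag (-1, 1) is the commutator of the jump with the generator of P. *)
Definition model_mat (m : model) (lam d alpha0 : R) : mat :=
  match m with
  | ModelI => Mat (RtoC 0) (RtoC 0) (Cr lam d) (Sr lam d)
  | ModelII => Mat (RtoC (- (alpha0 * Cr lam d))) (RtoC (- (alpha0 * Sr lam d)))
                 (RtoC (- (alpha0 * (lam * Sr lam d)))) (RtoC (alpha0 * Cr lam d))
  end.

Definition offset (m : model) (c omega phi gam : R) (q : nat -> R) (n : nat) : R :=
  match m with
  | ModelI => 0
  | ModelII => perturbation c omega phi gam q n
  end.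

Lemma perturbation_S (c omega phi gam : R) (q : nat -> R) (n : nat) :
  RtoC (perturbation c omega phi gam q (S n))
  = (Cdecay gam (S n) * forcing c omega phi n + q (S n))%C.
Proof.
  unfold perturbation, Cdecay, pow_decay, forcing.
  rewrite <- RtoC_mult, <- RtoC_plus. f_equal. rewrite Rpower_Ropp. unfold Rdiv. ring.
Qed.

Lemma summable_l1 (q : nat -> R) :
  ex_series (fun n => Rabs (q (S n))) -> l1 (fun n => RtoC (q (S n))).
Proof. intros H. apply l1_le with (fun n => Rabs (q (S n))); auto. intros; rewrite Cmod_R; lra. Qed.

Lemma perturbation_small (c omega phi gam : R) (q : nat -> R) :
  1 / 2 < gam <= 1 -> ex_series (fun n => Rabs (q (S n))) ->
  vanishes (fun n => RtoC (perturbation c omega phi gam q (S n))) /\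
  l1 (fun n => RtoC (perturbation c omega phi gam q (S n) * perturbation c omega phi gam q (S n))).
Proof.
  intros Hg Hq. apply summable_l1 in Hq.
  pose proof (bdd_forcing c omega phi) as HF.
  assert (Ht : vanishes (fun n => Cdecay gam (S n))).
  { apply (vanishes_shift (Cdecay gam) 1). apply Cdecay_vanishes. lra. }
  assert (Ht2 : l1 (fun n => Cdecay gam (S n) * Cdecay gam (S n))%C).
  { apply (l1_shift (fun n => Cdecay gam n * Cdecay gam n)%C 1). apply Cdecay_square_l1. lra. }
  split.
  - apply vanishes_ext with (fun n => Cdecay gam (S n) * forcing c omega phi n + q (S n))%C.
    { intros n. now rewrite perturbation_S. }
    apply vanishes_plus; [now apply vanishes_mult_bdd|now apply l1_vanishes].
  - apply l1_ext with (fun n => (Cdecay gam (S n) * Cdecay gam (S n))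
        * (forcing c omega phi n * forcing c omega phi n)
      + q (S n) * (2 * (Cdecay gam (S n) * forcing c omega phi n) + q (S n)))%C.
    { intros n. rewrite RtoC_mult, !perturbation_S. ring. }
    apply l1_plus; apply l1_mult_bdd; auto.
    + now apply bdd_mult.
    + apply bdd_plus; [|now apply l1_bdd]. apply bdd_mult; [apply bdd_const|].
      apply bdd_mult; auto. now apply vanishes_bdd.
Qed.

Lemma offset_vanishes (m : model) (c omega phi gam : R) (q : nat -> R) :
  1 / 2 < gam <= 1 -> ex_series (fun n => Rabs (q (S n))) ->
  vanishes (fun n => RtoC (offset m c omega phi gam q n)).
Proof.
  intros Hg Hq. destruct m; simpl.
  - apply l1_vanishes, l1_zero.
  - apply (vanishes_shift (fun n => RtoC (perturbation c omega phi gam q n)) 1).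
    now apply perturbation_small.
Qed.

(** In Model I each residual is a constant multiple of [q], or 0. In Model II the entries involve s
    c, s^2 and c^2 = 1 - lam s^2, with s and c the values at p = t F + q; s^2 is summable and s c
    differs from t F by a summable sequence, so each residual is a fixed combination of these
    two. *)
Lemma centred_perturbation (m : model) (d alpha0 c omega phi gam lam : R) (q x alpha : nat -> R) :
  1 / 2 < gam <= 1 -> ex_series (fun n => Rabs (q (S n))) ->
  is_model m d alpha0 c omega phi gam q x alpha ->
  is_perturbation (centred_transfer lam d (offset m c omega phi gam q) alpha)
    (base_mat lam d alpha0) (model_mat m lam d alpha0) (Cdecay gam) (forcing c omega phi).
Proof.
  intros Hg Hq [_ Hm].
  pose proof (summable_l1 q Hq) as Hq1.
  destruct (perturbation_small c omega phi gam q Hg Hq) as [Hp Hp2].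
  destruct m.
  - assert (Hal : forall n, RtoC (alpha (S n)) =
      (alpha0 + (Cdecay gam (S n) * forcing c omega phi n + q (S n)))%C).
    { intros n. destruct (Hm (S n) ltac:(lia)) as [_ ->]. rewrite RtoC_plus, perturbation_S. reflexivity. }
    unfold is_perturbation; simpl. rewrite Sr_0, Cr_0.
    split; [|split; [|split]].
    + apply l1_ext with (fun _ => RtoC 0); [|apply l1_zero].
      intros n. repeat rewrite ?RtoC_plus, ?RtoC_minus, ?RtoC_mult, ?RtoC_opp. ring.
    + apply l1_ext with (fun _ => RtoC 0); [|apply l1_zero].
      intros n. repeat rewrite ?RtoC_plus, ?RtoC_minus, ?RtoC_mult, ?RtoC_opp. ring.
    + apply l1_ext with (fun n => q (S n) * Cr lam d)%C; [|now apply l1_mult_bdd; auto using bdd_const].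
      intros n. repeat rewrite ?RtoC_plus, ?RtoC_minus, ?RtoC_mult, ?RtoC_opp. rewrite Hal. ring.
    + apply l1_ext with (fun n => q (S n) * Sr lam d)%C; [|now apply l1_mult_bdd; auto using bdd_const].
      intros n. repeat rewrite ?RtoC_plus, ?RtoC_minus, ?RtoC_mult, ?RtoC_opp. rewrite Hal. ring.
  - assert (Hal : forall n, alpha (S n) = alpha0) by (intros n; apply (Hm (S n)); lia).
    set (p := fun n => perturbation c omega phi gam q (S n)) in *.
    pose proof (Sr_square_l1 lam p Hp Hp2) as HY. pose proof (Sr_Cr_l1 lam p Hp Hp2) as HW'.
    assert (HW : l1 (fun n => Sr lam (p n) * Cr lam (p n) - Cdecay gam (S n) * forcing c omega phi n)%C).
    { apply l1_ext with (fun n => RtoC (Sr lam (p n) * Cr lam (p n) - p n) + q (S n))%C.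
      - intros n. rewrite RtoC_minus, RtoC_mult. unfold p at 3. rewrite perturbation_S. ring.
      - now apply l1_plus. }
    assert (HC : forall n, (RtoC (Cr lam (p n)) * Cr lam (p n)
       = 1 - lam * RtoC (Sr lam (p n) * Sr lam (p n)))%C).
    { intros n. rewrite <- !RtoC_mult, <- RtoC_minus. f_equal. rewrite <- (Cr2_Sr2 lam (p n)). ring. }
    assert (Hcomb : forall a b : C, l1 (fun n =>
       (Sr lam (p n) * Cr lam (p n) - Cdecay gam (S n) * forcing c omega phi n) * a
       + RtoC (Sr lam (p n) * Sr lam (p n)) * b)%C).
    { intros a b. apply l1_plus; apply l1_mult_bdd; auto using bdd_const. }
    unfold is_perturbation; simpl.
    assert (Hpp : forall n, perturbation c omega phi gam q (S n) = p n) by reflexivity.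
    split; [|split; [|split]].
    + eapply l1_ext; [|apply (Hcomb (- (alpha0 * Cr lam d)) (lam * alpha0 * Sr lam d))%C].
      intros n. cbv beta. rewrite Hal, Hpp. repeat rewrite ?RtoC_plus, ?RtoC_minus, ?RtoC_mult, ?RtoC_opp. ring.
    + eapply l1_ext; [|apply (Hcomb (- (alpha0 * Sr lam d)) (- (alpha0 * Cr lam d)))%C].
      intros n. cbv beta. rewrite Hal, Hpp. repeat rewrite ?RtoC_plus, ?RtoC_minus, ?RtoC_mult, ?RtoC_opp. ring.
    + eapply l1_ext; [|apply (Hcomb (- (lam * alpha0 * Sr lam d)) (- (alpha0 * lam * Cr lam d)))%C].
      intros n. cbv beta. rewrite Hal, Hpp. specialize (HC n). rewrite RtoC_mult in HC.
      repeat rewrite ?RtoC_plus, ?RtoC_minus, ?RtoC_mult, ?RtoC_opp. rewrite HC. ring.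
    + eapply l1_ext; [|apply (Hcomb (alpha0 * Cr lam d) (- (alpha0 * lam * Sr lam d)))%C].
      intros n. cbv beta. rewrite Hal, Hpp. specialize (HC n). rewrite RtoC_mult in HC.
      repeat rewrite ?RtoC_plus, ?RtoC_minus, ?RtoC_mult, ?RtoC_opp. rewrite HC. ring.
Qed.

(** * Spectral data of the unperturbed matrix and coupling of its modes *)

Lemma base_eigenbasis (lam d alpha0 : R) (mu1 mu2 : C) :
  RtoC (Sr lam d) <> 0 ->
  (mu1 + mu2 = 2 * Cr lam d + alpha0 * Sr lam d)%C -> (mu1 * mu2 = 1)%C ->
  eigenbasis (base_mat lam d alpha0) mu1 mu2
    ((mu1 - Cr lam d) / Sr lam d)%C ((mu2 - Cr lam d) / Sr lam d)%C.
Proof.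
  intros HS Ht Hd. unfold base_mat.
  pose proof (Cr2_Sr2 lam d) as H. apply (f_equal RtoC) in H.
  rewrite RtoC_plus, !RtoC_mult in H.
  repeat split; simpl; rewrite ?RtoC_plus, ?RtoC_minus, ?RtoC_mult;
  set (c := RtoC (Cr lam d)) in *; set (s := RtoC (Sr lam d)) in *.
  - field. auto.
  - transitivity ((mu1 * (2 * c + alpha0 * s) - (c * c + lam * (s * s)) - mu1 * c) / s)%C.
    + field. auto.
    + rewrite H, <- Hd, <- Ht. field. auto.
  - field. auto.
  - transitivity ((mu2 * (2 * c + alpha0 * s) - (c * c + lam * (s * s)) - mu2 * c) / s)%C.
    + field. auto.
    + rewrite H, <- Hd, <- Ht. field. auto.
  - rewrite Ht. ring.
  - rewrite Hd, <- H. ring.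
Qed.

(** For [mu] = [mu2], the coordinate along the first eigenvector of K applied to the second. Growth
    rate and phase depend only on this off-diagonal coupling and its mirror image. *)
Definition resonance_coefficient (m : model) (lam d alpha0 : R) (mu1 mu2 mu : C) : C :=
  match m with
  | ModelI => (mu * Sr lam d / (mu1 - mu2))%C
  | ModelII => (- (alpha0 * mu))%C
  end.

(** In Model I, K (1, tau2) = (0, mu2) because Cr + Sr tau2 = mu2, and splitting this vector
    produces the denominator mu1 - mu2. In Model II, tau1 + tau2 = alpha0 makes K map (1, tau2) to -
    alpha0 mu2 (1, tau1): K exchanges the eigendirections, so the other coordinate is 0. *)
Lemma model_coordinates (m : model) (lam d alpha0 : R) (mu1 mu2 : C) :
  RtoC (Sr lam d) <> 0 -> mu1 <> mu2 ->
  (mu1 + mu2 = 2 * Cr lam d + alpha0 * Sr lam d)%C -> (mu1 * mu2 = 1)%C ->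
  exists k22,
  coordinates (model_mat m lam d alpha0)
    ((mu1 - Cr lam d) / Sr lam d)%C ((mu2 - Cr lam d) / Sr lam d)%C
    ((mu2 - Cr lam d) / Sr lam d)%C (resonance_coefficient m lam d alpha0 mu1 mu2 mu2) k22.
Proof.
  intros HS Hne Ht Hd.
  assert (Hdiff : (mu1 - mu2)%C <> 0).
  { intros E. apply Hne. replace mu1 with (mu1 - mu2 + mu2)%C by ring. rewrite E. ring. }
  pose proof (Cr2_Sr2 lam d) as H. apply (f_equal RtoC) in H.
  rewrite RtoC_plus, !RtoC_mult in H.
  destruct m; simpl.
  - exists (- (mu2 * Sr lam d / (mu1 - mu2)))%C. split; simpl.
    + ring.
    + field. auto.
  - exists (RtoC 0). split; simpl.
    + rewrite !RtoC_opp, !RtoC_mult. field. auto.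
    + rewrite RtoC_opp, !RtoC_mult.
      set (c := RtoC (Cr lam d)) in *. set (s := RtoC (Sr lam d)) in *.
      transitivity (- alpha0 / s * ((c * c + lam * (s * s)) - c * mu2))%C; [field; auto|].
      rewrite H, <- Hd. field. auto.
Qed.

Lemma coordinates_swap (K : mat) (tau1 tau2 tau k1 k2 : C) :
  coordinates K tau1 tau2 tau k1 k2 -> coordinates K tau2 tau1 tau k2 k1.
Proof. intros [H1 H2]. split; [rewrite H1|rewrite H2]; ring. Qed.

Definition half_trace (lam d alpha0 : R) : R := Cr lam d + alpha0 * Sr lam d / 2.

Lemma Lfun_real (lam d alpha0 : R) :
  Lfun d alpha0 (sqrt_real lam) = RtoC (half_trace lam d alpha0).
Proof.
  unfold Lfun, half_trace. rewrite Ccos_sqrt_real, sin_over_sqrt_real.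
  unfold Rdiv. rewrite RtoC_plus, !RtoC_mult, RtoC_inv by lra. field.
Qed.

(** At a zero of [Sr] the Pythagorean identity gives |Cr| = 1, and [half_trace] reduces to [Cr]. *)
Lemma Sr_neq_0 (lam d alpha0 : R) :
  Rabs (half_trace lam d alpha0) <> 1 -> Sr lam d <> 0.
Proof.
  intros H E. apply H. unfold half_trace. pose proof (Cr2_Sr2 lam d) as H0.
  rewrite E in *. replace (Cr lam d + alpha0 * 0 / 2) with (Cr lam d) by field.
  assert (H1 : Rabs (Cr lam d) * Rabs (Cr lam d) = 1) by (rewrite <- Rabs_mult, Rabs_pos_eq; nra).
  pose proof (Rabs_pos (Cr lam d)). nra.
Qed.

Lemma is_model_positions (m : model) (d alpha0 c omega phi gam : R) (q x alpha : nat -> R) (n : nat) :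
  is_model m d alpha0 c omega phi gam q x alpha -> (1 <= n)%nat ->
  x n = INR n * d + offset m c omega phi gam q n.
Proof.
  intros [_ Hm] Hn. specialize (Hm n Hn). destruct m; destruct Hm as [-> _]; simpl; ring.
Qed.

(** The distances tend to d and [Sr lam d] is nonzero, so by continuity [Sr] is nonzero at all late
    distances. *)
Lemma admissible_exists (m : model) (d alpha0 c omega phi gam lam : R) (q x alpha : nat -> R) :
  1 / 2 < gam <= 1 -> ex_series (fun n => Rabs (q (S n))) ->
  is_model m d alpha0 c omega phi gam q x alpha -> Sr lam d <> 0 ->
  exists N, admissible x (sqrt_real lam) N.
Proof.
  intros Hg Hq Hm HS.
  pose proof (offset_vanishes m c omega phi gam q Hg Hq) as Hp.
  set (p := offset m c omega phi gam q) in *.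
  assert (Hp' : is_lim_seq p 0).
  { apply is_lim_seq_abs_0. revert Hp. apply is_lim_seq_ext. intros n. apply Cmod_R. }
  assert (Hl : is_lim_seq (fun n => Sr lam (d + (p (S n) - p n))) (Sr lam d)).
  { apply (is_lim_seq_continuous (Sr lam) (fun n => d + (p (S n) - p n)) d).
    - apply continuity_pt_filterlim. apply (ex_derive_continuous (K := R_AbsRing) (Sr lam) d).
      exists (Cr lam d). apply is_derive_Sr.
    - replace (Finite d) with (Finite (d + (0 - 0))) by (f_equal; ring).
      apply is_lim_seq_plus'; [apply is_lim_seq_const|].
      apply is_lim_seq_minus'; auto. now apply (is_lim_seq_incr_1 p). }
  destruct (proj2 (is_lim_seq_spec _ (Sr lam d)) Hl
    (mkposreal (Rabs (Sr lam d)) (Rabs_pos_lt _ HS))) as [N HN].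
  (* The successor guarantees n >= 1, where the formula for the positions applies. *)
  exists (S N). intros Hk n Hn E. specialize (HN n ltac:(lia)). simpl in HN.
  apply (Rlt_irrefl (Rabs (Sr lam d))).
  eapply Rle_lt_trans; [|exact HN]. right.
  unfold s_seq in E. rewrite Nat.add_1_r, Csin_sqrt_real in E.
  assert (E0 : Sr lam (x (S n) - x n) = 0).
  { apply RtoC_inj. destruct (Ceq_dec (RtoC (Sr lam (x (S n) - x n))) 0) as [E1|E1]; auto.
    exfalso. now apply (Cmult_neq_0 _ _ Hk E1). }
  rewrite (is_model_positions m d alpha0 c omega phi gam q x alpha (S n) Hm ltac:(lia)) in E0.
  rewrite (is_model_positions m d alpha0 c omega phi gam q x alpha n Hm ltac:(lia)) in E0.
  fold p in E0. rewrite S_INR in E0.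
  replace ((INR n + 1) * d + p (S n) - (INR n * d + p n)) with (d + (p (S n) - p n)) in E0 by ring.
  rewrite E0, Rabs_minus_sym. f_equal. ring.
Qed.

Lemma model_asymptotics (m : model) (d alpha0 c omega phi gam lam : R) (q x alpha : nat -> R)
    (g1 V1 g2 V2 : nat -> C) (N : nat) :
  1 / 2 < gam <= 1 -> ex_series (fun n => Rabs (q (S n))) ->
  is_model m d alpha0 c omega phi gam q x alpha ->
  (forall n, x n < x (n + 1)%nat) -> admissible x (sqrt_real lam) N ->
  bdd V1 -> bdd V2 -> (forall n, g1 n <> 0) -> (forall n, g2 n <> 0) ->
  asymptotic_basis (centred_transfer lam d (offset m c omega phi gam q) alpha) g1 V1 g2 V2 ->
  exists xip xim, is_basis x alpha (sqrt_real lam) N xip xim /\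
    asymp xip V1 g1 /\ asymp xim V2 g2.
Proof.
  intros Hg Hq Hm Hx Ha HV1 HV2 Hg1 Hg2 [W1 [W2 [delta [HW1 [HW2 [Hd [HD [A1 A2]]]]]]]].
  apply asymptotic_basis_transfer; auto.
  pose proof (offset_vanishes m c omega phi gam q Hg Hq) as Hp.
  exists W1, W2, delta. repeat (split; [assumption|]).
  split; eapply asymptotic_solution_centred; eauto;
  intros n Hn; now apply (is_model_positions m d alpha0 c omega phi gam q x alpha n Hm).
Qed.

(** * Bases of solutions in the nonresonant and the resonant case *)

Lemma asymp_ext (xi u v v' : nat -> C) : (forall n, v n = v' n) -> asymp xi u v -> asymp xi u v'.
Proof.
  intros E [eps [H [N HN]]]. exists eps. split; auto. exists N. intros n Hn. rewrite <- E. auto.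
Qed.

Lemma square_eq (x y : C) : (x * x = y * y)%C -> x = y \/ x = (- y)%C.
Proof.
  intros H. destruct (Ceq_dec (x - y) 0) as [E|E].
  - left. replace x with (x - y + y)%C by ring. rewrite E. ring.
  - right. assert (E' : (x + y)%C = 0).
    { apply Cmult_reg_r with (x - y)%C; auto. transitivity (x * x - y * y)%C; [ring|]. rewrite H. ring. }
    replace x with (x + y - y)%C by ring. rewrite E'. ring.
Qed.

(** mu1 is y or - y, hence mu2 is y' or - y' by uniqueness of inverses. With y = exp (+- i omega)
    this shows that resonance forces |L| = |cos omega|. *)
Lemma trace_of_resonance (mu1 mu2 y y' : C) (t : R) :
  (mu1 * mu2 = 1)%C -> (y * y' = 1)%C -> (y + y' = 2 * RtoC t)%C -> (mu1 * mu1 = y * y)%C ->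
  Cmod ((mu1 + mu2) / 2) = Rabs t.
Proof.
  intros Hmu Hy Hs Hsq.
  assert (Hinv : forall a b b' : C, (a * b = 1)%C -> (a * b' = 1)%C -> b = b').
  { intros a b b' E E'. transitivity (b * (a * b'))%C; [rewrite E'; ring|].
    transitivity ((a * b) * b')%C; [ring|]. rewrite E. ring. }
  destruct (square_eq _ _ Hsq) as [E|E]; rewrite E in *.
  - rewrite (Hinv _ _ _ Hmu Hy), Hs. replace (2 * t / 2)%C with (RtoC t) by field. apply Cmod_R.
  - rewrite (Hinv (- y)%C mu2 (- y')%C Hmu) by (rewrite <- Hy; ring).
    replace ((- y + - y') / 2)%C with (- ((y + y') / 2))%C by field.
    rewrite Hs, Cmod_opp. replace (2 * t / 2)%C with (RtoC t) by field. apply Cmod_R.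
Qed.

Lemma cis_sum (a : R) : (cis a + cis (- a) = 2 * RtoC (cos a))%C.
Proof. rewrite cos_cis. field. Qed.

Lemma cis_diff (a : R) : (cis a - cis (- a) = 2 * Ci * RtoC (sin a))%C.
Proof. rewrite sin_cis. field. repeat split; apply Ci_neq_0. Qed.

(** L + w and L - w are the roots of mu^2 - 2 L mu + 1 for either square root [w], and |L| <> 1
    makes them distinct. *)
Lemma nonresonant_basis (m : model) (d alpha0 c omega phi gam lam : R) (q x alpha : nat -> R)
    (N : nat) (w : C) :
  0 < omega < PI -> 1 / 2 < gam <= 1 -> ex_series (fun n => Rabs (q (S n))) ->
  is_model m d alpha0 c omega phi gam q x alpha ->
  (forall n, x n < x (n + 1)%nat) -> admissible x (sqrt_real lam) N ->
  let L := RtoC (half_trace lam d alpha0) in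
  Cmod L <> 1 -> Cmod L <> Rabs (cos omega) -> (w * w = L * L - 1)%C ->
  exists xip xim, is_basis x alpha (sqrt_real lam) N xip xim /\
    asymp xip (fun _ => RtoC 1) (Cpow (L + w)) /\ asymp xim (fun _ => RtoC 1) (Cpow (L - w)).
Proof.
  intros Ho Hg Hq Hm Hx Ha L HL1 HL2 Hw.
  assert (HS : Sr lam d <> 0).
  { apply Sr_neq_0 with alpha0. rewrite <- Cmod_R. exact HL1. }
  assert (HSC : RtoC (Sr lam d) <> 0) by (intros E; apply HS; now apply RtoC_inj).
  assert (Hprod : ((L + w) * (L - w) = 1)%C).
  { transitivity (L * L - w * w)%C; [ring|]. rewrite Hw. ring. }
  assert (Htr : ((L + w) + (L - w) = 2 * Cr lam d + alpha0 * Sr lam d)%C).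
  { transitivity (2 * L)%C; [ring|]. unfold L, half_trace, Rdiv.
    rewrite RtoC_plus, !RtoC_mult, RtoC_inv by lra. field. }
  assert (Hhalf : (((L + w) + (L - w)) / 2)%C = L) by field.
  assert (Hne0 : (L + w)%C <> 0).
  { intros E. rewrite E in Hprod. apply (f_equal fst) in Hprod. simpl in Hprod. lra. }
  assert (Hne0' : (L - w)%C <> 0).
  { intros E. rewrite E in Hprod. apply (f_equal fst) in Hprod. simpl in Hprod. lra. }
  assert (Hne : (L + w)%C <> (L - w)%C).
  { intros E. apply HL1.
    assert (Ew : w = 0).
    { transitivity (((L + w) - (L - w)) / 2)%C; [field|]. rewrite E. field. }
    rewrite Ew in Hprod.
    assert (E1 : (L * L)%C = 1) by (rewrite <- Hprod; ring).
    apply (f_equal Cmod) in E1. rewrite Cmod_mult, Cmod_1 in E1.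
    pose proof (Cmod_ge_0 L). nra. }
  apply (model_asymptotics m d alpha0 c omega phi gam lam q x alpha); auto using bdd_const, Cpow_neq_0.
  apply nonresonant_asymptotics with (base_mat lam d alpha0) (model_mat m lam d alpha0)
    c omega phi gam (((L + w) - Cr lam d) / Sr lam d)%C (((L - w) - Cr lam d) / Sr lam d)%C; auto.
  - now apply centred_perturbation with x.
  - now apply base_eigenbasis.
  - intros E. apply HL2. rewrite <- Hhalf.
    apply (trace_of_resonance (L + w) (L - w) (cis omega) (cis (- omega)) (cos omega)); auto using cis_opp, cis_sum.
  - intros E. apply HL2. rewrite <- Hhalf.
    apply (trace_of_resonance (L + w) (L - w) (cis (- omega)) (cis omega) (cos omega)); auto.
    + rewrite Cmult_comm. apply cis_opp.
    + rewrite Cplus_comm. apply cis_sum.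
Qed.

(** A real number is its own conjugate, so its polar form holds with both signs of the angle; the
    two matching conditions use one each. For an imaginary number conjugation costs a sign. *)
Lemma is_arg_real (r a : R) : is_arg (RtoC r) a ->
  RtoC r = (Rabs r * cis a)%C /\ RtoC r = (Rabs r * cis (- a))%C.
Proof.
  unfold is_arg. rewrite Cmod_R. intros E. split; [exact E|].
  pose proof (f_equal fst E) as E1. pose proof (f_equal snd E) as E2. simpl in E1, E2.
  apply injective_projections; simpl; rewrite ?cos_neg, ?sin_neg; lra.
Qed.

Lemma is_arg_imaginary (r a : R) : is_arg (Ci * RtoC r)%C a ->
  (Ci * RtoC r = Rabs r * cis a)%C /\ (- (Ci * RtoC r) = Rabs r * cis (- a))%C.
Proof.
  unfold is_arg. rewrite Cmod_mult, Cmod_Ci, Cmod_R, Rmult_1_l. intros E. split; [exact E|].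
  pose proof (f_equal fst E) as E1. pose proof (f_equal snd E) as E2. simpl in E1, E2.
  apply injective_projections; simpl; rewrite ?cos_neg, ?sin_neg; lra.
Qed.

Lemma cis_phase (a phi : R) :
  let theta := (a + phi) / 2 in
  cis phi = (cis theta * cis theta * cis (- a))%C /\
  cis (- phi) = (cis (- theta) * cis (- theta) * cis a)%C.
Proof.
  intros theta. rewrite <- !cis_plus. split; f_equal; unfold theta; field.
Qed.

(** Unifies L = cos omega and L = - cos omega as L = [sg] cos omega. In Model II the eigenvalue
    factor [sg] stands on both sides of the matching condition and cancels, hence no sign there. *)
Definition signed_phase (m : model) (sg : R) (lam d alpha0 c : R) : C :=
  match m with
  | ModelI => RtoC (- (sg * (c * Sr lam d)))
  | ModelII => (Ci * RtoC (c * alpha0))%C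
  end.

Definition growth_rate (m : model) (lam d alpha0 c omega : R) : R :=
  match m with
  | ModelI => Rabs (c * Sr lam d) / (4 * sin omega)
  | ModelII => Rabs (c * alpha0) / 2
  end.

(** In Model I the coefficient is z^(-1) S / (2 i sin omega), with S = [Sr lam d], so the first
    condition says - sg c S exp (i phi) / (4 sin omega) = beta exp (2 i theta); in Model II it says
    i c alpha0 exp (i phi) / 2 = beta exp (2 i theta). Modulus and argument give beta and theta. The
    second condition is the complex conjugate of the first. *)
Lemma resonance_identities (m : model) (d alpha0 c omega phi lam a sg : R) :
  0 < omega < PI -> sg * sg = 1 ->
  is_arg (signed_phase m sg lam d alpha0 c) a ->
  let theta := (a + phi) / 2 in
  let s := RtoC sg in
  let mu1 := (s * cis omega)%C in let mu2 := (s * cis (- omega))%C in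
  let beta := RtoC (growth_rate m lam d alpha0 c omega) in
  (c * cis phi / (2 * Ci) * cis (- theta) * cis omega
     * resonance_coefficient m lam d alpha0 mu1 mu2 mu2 = beta * s * cis theta)%C /\
  (- (c * cis (- phi) / (2 * Ci)) * cis theta * cis (- omega)
     * resonance_coefficient m lam d alpha0 mu2 mu1 mu1 = beta * s * cis (- theta))%C.
Proof.
  intros Ho Hsg Harg theta s mu1 mu2 beta.
  destruct (cis_phase a phi) as [Ep Em]. fold theta in Ep, Em.
  pose proof (cis_opp theta) as Ht. pose proof (cis_opp omega) as Hz.
  pose proof (cis_diff omega) as Hdiff.
  pose proof (sin_gt_0 omega ltac:(lra) ltac:(lra)) as Hsin.
  assert (Hsin' : RtoC (sin omega) <> 0) by (intros E; apply RtoC_inj in E; lra).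
  assert (Hss : (s * s)%C = 1) by (unfold s; rewrite <- RtoC_mult, Hsg; reflexivity).
  assert (Hs0 : s <> 0).
  { intros E. rewrite E in Hss. apply (f_equal fst) in Hss. simpl in Hss. lra. }
  assert (HCi : (Ci * Ci = - (1))%C).
  { apply injective_projections; simpl; ring. }
  pose proof Ci_neq_0 as HCi0.
  assert (Hd12 : (mu1 - mu2 = s * (2 * Ci * sin omega))%C).
  { unfold mu1, mu2. rewrite <- Hdiff. ring. }
  assert (Hd21 : (mu2 - mu1 = - (s * (2 * Ci * sin omega)))%C).
  { rewrite <- Hd12. ring. }
  destruct m; simpl in Harg; unfold resonance_coefficient, beta, growth_rate.
  - apply is_arg_real in Harg. destruct Harg as [A1 A2].
    assert (Habs : Rabs (- (sg * (c * Sr lam d))) = Rabs (c * Sr lam d)).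
    { rewrite Rabs_Ropp, Rabs_mult. assert (Rabs sg = 1).
      { pose proof (Rabs_pos sg). assert (Rabs sg * Rabs sg = 1) by (rewrite <- Rabs_mult, Hsg; apply Rabs_R1).
        nra. }
      rewrite H. ring. }
    rewrite Habs in A1, A2. unfold Rdiv. rewrite RtoC_mult, RtoC_inv, RtoC_mult by lra.
    rewrite RtoC_opp, !RtoC_mult in A1, A2. fold s in A1, A2.
    rewrite Hd12, Hd21. rewrite Ep, Em. unfold mu1, mu2.
    set (b := RtoC (Rabs (c * Sr lam d))) in *. set (S0 := RtoC (Sr lam d)) in *.
    set (so := RtoC (sin omega)) in *.
    set (z := cis omega) in *. set (z' := cis (- omega)) in *.
    set (th := cis theta) in *. set (th' := cis (- theta)) in *.
    set (ca := cis a) in *. set (ca' := cis (- a)) in *.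
    assert (Hca : (ca * ca' = 1)%C) by apply cis_opp.
    assert (B1 : (- (s * (c * S0)) * ca' = b)%C) by (rewrite A1, <- Cmult_assoc, Hca; ring).
    assert (B2 : (- (s * (c * S0)) * ca = b)%C).
    { rewrite A2, <- Cmult_assoc, (Cmult_comm ca'), Hca; ring. }
    split.
    + transitivity ((th * th') * (z * z') * (s * s) * (c * S0 * ca') * th / (4 * (Ci * Ci) * so) * / (s * s))%C.
      { field. repeat split; auto. }
      rewrite Ht, Hz, HCi, <- B1, !Hss. rewrite <- Hss. field. auto.
    + transitivity ((th * th') * (z * z') * (s * s) * (c * S0 * ca) * th' / (4 * (Ci * Ci) * so) * / (s * s))%C.
      { field. repeat split; auto. }
      rewrite Ht, Hz, HCi, <- B2, !Hss. rewrite <- Hss. field. auto.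
  - apply is_arg_imaginary in Harg. destruct Harg as [A1 A2].
    unfold Rdiv. rewrite RtoC_mult, RtoC_inv by lra.
    rewrite RtoC_mult in A1, A2. rewrite Ep, Em. unfold mu1, mu2.
    set (b := RtoC (Rabs (c * alpha0))) in *.
    set (z := cis omega) in *. set (z' := cis (- omega)) in *.
    set (th := cis theta) in *. set (th' := cis (- theta)) in *.
    set (ca := cis a) in *. set (ca' := cis (- a)) in *.
    assert (Hca : (ca * ca' = 1)%C) by apply cis_opp.
    assert (B1 : (Ci * (c * alpha0) * ca' = b)%C) by (rewrite A1, <- Cmult_assoc, Hca; ring).
    assert (B2 : (- (Ci * (c * alpha0)) * ca = b)%C).
    { rewrite A2, <- Cmult_assoc, (Cmult_comm ca'), Hca; ring. }
    split.
    + transitivity ((th * th') * (z * z') * (- (c * alpha0 * ca')) * s * th * Ci / (2 * (Ci * Ci)))%C.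
      { field. repeat split; auto. }
      rewrite Ht, Hz, HCi, <- B1. field.
    + transitivity ((th * th') * (z * z') * (c * alpha0 * ca) * s * th' * Ci / (2 * (Ci * Ci)))%C.
      { field. repeat split; auto. }
      rewrite Ht, Hz, HCi, <- B2. field.
Qed.

Lemma resonant_basis (m : model) (d alpha0 c omega phi gam lam a sg : R) (q x alpha : nat -> R)
    (N : nat) :
  0 < omega < PI -> omega <> PI / 2 -> 1 / 2 < gam <= 1 ->
  ex_series (fun n => Rabs (q (S n))) ->
  is_model m d alpha0 c omega phi gam q x alpha ->
  (forall n, x n < x (n + 1)%nat) -> admissible x (sqrt_real lam) N ->
  Rabs (half_trace lam d alpha0) <> 1 ->
  sg * sg = 1 -> half_trace lam d alpha0 = sg * cos omega ->
  is_arg (signed_phase m sg lam d alpha0 c) a ->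
  let theta := (a + phi) / 2 in
  let beta := growth_rate m lam d alpha0 c omega in
  exists xip xim, is_basis x alpha (sqrt_real lam) N xip xim /\
    asymp xip (fun n => RtoC (cos (omega * INR n + theta)))
      (fun n => RtoC (sg ^ n * f_growth gam beta n)) /\
    asymp xim (fun n => RtoC (sin (omega * INR n + theta)))
      (fun n => RtoC (sg ^ n * f_growth gam (- beta) n)).
Proof.
  intros Ho Ho2 Hg Hq Hm Hx Ha HL1 Hsg HL Harg theta beta.
  assert (HS : Sr lam d <> 0) by (apply Sr_neq_0 with alpha0; exact HL1).
  assert (HSC : RtoC (Sr lam d) <> 0) by (intros E; apply HS; now apply RtoC_inj).
  set (s := RtoC sg).
  assert (Hss : (s * s)%C = 1) by (unfold s; rewrite <- RtoC_mult, Hsg; reflexivity).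
  assert (Hs0 : s <> 0).
  { intros E. rewrite E in Hss. apply (f_equal fst) in Hss. simpl in Hss. lra. }
  set (mu1 := (s * cis omega)%C). set (mu2 := (s * cis (- omega))%C).
  assert (Hprod : (mu1 * mu2 = 1)%C).
  { unfold mu1, mu2. transitivity ((s * s) * (cis omega * cis (- omega)))%C; [ring|].
    rewrite Hss, cis_opp. ring. }
  assert (Htr : (mu1 + mu2 = 2 * Cr lam d + alpha0 * Sr lam d)%C).
  { transitivity (s * (cis omega + cis (- omega)))%C; [unfold mu1, mu2; ring|].
    rewrite cis_sum. unfold s. rewrite <- !RtoC_mult, <- RtoC_plus. f_equal.
    transitivity (2 * half_trace lam d alpha0); [rewrite HL; ring|]. unfold half_trace. field. }
  assert (Hne : mu1 <> mu2).
  { intros E. apply (cis_double_neq_1 omega Ho).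
    transitivity (mu1 * mu1)%C.
    - unfold mu1. transitivity ((s * s) * (cis omega * cis omega))%C; [rewrite Hss; ring|ring].
    - rewrite E at 2. exact Hprod. }
  destruct (model_coordinates m lam d alpha0 mu1 mu2 HSC Hne Htr Hprod) as [k22 K2].
  destruct (model_coordinates m lam d alpha0 mu2 mu1 HSC) as [k11 K1]; auto.
  { rewrite Cplus_comm. exact Htr. }
  { rewrite Cmult_comm. exact Hprod. }
  apply coordinates_swap in K1.
  destruct (resonance_identities m d alpha0 c omega phi lam a sg Ho Hsg Harg) as [R1 R2].
  fold theta beta s mu1 mu2 in R1, R2.
  assert (Hb : 0 <= beta).
  { pose proof (sin_gt_0 omega ltac:(lra) ltac:(lra)) as Hsin. unfold beta, growth_rate.
    destruct m; apply Rmult_le_pos; try apply Rabs_pos; left; apply Rinv_0_lt_compat; lra. }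
  assert (Hpow : forall b n, (s ^ n * f_growth gam b n)%C = RtoC (sg ^ n * f_growth gam b n)).
  { intros b n. rewrite RtoC_mult, RtoC_pow. reflexivity. }
  assert (Hfne : forall b n, (s ^ n * f_growth gam b n)%C <> 0).
  { intros b n. apply Cmult_neq_0; [now apply Cpow_neq_0|].
    intros E. apply RtoC_inj in E. pose proof (f_growth_pos gam b n). lra. }
  assert (Hbc : forall f : R -> R, (forall t, -1 <= f t <= 1) ->
    bdd (fun n => RtoC (f (omega * INR n + theta)))).
  { intros f Hf. exists 1. intros n. rewrite Cmod_R. apply Rabs_le. apply Hf. }
  destruct (model_asymptotics m d alpha0 c omega phi gam lam q x alpha
    (fun n => s ^ n * f_growth gam beta n)%C (fun n => RtoC (cos (omega * INR n + theta)))
    (fun n => s ^ n * f_growth gam (- beta) n)%C (fun n => RtoC (sin (omega * INR n + theta))) N)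
    as [xip [xim [HB [A1 A2]]]]; auto using COS_bound, SIN_bound.
  - apply (resonant_asymptotics _ (base_mat lam d alpha0) (model_mat m lam d alpha0)
      c omega phi gam beta theta s ((mu1 - Cr lam d) / Sr lam d)%C ((mu2 - Cr lam d) / Sr lam d)%C
      k11 (resonance_coefficient m lam d alpha0 mu1 mu2 mu2)
      (resonance_coefficient m lam d alpha0 mu2 mu1 mu1) k22); auto.
    + now apply centred_perturbation with x.
    + now apply base_eigenbasis.
  - exists xip, xim. split; [exact HB|].
    split; (eapply asymp_ext; [apply Hpow|assumption]).
Qed.

Lemma beta_exp_real (m : model) (d alpha0 c omega lam : R) :
  0 < omega < PI ->
  beta_exp m d alpha0 c omega (sqrt_real lam) = growth_rate m lam d alpha0 c omega.
Proof.
  intros Ho. pose proof (sin_gt_0 omega ltac:(lra) ltac:(lra)) as Hsin.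
  destruct m; simpl.
  - rewrite sin_over_sqrt_real, <- RtoC_mult, Cmod_div, !Cmod_R.
    + rewrite (Rabs_pos_eq (4 * sin omega)) by lra. reflexivity.
    + intros E. apply RtoC_inj in E. lra.
  - unfold Rdiv. rewrite Rabs_mult, (Rabs_pos_eq (/ 2)) by lra. reflexivity.
Qed.

Theorem theorem3p3
  (m : model) (d alpha0 c omega phi gam lam : R) (q x alpha : nat -> R)
  (hd : 0 < d)
  (hc : c <> 0)
  (homega : 0 < omega < PI) (homega2 : omega <> PI / 2)
  (hphi : 0 <= phi < 2 * PI)
  (hgam : 1 / 2 < gam <= 1)
  (hq : ex_series (fun n => Rabs (q (S n))))
  (hmodel : is_model m d alpha0 c omega phi gam q x alpha)
  (hx : forall n : nat, x n < x (n + 1)%nat)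
  (hinf : Rbar_lt 0 (Inf_seq (fun n => Rabs (x (S n + 1)%nat - x (S n)))))
  (hsup : Rbar_lt (Sup_seq (fun n => Rabs (x (S n + 1)%nat - x (S n)))) p_infty) :
  let k := sqrt_real lam in
  let L := Lfun d alpha0 k in
  let beta := beta_exp m d alpha0 c omega k in
  Cmod L <> 1 ->
  (exists N : nat, admissible x k N) /\
  forall N : nat, admissible x k N ->
    (Cmod L <> Rabs (cos omega) ->
     forall w : C, (w * w)%C = (L * L - 1)%C ->
     exists xip xim : nat -> C,
       is_basis x alpha k N xip xim /\
       asymp xip (fun _ => RtoC 1) (fun n => Cpow (L + w) n) /\
       asymp xim (fun _ => RtoC 1) (fun n => Cpow (L - w) n))
    /\
    (L = cos omega ->
     forall a : R, is_arg (phase_plus m d alpha0 c k) a ->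
     let theta := (a + phi) / 2 in
     exists xip xim : nat -> C,
       is_basis x alpha k N xip xim /\
       asymp xip (fun n => RtoC (cos (omega * INR n + theta)))
                 (fun n => RtoC (f_growth gam beta n)) /\
       asymp xim (fun n => RtoC (sin (omega * INR n + theta)))
                 (fun n => RtoC (f_growth gam (- beta) n)))
    /\
    (L = - cos omega ->
     forall a : R, is_arg (phase_minus m d alpha0 c k) a ->
     let theta := (a + phi) / 2 in
     exists xip xim : nat -> C,
       is_basis x alpha k N xip xim /\
       asymp xip (fun n => RtoC (cos (omega * INR n + theta)))
                 (fun n => RtoC ((-1) ^ n * f_growth gam beta n)) /\
       asymp xim (fun n => RtoC (sin (omega * INR n + theta)))
                 (fun n => RtoC ((-1) ^ n * f_growth gam (- beta) n))).
Proof.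
  intros k L beta HL.
  assert (EL : L = RtoC (half_trace lam d alpha0)) by apply Lfun_real.
  assert (Eb : beta = growth_rate m lam d alpha0 c omega) by (apply beta_exp_real; exact homega).
  assert (HLr : Rabs (half_trace lam d alpha0) <> 1) by (rewrite <- Cmod_R, <- EL; exact HL).
  split.
  { apply (admissible_exists m d alpha0 c omega phi gam lam q x alpha); auto.
    now apply Sr_neq_0 with alpha0. }
  intros N HN. rewrite Eb. clearbody L. subst L. split; [|split].
  - intros HL2 w Hw.
    now apply (nonresonant_basis m d alpha0 c omega phi gam lam q x alpha).
  - intros HLc a Ha theta. apply RtoC_inj in HLc.
    destruct (resonant_basis m d alpha0 c omega phi gam lam a 1 q x alpha N)
      as [xip [xim [HB [A1 A2]]]]; auto; try lra.
    + revert Ha. unfold phase_plus, k. destruct m; simpl.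
      * rewrite sin_over_sqrt_real, Rmult_1_l, RtoC_opp, RtoC_mult. auto.
      * rewrite RtoC_mult, Cmult_assoc. auto.
    + exists xip, xim. split; [exact HB|].
      split; eapply asymp_ext; eauto; intros n; cbv beta; now rewrite pow1, Rmult_1_l.
  - intros HLc a Ha theta. apply RtoC_inj in HLc.
    destruct (resonant_basis m d alpha0 c omega phi gam lam a (-1) q x alpha N)
      as [xip [xim [HB [A1 A2]]]]; auto; try lra.
    + revert Ha. unfold phase_minus, k. destruct m; simpl.
      * rewrite sin_over_sqrt_real, <- RtoC_mult.
        replace (- (-1 * (c * Sr lam d))) with (c * Sr lam d) by ring. auto.
      * rewrite RtoC_mult, Cmult_assoc. auto.
    + exists xip, xim. auto.
Qed.
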